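(* Suppose that $\mathbb Q\subseteq\Bbbk$. Then the algebra $\mathcal A^+_{\mathrm{loc}}=\mathcal A^+\otimes_R\operatorname{Frac}R$ is spherically generated. In particular, the same is true of the shuffle algebra $\mathcal S\cong\mathcal A^+$, i.e. $\mathcal S_{\mathrm{loc}}=\mathcal S\otimes_R\operatorname{Frac}R$ is spherically generated.
   Context: Conventions. $\Bbbk$ is a commutative ring, $\mathbb N=\{0,1,2,\dots\}$, $[n]=\{1,\dots,n\}$. $Q=(I,E)$ is a finite quiver (edge loops and multiple edges allowed) with source and target maps $\mathsf s,\mathsf t:E\to I$; $e:i\to j$ means $\mathsf s(e)=i,\mathsf t(e)=j$; $a_{ij}$ is the number of edges $i\to j$ and $c_{ij}=2\delta_{ij}-a_{ij}-a_{ji}$. $\{\alpha_i\}_{i\in I}$ is the standard basis of $\mathbb Z^I$. On $\mathbb Z^I$, $\mathbf v'\le\mathbf v$ means $v'_i\le v_i$ for all $i$, and $(\mathbf v',\mathbf v)=\sum_{i,j}c_{ij}v'_iv_j$. $R=\Bbbk[\tfrac12\hbar,\theta_e:e\in E]$ is a polynomial ring in variables $\tfrac12\hbar,\theta_e$; $\operatorname{Frac}R$ is its fraction ring. An $\mathbb N^I$-graded algebra $B$ is spherically generated if it is generated by its homogeneous components $B_{\mathbf 0}$ and $B_{\alpha_i}$, $i\in I$. ($R$ is placed in $\mathbb N^I$-degree $\mathbf 0$.) Difference operators. For $\mathbf v=(v_i)\in\mathbb N^I$ let $\widetilde\Lambda(\mathbf v)=R[w_{i,r}:i\in I,r\in[v_i]]$,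 on which $S_{\mathbf v}=\prod_iS_{v_i}$ acts by permuting the $w_{i,r}$ for each $i$. Let $\widetilde A(\mathbf v)$ be the $R$-algebra generated by $w_{i,r},u_{i,r}$ with relations $u_{i,r}w_{j,s}=(w_{j,s}+\hbar\delta_{ij}\delta_{rs})u_{i,r}$, $[u_{i,r},u_{j,s}]=[w_{i,r},w_{j,s}]=0$, and $\widetilde A(\mathbf v)_{loc}$ its Ore localization at the multiplicative set generated by $w_{i,r}-w_{i,s}+n\hbar$ ($r\ne s$, $n\in\mathbb Z$). Positive part of quantized zastava. Inside the Braverman–Finkelberg–Nakajima quantized zastava $\mathcal A(\mathbf v)$, viewed inside $\widetilde A(\mathbf v)_{loc}^{S_{\mathbf v}}$ via the GKLO embedding: for $\mathbf 0\le\mathbf m\le\mathbf v$ and $f\in R[w_{i,r}:i\in I,r\in[m_i]]^{S_{\mathbf m}}$, put $$\mathsf M_{\mathbf m}(f)=\sum_{\Gamma}f|_\Gamma\cdot\frac{\prod_{e\in E}\prod_{r\in\Gamma_{\mathsf s(e)},\,s\in[v_{\mathsf t(e)}]\setminus\Gamma_{\mathsf t(e)}}(w_{\mathsf t(e),s}-w_{\mathsf s(e),r}+\theta_e-\tfrac12\hbar)}{\prod_{i\in I}\prod_{r\in\Gamma_i,\,s\in[v_i]\setminus\Gamma_i}(w_{i,r}-w_{i,s})}\prod_{i\in I}\prod_{r\in\Gamma_i}u_{i,r},$$ sum over tuples $\Gamma=(\Gamma_i)_{i\in I}$, $\Gamma_i\subseteq[v_i]$, $\#\Gamma_i=m_i$,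 with $f|_\Gamma=\sigma(f)$ for any $\sigma\in S_{\mathbf v}$ with $\sigma_i([m_i])=\Gamma_i$. $\mathcal A^+(\mathbf v)$ is the subring generated by these elements. It is $\mathbb Z^I\times\mathbb Z$-graded with $\deg\mathsf M_{\mathbf m}(f)=(\mathbf m,\deg f+\tfrac12(\mathbf m,\mathbf m))$, where $\tfrac12\hbar,\theta_e,w_{i,r}$ have degree $1$ in polynomial rings. For $\mathbf v\ge\mathbf v'$ there is a graded ring surjection $\mathcal A^+(\mathbf v)\twoheadrightarrow\mathcal A^+(\mathbf v')$ determined by $\mathsf M_{\mathbf m}(f)\mapsto\mathsf M_{\mathbf m}(f)$ if $\mathbf m\le\mathbf v'$ and $\mathsf M_{\mathbf m}(f)\mapsto0$ otherwise. $\mathcal A^+=\varprojlim\mathcal A^+(\mathbf v)$ in the category of $\mathbb Z^I\times\mathbb Z$-graded rings (degreewise limit). Big shuffle algebra. For $\mathbf k\in\mathbb N^I$ let ${}^{\mathrm{big}}\mathcal S_{\mathbf k}=R[x_{i,a}:i\in I,1\le a\le k_i]^{S_{\mathbf k}}$, ${}^{\mathrm{big}}\mathcal S=\bigoplus_{\mathbf k}{}^{\mathrm{big}}\mathcal S_{\mathbf k}$. Put $$\zeta_{i,j}(x)=\Big(\frac{x-\hbar}x\Big)^{\delta_{ij}}\prod_{e:i\to j}(-x+\theta_e-\tfrac12\hbar)\prod_{e:j\to i}(x+\theta_e+\tfrac12\hbar).$$ The shuffle product of $f\in{}^{\mathrm{big}}\mathcal S_{\mathbf k'}$, $g\in{}^{\mathrm{big}}\mathcal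 S_{\mathbf k''}$ is $$\sum_{\sigma\in S_{\mathbf k'+\mathbf k''}/(S_{\mathbf k'}\times S_{\mathbf k''})}\sigma\Big(f(\{x_{i,a}\}_{1\le a\le k'_i})\,g(\{x_{i,b}\}_{k'_i<b\le k'_i+k''_i})\prod_{i,j\in I}\prod_{1\le a\le k'_i,\ k'_j<b\le k'_j+k''_j}\zeta_{i,j}(x_{i,a}-x_{j,b})\Big).$$ Shuffle algebra. For $m,n\ge0$ put $x^{\underline m\cdot\overline n}=\prod_{0\le r<m,0\le s<n}(x+(s-r)\hbar)$. For a tuple $A=(A_i)_{i\in I}$ of functions $A_i:[v_i]\to\mathbb N$ put $|A|=(\sum_rA_i(r))_i$; for $f\in{}^{\mathrm{big}}\mathcal S_{|A|}$, $f|_A\in\widetilde\Lambda(\mathbf v)$ is obtained by specializing, for each $i$, the variables $x_{i,a}$ to the values $\bigcup_{r\in[v_i]}\{w_{i,r},w_{i,r}+\hbar,\dots,w_{i,r}+(A_i(r)-1)\hbar\}$. $\mathcal S_{\mathbf k}$ is the set of $f\in{}^{\mathrm{big}}\mathcal S_{\mathbf k}$ satisfying the refined wheel conditions: for all $\mathbf v\in\mathbb N^I$ and all tuples $A=(A_i)_{i\in I}$ of functions $A_i:[v_i]\to\mathbb N$ with $|A|=\mathbf k$, every edge $e:i\to j$, $r\in[v_i]$, $s\in[v_j]$ (including $i=j$, $r=s$), $f|_A$ is divisible by $(w_{j,s}-w_{i,r}+\theta_e-\tfrac12\hbar)^{\underline{A_i(r)-1}\cdot\overline{A_j(s)}}$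 if $A_i(r)\ge A_j(s)$, and by $(w_{j,s}-w_{i,r}+\theta_e+\tfrac12\hbar)^{\underline{A_i(r)}\cdot\overline{A_j(s)-1}}$ if $A_i(r)\le A_j(s)$ (conditions with an exponent $-1$ are vacuous). $\mathcal S=\bigoplus_{\mathbf k}\mathcal S_{\mathbf k}$ is a subring of ${}^{\mathrm{big}}\mathcal S$, $\mathbb N^I$-graded by $\mathbf k$. *)

(* Defs.v *)
From HB Require Import structures.
From mathcomp Require Import all_boot all_order all_algebra.
From mathcomp Require Import perm generic_quotient finmap.
From mathcomp Require Import boolp.
From mathcomp Require Import monalg ring.

Set Implicit Arguments.
Unset Strict Implicit.
Unset Printing Implicit Defensive.

Import GRing.Theory.
Local Open Scope ring_scope.

Record central_mulset (B : pzRingType) := CentralMulset {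
  cms :> B -> Prop;
  cms1 : cms 1;
  cmsM : forall s t, cms s -> cms t -> cms (s * t);
  cmsC : forall s b, cms s -> s * b = b * s
}.

Section Localization.
Variables (B : pzRingType) (S : central_mulset B).

Lemma cmsCA s b c : S s -> s * (b * c) = b * (s * c).
Proof. by move=> Ss; rewrite mulrA (cmsC _ Ss) mulrA. Qed.
Arguments cmsCA : clear implicits.

Definition locpair := {bs : B * B | `[< S bs.2 >]}.

Definition loc_equiv (x y : locpair) : bool :=
  `[< exists2 u, S u
      & u * ((val y).2 * (val x).1) = u * ((val x).2 * (val y).1) >].

Lemma locpairP (x : locpair) : S (val x).2.
Proof. by case: x => x /= /asboolP. Qed.

Lemma loc_equiv_refl : reflexive loc_equiv.
Proof. by move=> x; apply/asboolP; exists 1 => //; exact: cms1. Qed.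

Lemma loc_equiv_sym : symmetric loc_equiv.
Proof.
by move=> x y; apply/asboolP/asboolP => -[u Su e]; exists u.
Qed.

Lemma loc_equiv_trans : transitive loc_equiv.
Proof.
move=> y x z /asboolP[u Su e] /asboolP[v Sv e']; apply/asboolP.
have [Sx Sy Sz] := And3 (locpairP x) (locpairP y) (locpairP z).
move: Sx Sy Sz e e'.
case: (val x) (val y) (val z) => a s [b t] [c r] /= Ss St Sr e e'.
exists (u * v * t); first by do 2?apply: cmsM.
rewrite -!mulrA (cmsCA t r a St) (cmsCA v r _ Sv) (cmsCA u r _ Su).
rewrite (cmsCA u v _ Su) e (cmsCA t s _ St) (cmsCA v s _ Sv) (cmsCA u s _ Su).
rewrite -e' (cmsCA u s _ Su) (cmsCA v s _ Sv) (cmsCA r s _ Sr); congr (_ * _).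
by rewrite (cmsCA v r _ Sv) (cmsCA u r _ Su) (cmsCA u v _ Su).
Qed.

Canonical loc_equivr :=
  EquivRel loc_equiv loc_equiv_refl loc_equiv_sym loc_equiv_trans.

Definition loc := {eq_quot loc_equivr}%qT.

HB.instance Definition _ : EqQuotient _ loc_equivr loc := EqQuotient.on loc.
HB.instance Definition _ := Choice.on loc.

Definition locpair0 : locpair := exist _ (0, 1) (asboolT (cms1 S)).

(* The fraction b / s; the junk value when s is not in S is 0. *)
Definition frac (b s : B) : loc := (\pi_loc (insubd locpair0 (b, s)))%qT.

Lemma fracP (x : loc) : exists b s, S s /\ x = frac b s.
Proof.
elim/quotW: x => x; exists (val x).1, (val x).2; split; first exact: locpairP.
rewrite /frac; congr (\pi_loc _)%qT; apply: val_inj.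
by rewrite val_insubd -surjective_pairing (valP x).
Qed.

Lemma frac_eq a s b t : S s -> S t ->
  frac a s = frac b t <-> exists2 u, S u & u * (t * a) = u * (s * b).
Proof.
move=> Ss St; rewrite /frac; split.
  move/eqmodP => /asboolP; rewrite !val_insubd /=.
  by rewrite /= !asboolT.
move=> e; apply/eqmodP/asboolP; rewrite !val_insubd /=.
by rewrite /= !asboolT.
Qed.

Lemma fracE a s b t : S s -> S t -> t * a = s * b -> frac a s = frac b t.
Proof. by move=> Ss St e; apply/(frac_eq _ _ Ss St); exists 1; rewrite ?e //; exact: cms1. Qed.

Definition num (x : loc) : B := (val (repr x)).1.
Definition den (x : loc) : B := (val (repr x)).2.

Lemma denP x : S (den x). Proof. exact: locpairP. Qed.
Hint Resolve denP : core.

Lemma num_den x : x = frac (num x) (den x).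
Proof.
rewrite -[LHS]reprK /frac; congr (\pi_loc _)%qT; apply: val_inj.
by rewrite val_insubd -surjective_pairing (valP (repr x)).
Qed.

Definition loc_add x y := frac (den y * num x + den x * num y) (den x * den y).
Definition loc_opp x := frac (- num x) (den x).
Definition loc_mul x y := frac (num x * num y) (den x * den y).

Lemma loc_addE a s b t : S s -> S t ->
  loc_add (frac a s) (frac b t) = frac (t * a + s * b) (s * t).
Proof.
move=> Ss St; set x := frac a s; set y := frac b t.
have [u Su eu] : exists2 u, S u & u * (s * num x) = u * (den x * a).
  by apply/(frac_eq _ _ (denP x) Ss); rewrite -num_den.
have [v Sv ev] : exists2 u, S u & u * (t * num y) = u * (den y * b).
  by apply/(frac_eq _ _ (denP y) St); rewrite -num_den.
apply/(frac_eq _ _ (cmsM (denP x) (denP y)) (cmsM Ss St)).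
exists (u * v); first exact: cmsM.
move: (denP x) (denP y) eu ev; rewrite /loc_add.
move: (num x) (num y) (den x) (den y) => a' b' s' t' Ss' St' eu ev.
rewrite !mulrDr -!mulrA; congr (_ + _).
  rewrite (cmsCA t t' _ St) (cmsCA s t' _ Ss) (cmsCA v t' _ Sv) (cmsCA u t' _ Su).
  rewrite (cmsCA s t _ Ss) (cmsCA v t _ Sv) (cmsCA u t _ Su).
  rewrite (cmsCA u v _ Su) eu.
  rewrite (cmsCA s' t' _ Ss') (cmsCA v t' _ Sv) (cmsCA u t' _ Su); congr (_ * _).
  by rewrite (cmsCA s' t _ Ss') (cmsCA v t _ Sv) (cmsCA u t _ Su) (cmsCA u v _ Su).
rewrite (cmsCA t s' _ St) (cmsCA s s' _ Ss) (cmsCA v s' _ Sv) (cmsCA u s' _ Su).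
rewrite [RHS](_ : _ = s' * (u * (v * (t' * (s * b))))); last first.
  by rewrite (cmsCA v s' _ Sv) (cmsCA u s' _ Su).
congr (_ * (_ * _)).
by rewrite (cmsCA v s _ Sv) ev (cmsCA s v _ Ss) (cmsCA s t' _ Ss).
Qed.

Lemma loc_mulE a s b t : S s -> S t ->
  loc_mul (frac a s) (frac b t) = frac (a * b) (s * t).
Proof.
move=> Ss St; set x := frac a s; set y := frac b t.
have [u Su eu] : exists2 u, S u & u * (s * num x) = u * (den x * a).
  by apply/(frac_eq _ _ (denP x) Ss); rewrite -num_den.
have [v Sv ev] : exists2 u, S u & u * (t * num y) = u * (den y * b).
  by apply/(frac_eq _ _ (denP y) St); rewrite -num_den.
apply/(frac_eq _ _ (cmsM (denP x) (denP y)) (cmsM Ss St)).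
exists (u * v); first exact: cmsM.
move: (denP x) (denP y) eu ev.
move: (num x) (num y) (den x) (den y) => a' b' s' t' Ss' St' eu ev.
transitivity ((u * (s * a')) * (v * (t * b'))).
  rewrite -!mulrA; congr (_ * _); rewrite (cmsCA v s _ Sv); congr (_ * _).
  by rewrite (cmsCA t a' _ St) (cmsCA v a' _ Sv).
rewrite eu ev -!mulrA; congr (_ * _).
rewrite (cmsCA v s' _ Sv); congr (_ * _).
by rewrite (cmsCA t' a _ St') (cmsCA v a _ Sv).
Qed.

Lemma loc_oppE a s : S s -> loc_opp (frac a s) = frac (- a) s.
Proof.
move=> Ss; set x := frac a s.
have [u Su eu] : exists2 u, S u & u * (s * num x) = u * (den x * a).
  by apply/(frac_eq _ _ (denP x) Ss); rewrite -num_den.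
by apply/(frac_eq _ _ (denP x) Ss); exists u; rewrite // !mulrN eu.
Qed.

Fact loc_addA : associative loc_add.
Proof.
move=> x y z.
have [a [s [Ss ->]]] := fracP x; have [b [t [St ->]]] := fracP y.
have [c [r [Sr ->]]] := fracP z.
rewrite !loc_addE //; do ?exact: cmsM.
rewrite !mulrDr !addrA -!mulrA (cmsCA r t _ Sr) (cmsCA r s _ Sr) //.
Qed.

Fact loc_addC : commutative loc_add.
Proof.
move=> x y; have [a [s [Ss ->]]] := fracP x; have [b [t [St ->]]] := fracP y.
by rewrite !loc_addE // addrC (cmsC t Ss).
Qed.

Fact loc_add0 : left_id (frac 0 1) loc_add.
Proof.
move=> x; have [a [s [Ss ->]]] := fracP x.
by rewrite loc_addE ?mulr0 ?add0r ?mul1r //; exact: cms1.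
Qed.

Fact loc_addN : left_inverse (frac 0 1) loc_opp loc_add.
Proof.
move=> x; have [a [s [Ss ->]]] := fracP x.
rewrite loc_oppE // loc_addE // mulrN addNr.
by apply: fracE; rewrite ?mulr0 //; [exact: cmsM|exact: cms1].
Qed.

HB.instance Definition _ :=
  GRing.isZmodule.Build loc loc_addA loc_addC loc_add0 loc_addN.

Fact loc_mulA : associative loc_mul.
Proof.
move=> x y z.
have [a [s [Ss ->]]] := fracP x; have [b [t [St ->]]] := fracP y.
have [c [r [Sr ->]]] := fracP z.
by rewrite !loc_mulE //; do ?exact: cmsM; rewrite !mulrA.
Qed.

Fact loc_mul1l : left_id (frac 1 1) loc_mul.
Proof.
move=> x; have [a [s [Ss ->]]] := fracP x.
by rewrite loc_mulE ?mul1r //; exact: cms1.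
Qed.

Fact loc_mul1r : right_id (frac 1 1) loc_mul.
Proof.
move=> x; have [a [s [Ss ->]]] := fracP x.
by rewrite loc_mulE ?mulr1 //; exact: cms1.
Qed.

Fact loc_mulDl : left_distributive loc_mul loc_add.
Proof.
move=> x y z.
have [a [s [Ss ->]]] := fracP x; have [b [t [St ->]]] := fracP y.
have [c [r [Sr ->]]] := fracP z.
rewrite loc_addE // !loc_mulE ?loc_addE //; do ?exact: cmsM.
apply: fracE; [by do 2?apply: cmsM | by do 2?apply: cmsM |].
rewrite mulrDl !mulrDr -!mulrA; congr (s * _ + s * _).
  rewrite (cmsCA r t _ Sr); congr (_ * (_ * _)).
  by rewrite (cmsCA r t _ Sr).
rewrite (cmsCA r t _ Sr); congr (_ * (_ * _)).
by rewrite (cmsCA r s _ Sr).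
Qed.

Fact loc_mulDr : right_distributive loc_mul loc_add.
Proof.
move=> x y z.
have [a [s [Ss ->]]] := fracP x; have [b [t [St ->]]] := fracP y.
have [c [r [Sr ->]]] := fracP z.
rewrite loc_addE // !loc_mulE ?loc_addE //; do ?exact: cmsM.
apply: fracE; [by do 2?apply: cmsM | by do 2?apply: cmsM |].
rewrite !mulrDr -!mulrA; congr (s * (t * _) + s * (t * _)).
  by rewrite (cmsCA r a b Sr) (cmsCA s r _ Ss).
by rewrite (cmsCA t a c St) (cmsCA s r _ Ss).
Qed.

HB.instance Definition _ := GRing.Zmodule_isPzRing.Build loc
  loc_mulA loc_mul1l loc_mul1r loc_mulDl loc_mulDr.

Lemma fracD a s b t : S s -> S t ->
  frac a s + frac b t = frac (t * a + s * b) (s * t).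
Proof. exact: loc_addE. Qed.

Lemma fracM a s b t : S s -> S t -> frac a s * frac b t = frac (a * b) (s * t).
Proof. exact: loc_mulE. Qed.

Lemma fracN a s : S s -> - frac a s = frac (- a) s.
Proof. exact: loc_oppE. Qed.

End Localization.

Fact loc_mulC (B : comPzRingType) (S : central_mulset B) :
  commutative (@GRing.mul (loc S)).
Proof.
move=> x y; have [a [s [Ss ->]]] := fracP x; have [b [t [St ->]]] := fracP y.
by rewrite !fracM // (mulrC a) (mulrC s).
Qed.

HB.instance Definition _ (B : comPzRingType) (S : central_mulset B) :=
  GRing.PzRing_hasCommutativeMul.Build (loc S) (@loc_mulC B S).

Section LocalizationMap.
Variables (B B' : comPzRingType) (S : central_mulset B).
Variables (S' : central_mulset B') (phi : {rmorphism B -> B'}).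
Hypothesis phiS : forall s, S s -> S' (phi s).

Definition loc_map (x : loc S) : loc S' := frac S' (phi (num x)) (phi (den x)).

Lemma loc_mapE b s : S s -> loc_map (frac S b s) = frac S' (phi b) (phi s).
Proof.
move=> Ss; set x := frac S b s.
have [u Su eu] : exists2 u, S u & u * (s * num x) = u * (den x * b).
  by apply/(frac_eq _ _ (denP x) Ss); rewrite -num_den.
apply/(frac_eq _ _ (phiS (denP x)) (phiS Ss)).
by exists (phi u); [exact: phiS | rewrite -!rmorphM eu].
Qed.

Fact loc_map_zmod_morphism : zmod_morphism loc_map.
Proof.
move=> x y; have [a [s [Ss ->]]] := fracP x; have [b [t [St ->]]] := fracP y.
rewrite fracN // fracD // !loc_mapE //; last exact: cmsM.
rewrite fracN ?fracD //; try exact: phiS.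
by rewrite rmorphD !rmorphM rmorphN.
Qed.

Fact loc_map_monoid_morphism : monoid_morphism loc_map.
Proof.
split; first by rewrite loc_mapE ?rmorph1 //; exact: cms1.
move=> x y; have [a [s [Ss ->]]] := fracP x; have [b [t [St ->]]] := fracP y.
rewrite fracM // !loc_mapE //; last exact: cmsM.
by rewrite fracM ?rmorphM //; exact: phiS.
Qed.

Definition loc_rmorphism : {rmorphism loc S -> loc S'} :=
  HB.pack loc_map
    (GRing.isZmodMorphism.Build _ _ loc_map loc_map_zmod_morphism)
    (GRing.isMonoidMorphism.Build _ _ loc_map loc_map_monoid_morphism).

Lemma loc_rmorphismE b s :
  S s -> loc_rmorphism (frac S b s) = frac S' (phi b) (phi s).
Proof. exact: loc_mapE. Qed.

End LocalizationMap.
Arguments loc_rmorphism {B B' S S' phi} phiS.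

Inductive mulset_gen (B : comPzRingType) (X : B -> Prop) : B -> Prop :=
| mulset_gen1 : mulset_gen X 1
| mulset_genM s t : X s -> mulset_gen X t -> mulset_gen X (s * t).

Section GeneratedMulset.
Variables (B : comPzRingType) (X : B -> Prop).

Fact mulset_gen_mul s t :
  mulset_gen X s -> mulset_gen X t -> mulset_gen X (s * t).
Proof.
elim=> [|s1 s2 Xs1 _ IH] Xt; first by rewrite mul1r.
by rewrite -mulrA; apply: mulset_genM => //; exact: IH.
Qed.

Definition generated_mulset : central_mulset B :=
  CentralMulset (mulset_gen1 X) mulset_gen_mul (fun s b _ => mulrC s b).

End GeneratedMulset.

(* For an R-algebra A with central structure map c, the localization of A at
   this set is the tensor product of A and Frac R over R; in a commutative ring
   GRing.lreg r says that r is not a zero divisor. *)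
Section BaseMulset.
Variables (R : comNzRingType) (A : pzRingType) (c : R -> A).
Hypotheses (c_mul : monoid_morphism c) (c_central : forall r a, c r * a = a * c r).

Definition nonzerodivisor_image (a : A) : Prop :=
  exists2 r, GRing.lreg r & a = c r.

Fact nonzerodivisor_image1 : nonzerodivisor_image 1.
Proof. by exists 1; [exact: lreg1 | rewrite c_mul.1]. Qed.

Fact nonzerodivisor_imageM s t : nonzerodivisor_image s ->
  nonzerodivisor_image t -> nonzerodivisor_image (s * t).
Proof.
move=> [r rr ->] [q qq ->]; exists (r * q); last by rewrite c_mul.2.
exact: lregM.
Qed.

Fact nonzerodivisor_imageC s b : nonzerodivisor_image s -> s * b = b * s.
Proof. by move=> [r _ ->]; exact: c_central. Qed.

Definition base_mulset : central_mulset A :=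
  CentralMulset nonzerodivisor_image1 nonzerodivisor_imageM nonzerodivisor_imageC.

End BaseMulset.

Inductive zspan (A : zmodType) (X : A -> Prop) : A -> Prop :=
| zspan_in x : X x -> zspan X x
| zspan0 : zspan X 0
| zspanB x y : zspan X x -> zspan X y -> zspan X (x - y).

Inductive subring_gen (A : pzRingType) (X : A -> Prop) : A -> Prop :=
| subring_in x : X x -> subring_gen X x
| subring1 : subring_gen X 1
| subringB x y : subring_gen X x -> subring_gen X y -> subring_gen X (x - y)
| subringM x y : subring_gen X x -> subring_gen X y -> subring_gen X (x * y).

Notation mvpoly R V := {malg R[{cmonom V}]}.

HB.lock Definition pvar (R : comNzRingType) (V : choiceType) (x : V) :
  mvpoly R V := << ucm x >>.

HB.lock Definition pconst (R : comNzRingType) (V : choiceType) (c : R) :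
  mvpoly R V := << c *g mone >>.
Arguments pconst {R} V c.

Section Polynomials.
Variable R : comNzRingType.

Lemma malg_mulUU (K : monomType) (c1 c2 : R) (k1 k2 : K) :
  << c1 *g k1 >> * << c2 *g k2 >> = << c1 * c2 *g mmul k1 k2 >> :> {malg R[K]}.
Proof. exact: fgmulUU. Qed.

Fact pconst_zmod_morphism V : zmod_morphism (@pconst R V).
Proof. by move=> c d; rewrite pconst.unlock monalgUB. Qed.

Fact pconst_monoid_morphism V : monoid_morphism (@pconst R V).
Proof. by rewrite pconst.unlock; split=> [//|c d]; rewrite malg_mulUU mul1m. Qed.

HB.instance Definition _ V :=
  GRing.isZmodMorphism.Build R (mvpoly R V) (@pconst R V)
    (@pconst_zmod_morphism V).
HB.instance Definition _ V :=
  GRing.isMonoidMorphism.Build R (mvpoly R V) (@pconst R V)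
    (@pconst_monoid_morphism V).

Definition cmonom_eval (V : choiceType) (S : comNzRingType) (s : V -> S)
    (m : {cmonom V}) : S :=
  \prod_(x <- finsupp m) s x ^+ m x.

Fact cmonom_eval_mmorphism V S s : mmorphism (@cmonom_eval V S s).
Proof.
have big_widen (m : {cmonom V}) (d : {fset V}) : (finsupp m `<=` d)%fset ->
    cmonom_eval s m = \prod_(x <- d) s x ^+ m x.
  move=> le; rewrite /cmonom_eval (big_fset_incl _ le) // => x _.
  by rewrite -cmE_neq0 negbK => /eqP ->; rewrite expr0.
split; last by rewrite /cmonom_eval mdom1 big_seq_fset0.
move=> m1 m2; rewrite (big_widen m1 _ (fsubsetUl _ (finsupp m2))).
rewrite (big_widen m2 _ (fsubsetUr (finsupp m1) _)) /cmonom_eval mdomD.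
by rewrite -big_split /=; apply: eq_bigr => x _; rewrite cmM exprD.
Qed.

HB.instance Definition _ (V : choiceType) (S : comNzRingType) (s : V -> S) :=
  isMultiplicative.Build {cmonom V} S (@cmonom_eval V S s)
    (@cmonom_eval_mmorphism V S s).

End Polynomials.

(* The R-algebra map sending the variable x to s x. *)
HB.lock Definition psubst (R : comNzRingType) (V W : choiceType)
    (s : V -> mvpoly R W) (f : mvpoly R V) : mvpoly R W :=
  mmap (@pconst R W) (cmonom_eval s) f.

Fact psubst_zmod_morphism R V W s : zmod_morphism (@psubst R V W s).
Proof. by rewrite psubst.unlock; exact: raddfB. Qed.

Fact psubst_monoid_morphism R V W s : monoid_morphism (@psubst R V W s).
Proof. by rewrite psubst.unlock; split; [exact: rmorph1|exact: rmorphM]. Qed.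

HB.instance Definition _ (R : comNzRingType) (V W : choiceType)
    (s : V -> mvpoly R W) :=
  GRing.isZmodMorphism.Build (mvpoly R V) (mvpoly R W) (psubst s)
    (psubst_zmod_morphism s).
HB.instance Definition _ (R : comNzRingType) (V W : choiceType)
    (s : V -> mvpoly R W) :=
  GRing.isMonoidMorphism.Build (mvpoly R V) (mvpoly R W) (psubst s)
    (psubst_monoid_morphism s).

Record monoid_action (K : nmodType) (L : comPzRingType) := MonoidAction {
  act :> K -> {rmorphism L -> L};
  act0 : forall x, act 0 x = x;
  actD : forall k l x, act (k + l) x = act k (act l x)
}.

Section SkewMonoidRing.
Variables (K : nmodType) (L : comPzRingType) (t : monoid_action K L).

(* Finite formal sums of terms << c *g k >> (standing for c u^k), with
   u^k c = t k (c) u^k. *)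
Definition skew (_ : monoid_action K L) : Type := {malg L[K]}.

HB.instance Definition _ := GRing.Zmodule.copy (skew t) {malg L[K]}.

Implicit Types g : skew t.

Definition skew_mul g1 g2 : skew t :=
  \sum_(k1 <- msupp g1) \sum_(k2 <- msupp g2)
    << g1@_k1 * t k1 (g2@_k2) *g k1 + k2 >>.

Lemma skew_mulw (d1 d2 : {fset K}) g1 g2 :
  (msupp g1 `<=` d1)%fset -> (msupp g2 `<=` d2)%fset ->
  skew_mul g1 g2 = \sum_(k1 <- d1) \sum_(k2 <- d2)
    << g1@_k1 * t k1 (g2@_k2) *g k1 + k2 >>.
Proof.
move=> le_d1 le_d2; rewrite /skew_mul (big_fset_incl _ le_d1) /=.
  apply/eq_bigr=> k1 _; apply/big_fset_incl => // k _ /mcoeff_outdom ->.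
  by rewrite rmorph0 mulr0 monalgU0.
move=> k _ /mcoeff_outdom g1k.
by rewrite big1 => // k' _; rewrite g1k mul0r monalgU0.
Qed.

Lemma skew_mulUU c1 c2 k1 k2 :
  skew_mul << c1 *g k1 >> << c2 *g k2 >> = << c1 * t k1 c2 *g k1 + k2 >>.
Proof. by rewrite (skew_mulw msuppU_le msuppU_le) !big_seq_fset1 !mcoeffUU. Qed.

Fact skew_mulDl : left_distributive skew_mul +%R.
Proof.
move=> g1 g2 g; pose d := (msupp g1 `|` msupp g2)%fset.
have dD : (msupp (g1 + g2)%R `<=` d)%fset by exact: msuppD_le.
rewrite (skew_mulw dD (fsubset_refl _)).
rewrite (@skew_mulw d (msupp g) g1) ?fsubsetUl //.
rewrite (@skew_mulw d (msupp g) g2) ?fsubsetUr //.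
rewrite -big_split /=; apply/eq_bigr=> k1 _.
rewrite -big_split /=; apply/eq_bigr=> k2 _.
by rewrite mcoeffD mulrDl monalgUD.
Qed.

Fact skew_mulDr : right_distributive skew_mul +%R.
Proof.
move=> g g1 g2; pose d := (msupp g1 `|` msupp g2)%fset.
have dD : (msupp (g1 + g2)%R `<=` d)%fset by exact: msuppD_le.
rewrite (skew_mulw (fsubset_refl _) dD).
rewrite (@skew_mulw (msupp g) d g g1) ?fsubsetUl //.
rewrite (@skew_mulw (msupp g) d g g2) ?fsubsetUr //.
rewrite -big_split /=; apply/eq_bigr=> k1 _.
rewrite -big_split /=; apply/eq_bigr=> k2 _.
by rewrite mcoeffD rmorphD mulrDr monalgUD.
Qed.

Fact skew_mul0l : left_zero 0 skew_mul.
Proof. by move=> g; rewrite /skew_mul msupp0 big_seq_fset0. Qed.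

Fact skew_mul0r : right_zero 0 skew_mul.
Proof.
by move=> g; rewrite /skew_mul msupp0 big1 // => k _; rewrite big_seq_fset0.
Qed.

Lemma skew_mulEl g1 g2 :
  skew_mul g1 g2 = \sum_(k1 <- msupp g1) skew_mul << g1@_k1 *g k1 >> g2.
Proof.
apply/eq_bigr=> k _; rewrite (skew_mulw msuppU_le (fsubset_refl _)).
by rewrite big_seq_fset1 mcoeffUU.
Qed.

Lemma skew_mulEr g1 g2 :
  skew_mul g1 g2 = \sum_(k2 <- msupp g2) skew_mul g1 << g2@_k2 *g k2 >>.
Proof.
rewrite /skew_mul exchange_big; apply/eq_bigr=> k _ /=.
rewrite -/(skew_mul _ _) (skew_mulw (fsubset_refl _) msuppU_le).
by apply: eq_bigr => k1 _; rewrite big_seq_fset1 mcoeffUU.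
Qed.

Fact skew_mul1l : left_id << 1 *g 0 >> skew_mul.
Proof.
move=> g; rewrite skew_mulEr [RHS]monalgE.
by apply/eq_bigr=> k _; rewrite skew_mulUU mul1r act0 add0r.
Qed.

Fact skew_mul1r : right_id << 1 *g 0 >> skew_mul.
Proof.
move=> g; rewrite skew_mulEl [RHS]monalgE.
by apply/eq_bigr=> k _; rewrite skew_mulUU rmorph1 mulr1 addr0.
Qed.

Fact skew_mulA : associative skew_mul.
Proof.
move=> g1 g2 g3.
rewrite [RHS](big_morph (skew_mul^~ _) (fun _ _ => skew_mulDl _ _ _)
  (skew_mul0l _)).
rewrite skew_mulEl; apply/eq_bigr=> k1 _.
rewrite [LHS](big_morph (skew_mul _) (fun _ _ => skew_mulDr _ _ _)
  (skew_mul0r _)).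
rewrite [RHS](big_morph (skew_mul^~ _) (fun _ _ => skew_mulDl _ _ _)
  (skew_mul0l _)).
apply/eq_bigr=> k2 _.
rewrite [LHS](big_morph (skew_mul _) (fun _ _ => skew_mulDr _ _ _)
  (skew_mul0r _)).
rewrite skew_mulEr; apply/eq_bigr=> k3 _.
by rewrite !skew_mulUU rmorphM actD mulrA addrA.
Qed.

HB.instance Definition _ := GRing.Zmodule_isPzRing.Build (skew t)
  skew_mulA skew_mul1l skew_mul1r skew_mulDl skew_mulDr.

End SkewMonoidRing.

Section ProductRing.
Variables (T : Type) (B : T -> pzRingType).

Definition prod_ring : Type := forall t, B t.

HB.instance Definition _ := Choice.on prod_ring.

Implicit Types x y z : prod_ring.

Definition prod_add x y : prod_ring := fun t => x t + y t.
Definition prod_opp x : prod_ring := fun t => - x t.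
Definition prod_mul x y : prod_ring := fun t => x t * y t.

Let ext x y : (forall t, x t = y t) -> x = y.
Proof. by move=> e; exact: functional_extensionality_dep. Qed.

Fact prod_addA : associative prod_add.
Proof. by move=> x y z; apply: ext => t; exact: addrA. Qed.
Fact prod_addC : commutative prod_add.
Proof. by move=> x y; apply: ext => t; exact: addrC. Qed.
Fact prod_add0 : left_id (fun=> 0) prod_add.
Proof. by move=> x; apply: ext => t; exact: add0r. Qed.
Fact prod_addN : left_inverse (fun=> 0) prod_opp prod_add.
Proof. by move=> x; apply: ext => t; exact: addNr. Qed.

HB.instance Definition _ :=
  GRing.isZmodule.Build prod_ring prod_addA prod_addC prod_add0 prod_addN.

Fact prod_mulA : associative prod_mul.
Proof. by move=> x y z; apply: ext => t; exact: mulrA. Qed.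
Fact prod_mul1l : left_id (fun=> 1) prod_mul.
Proof. by move=> x; apply: ext => t; exact: mul1r. Qed.
Fact prod_mul1r : right_id (fun=> 1) prod_mul.
Proof. by move=> x; apply: ext => t; exact: mulr1. Qed.
Fact prod_mulDl : left_distributive prod_mul prod_add.
Proof. by move=> x y z; apply: ext => t; exact: mulrDl. Qed.
Fact prod_mulDr : right_distributive prod_mul prod_add.
Proof. by move=> x y z; apply: ext => t; exact: mulrDr. Qed.

HB.instance Definition _ := GRing.Zmodule_isPzRing.Build prod_ring
  prod_mulA prod_mul1l prod_mul1r prod_mulDl prod_mulDr.

End ProductRing.

Section PolynomialTheory.
Variable R : comNzRingType.

Lemma cmonom_eval_pvar (V : choiceType) (m : {cmonom V}) :
  cmonom_eval (@pvar R V) m = << m >>.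
Proof.
pose u x n : {cmonom V} := iter n (mmul (ucm x)) mone.
have uE x n y : u x n y = ((x == y) * n)%N.
  elim: n => [|n IH]; first by rewrite cm1 muln0.
  by rewrite /u iterS cmM cmU -/(u x n) IH mulnS.
have uS x n : mmul (ucm x) (u x n) = u x n.+1 by [].
have pow x n : pvar R x ^+ n = << u x n >>.
  elim: n => [//|n IH].
  rewrite exprS IH pvar.unlock malg_mulUU mulr1 uS; exact: erefl.
have prodE (r : seq V) : \prod_(x <- r) pvar R x ^+ m x =
    << \big[mmul/mone]_(x <- r) u x (m x) >>.
  under eq_bigr do rewrite pow.
  elim/big_rec2: _ => [|x k p _ ->]; first exact: erefl.
  by rewrite malg_mulUU mulr1.
rewrite /cmonom_eval prodE; congr << _ >>; apply/eqP/cmP => y.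
have mulE (r : seq V) (F : V -> {cmonom V}) :
    (\big[mmul/mone]_(x <- r) F x) y = (\sum_(x <- r) F x y)%N.
  by elim/big_rec2: _ => [|x n k _ e]; rewrite ?cm1 // cmM e.
rewrite mulE; under eq_bigr do rewrite uE.
have [my|my] := finsuppP m y.
  rewrite big1_fset // => x xm _; case: eqVneq => [xy|_]; last by rewrite mul0n.
  by move: xm; rewrite xy (negbTE my).
rewrite (big_fsetD1 y) //= eqxx mul1n big1_fset ?addn0 // => x.
by rewrite !inE => /andP[/negbTE ->].
Qed.

Lemma mvpoly_ext (V : choiceType) (S : pzRingType)
    (phi psi : {rmorphism mvpoly R V -> S}) :
  (forall c : R, phi (pconst V c) = psi (pconst V c)) ->
  (forall x : V, phi (pvar R x) = psi (pvar R x)) -> phi =1 psi.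
Proof.
move=> eC eX f; rewrite (monalgE f) !raddf_sum; apply: eq_bigr => m _ /=.
have mE : << f@_m *g m >> = pconst V (f@_m) * cmonom_eval (@pvar R V) m.
  by rewrite cmonom_eval_pvar pconst.unlock malg_mulUU mulr1 mul1m.
rewrite mE !rmorphM eC; congr (_ * _).
rewrite /cmonom_eval !rmorph_prod; apply: eq_bigr => x _.
by rewrite !rmorphXn eX.
Qed.

Lemma psubstU (V W : choiceType) (s : V -> mvpoly R W) c (m : {cmonom V}) :
  psubst s << c *g m >> = pconst W c * cmonom_eval s m.
Proof. by rewrite psubst.unlock; exact: mmapU. Qed.

Lemma psubst_var (V W : choiceType) (s : V -> mvpoly R W) x :
  psubst s (pvar R x) = s x.
Proof.
by rewrite pvar.unlock psubstU rmorph1 mul1r /cmonom_eval mdomU big_seq_fset1 cmUU expr1.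
Qed.

Lemma psubst_const (V W : choiceType) (s : V -> mvpoly R W) c :
  psubst s (pconst V c) = pconst W c.
Proof. by rewrite {1}pconst.unlock psubstU mmorph1 mulr1. Qed.

End PolynomialTheory.

Section SetFunctions.
Variables (X : choiceType) (L : comPzRingType) (z : X -> X -> L).
Local Open Scope fset_scope.

Definition setfun (_ : X -> X -> L) : Type := {fset X} -> L.

HB.instance Definition _ :=
  GRing.Zmodule.copy (setfun z) (prod_ring (fun _ : {fset X} => L)).

Implicit Types (F G H : setfun z) (A B C D : {fset X}).

Definition zprod A B : L := \prod_(p <- A) \prod_(q <- B) z p q.

Definition setfun_mul F G : setfun z :=
  fun C => \sum_(A <- fpowerset C) F A * G (C `\` A) * zprod A (C `\` A).

Definition setfun_const (c : L) : setfun z :=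
  fun C => if C == fset0 then c else 0.

Lemma setfunP F G : (forall C, F C = G C) -> F = G.
Proof. by move=> e; apply: functional_extensionality_dep. Qed.

Lemma setfunD F G C : (F + G)%R C = (F C + G C)%R.
Proof. by []. Qed.

Lemma perm_fsetU A B : [disjoint A & B]%fset -> perm_eq (A `|` B) (A ++ B).
Proof.
move=> dAB; apply: uniq_perm; rewrite ?fset_uniq //.
  rewrite cat_uniq !fset_uniq andbT; apply/hasPn => x xB.
  by move/fdisjointP: dAB => dAB; apply/negP => /dAB; rewrite xB.
by move=> x; rewrite mem_cat !inE.
Qed.

Lemma zprodUl A B C : [disjoint A & B]%fset ->
  zprod (A `|` B) C = (zprod A C * zprod B C)%R.
Proof. by move=> dAB; rewrite /zprod (perm_big _ (perm_fsetU dAB)) big_cat. Qed.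

Lemma zprodUr A B C : [disjoint B & C]%fset ->
  zprod A (B `|` C) = (zprod A B * zprod A C)%R.
Proof.
move=> dBC; rewrite /zprod -big_split /=; apply: eq_bigr => p _.
by rewrite (perm_big _ (perm_fsetU dBC)) big_cat.
Qed.

Lemma perm_fpowerset_above B C : B `<=` C ->
  perm_eq [seq A <- fpowerset C | B `<=` A]
          [seq B `|` D | D <- fpowerset (C `\` B)].
Proof.
move=> BC; apply: uniq_perm; first by rewrite filter_uniq ?fset_uniq.
  rewrite map_inj_in_uniq ?fset_uniq // => D D'.
  rewrite !fpowersetE !fsubsetD => /andP[_ d] /andP[_ d'] e.
  have K D0 : [disjoint D0 & B] -> D0 = (B `|` D0) `\` B.
    move=> d0; rewrite fsetDUl fsetDv fset0U; apply/esym/fsetDidPl.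
    exact: d0.
  by rewrite (K _ d) e -K.
move=> A; rewrite mem_filter fpowersetE; apply/andP/mapP.
  move=> [BA AC]; exists (A `\` B); last by rewrite fsetUDl fsetDv fsetD0 (fsetUidPr _ _ BA).
  by rewrite fpowersetE fsetSD.
move=> [D]; rewrite fpowersetE fsubsetD => /andP[DC _] ->.
by rewrite fsubsetUl fsubUset BC DC.
Qed.

Fact setfun_mulA : associative setfun_mul.
Proof.
move=> F G H; apply: setfunP => C; rewrite /setfun_mul.
transitivity (\sum_(B <- fpowerset C) \sum_(D <- fpowerset (C `\` B))
    F B * G D * H (C `\` (B `|` D)) * zprod B D
    * zprod B (C `\` (B `|` D)) * zprod D (C `\` (B `|` D)))%R.
  apply: eq_big_seq => B; rewrite fpowersetE => BC.
  rewrite mulr_sumr mulr_suml; apply: eq_big_seq => D.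
  rewrite fpowersetE => DCB; rewrite fsetDDl.
  have -> : zprod B (C `\` B) = (zprod B D * zprod B (C `\` (B `|` D)))%R.
    rewrite -zprodUr; last by rewrite -fsetDDl; apply/fdisjointP_sym => x; rewrite inE => /andP[].
    by congr zprod; rewrite -fsetDDl fsetUDl fsetDv fsetD0 (fsetUidPr _ _ DCB).
  by rewrite -!mulrA; do 3!congr (_ * _)%R; rewrite mulrC mulrA.
transitivity (\sum_(B <- fpowerset C) \sum_(A <- fpowerset C | B `<=` A)
   F B * G (A `\` B) * H (C `\` A) * zprod B (A `\` B)
    * zprod A (C `\` A))%R.
  apply: eq_big_seq => B; rewrite fpowersetE => BC.
  rewrite -[RHS]big_filter (perm_big _ (perm_fpowerset_above BC)) big_map.
  apply: eq_big_seq => D; rewrite fpowersetE fsubsetD => /andP[DC dDB].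
  have -> : (B `|` D) `\` B = D.
    by rewrite fsetDUl fsetDv fset0U; apply/fsetDidPl.
  rewrite zprodUl ?mulrA //; last by rewrite fdisjoint_sym.
rewrite (exchange_big_dep xpredT) //=.
apply: eq_big_seq => A; rewrite fpowersetE => AC.
rewrite !mulr_suml -big_filter.
have pe : perm_eq [seq B <- fpowerset C | B `<=` A] (fpowerset A).
  apply: uniq_perm; rewrite ?filter_uniq ?fset_uniq // => B.
  rewrite mem_filter !fpowersetE andb_idr // => BA; exact: fsubset_trans BA AC.
rewrite (perm_big _ pe); apply: eq_bigr => B _.
by rewrite -!mulrA; do 2!congr (_ * _)%R; rewrite mulrCA.
Qed.

Lemma setfun_constl c F C : setfun_mul (setfun_const c) F C = (c * F C)%R.
Proof.
rewrite /setfun_mul (big_fsetD1 fset0) /=; last by rewrite fpowersetE fsub0set.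
rewrite /setfun_const eqxx fsetD0 /zprod big_seq_fset0 mulr1.
rewrite big1_fset ?addr0 // => A; rewrite !inE => /andP[/negbTE -> _] _.
by rewrite !mul0r.
Qed.

Lemma setfun_constr c F C : setfun_mul F (setfun_const c) C = (F C * c)%R.
Proof.
rewrite /setfun_mul (big_fsetD1 C) /=; last by rewrite fpowersetE fsubset_refl.
rewrite /setfun_const fsetDv eqxx /zprod big1 ?mulr1; last first.
  by move=> p _; rewrite big_seq_fset0.
rewrite big1_fset ?addr0 // => A; rewrite !inE fpowersetE => /andP[ne AC] _.
rewrite fsetD_eq0; case: ifP => [CA|_]; last by rewrite mulr0 mul0r.
by case/eqP: ne; apply/eqP; rewrite eqEfsubset AC.
Qed.

Fact setfun_mul1l : left_id (setfun_const 1) setfun_mul.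
Proof. by move=> F; apply: setfunP => C; rewrite setfun_constl mul1r. Qed.

Fact setfun_mul1r : right_id (setfun_const 1) setfun_mul.
Proof. by move=> F; apply: setfunP => C; rewrite setfun_constr mulr1. Qed.

Fact setfun_mulDl : left_distributive setfun_mul +%R.
Proof.
move=> F G H; apply: setfunP => C; rewrite setfunD /setfun_mul -big_split /=.
by apply: eq_bigr => A _; rewrite setfunD !mulrDl.
Qed.

Fact setfun_mulDr : right_distributive setfun_mul +%R.
Proof.
move=> F G H; apply: setfunP => C; rewrite setfunD /setfun_mul -big_split /=.
by apply: eq_bigr => A _; rewrite setfunD mulrDr mulrDl.
Qed.

HB.instance Definition _ := GRing.Zmodule_isPzRing.Build (setfun z)
  setfun_mulA setfun_mul1l setfun_mul1r setfun_mulDl setfun_mulDr.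

Fact setfun_const_monoid_morphism : monoid_morphism setfun_const.
Proof.
split=> // c d; apply: setfunP => C; rewrite [RHS]setfun_constl /setfun_const.
by case: ifP => _; rewrite ?mulr0.
Qed.

Fact setfun_const_central c F : (setfun_const c * F = F * setfun_const c)%R.
Proof.
by apply: setfunP => C; rewrite [LHS]setfun_constl [RHS]setfun_constr mulrC.
Qed.

Lemma setfun_mulE F G C :
  (F * G)%R C = (\sum_(A <- fpowerset C) F A * G (C `\` A) * zprod A (C `\` A))%R.
Proof. by []. Qed.

End SetFunctions.

Record quiver := Quiver {
  vertex : finType;
  edge : finType;
  src : edge -> vertex;
  tgt : edge -> vertex
}.

Section Zastava.
Variables (k : comNzRingType) (Q : quiver).
Notation I := (vertex Q).
Notation E := (edge Q).

Notation dimvec := {ffun I -> nat}.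
Implicit Types (v m : dimvec) (i j : I).

Definition simple_root i : dimvec := [ffun j => (i == j) : nat].

Definition dimvec_le v' v := [forall i, (v' i <= v i)%N].

Definition edge_count i j := #|[set e : E | (src e == i) && (tgt e == j)]|.

Definition cartan i j : int :=
  (i == j)%:Z *+ 2 - (edge_count i j)%:Z - (edge_count j i)%:Z.

Definition pairing v' v : int :=
  \sum_i \sum_j cartan i j * (v' i)%:Z * (v j)%:Z.

(* The variable None is hbar / 2, and Some e is theta_e. *)
Definition baseR : comNzRingType := mvpoly k (option E).

Definition hhbar : baseR := pvar k None.
Definition hbar : baseR := hhbar *+ 2.
Definition theta (e : E) : baseR := pvar k (Some e).

Definition widx v : finType := {i : I & 'I_(v i)}.
Definition mkidx v i (r : 'I_(v i)) : widx v := Tagged (fun i => 'I_(v i)) r.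

Definition Lam v : comNzRingType := mvpoly baseR (widx v).

Definition wvar v i (r : 'I_(v i)) : Lam v := pvar baseR (mkidx r).

Definition wset v (p : Lam v) : Prop :=
  exists i (r s : 'I_(v i)) (n : int), r != s /\
    p = wvar r - wvar s + pconst _ (hbar *~ n).

Definition Lam_loc v : comPzRingType := loc (generated_mulset (@wset v)).

Definition wshift v (a : {ffun widx v -> nat}) : {rmorphism Lam v -> Lam v} :=
  psubst (fun p => pvar baseR p + pconst _ (hbar *+ a p)).

Lemma wshift_var v a p : @wshift v a (pvar baseR p) = pvar baseR p + pconst _ (hbar *+ a p).
Proof. exact: psubst_var. Qed.

Lemma wshift_const v a (c : baseR) : @wshift v a (pconst _ c) = pconst _ c.
Proof. exact: psubst_const. Qed.

Fact wshift_wset v a s : generated_mulset (@wset v) s ->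
  generated_mulset (@wset v) (wshift a s).
Proof.
elim=> [|{}s t [i [r [r' [n [ne ->]]]]] _ IH].
  by rewrite rmorph1; exact: mulset_gen1.
rewrite rmorphM; apply: mulset_genM => //.
exists i, r, r', (n + (a (mkidx r))%:Z - (a (mkidx r'))%:Z); split=> //.
rewrite (rmorphD (wshift a)) (rmorphB (wshift a)) wshift_const /wvar !wshift_var.
rewrite mulrzBr mulrzDr -!pmulrn rmorphB rmorphD /=.
move: (pvar _ _) (pvar _ _) (pconst _ _) (pconst _ _) (pconst _ _) => x y b c d.
ring.
Qed.

Lemma wshift0 v : @wshift v 0 =1 id.
Proof.
apply: (@mvpoly_ext _ _ _ (@wshift v 0) idfun) => [c|p].
  by rewrite wshift_const.
by rewrite wshift_var ffunE rmorph0 addr0.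
Qed.

Lemma wshiftD v a b : @wshift v (a + b) =1 wshift a \o wshift b.
Proof.
apply: (@mvpoly_ext _ _ _ (wshift (a + b)) (wshift a \o wshift b)) => [c|p] /=.
  by rewrite (wshift_const b) !wshift_const.
rewrite (wshift_var b) wshift_var rmorphD /= wshift_const wshift_var ffunE mulrnDr rmorphD.
by rewrite /= addrA.
Qed.

Fact wshift_loc0 v x : loc_rmorphism (@wshift_wset v 0) x = x.
Proof. by have [b [s [Ss ->]]] := fracP x; rewrite loc_rmorphismE // !wshift0. Qed.

Fact wshift_locD v a b x : loc_rmorphism (@wshift_wset v (a + b)) x =
  loc_rmorphism (@wshift_wset v a) (loc_rmorphism (@wshift_wset v b) x).
Proof.
have [c [s [Ss ->]]] := fracP x; rewrite !loc_rmorphismE ?wshiftD //.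
exact: wshift_wset.
Qed.

Definition wshift_action v : monoid_action {ffun widx v -> nat} (Lam_loc v) :=
  @MonoidAction _ (Lam_loc v)
    (fun a => loc_rmorphism (@wshift_wset v a)) (@wshift_loc0 v) (@wshift_locD v).

(* The localized algebra of difference operators is free as a left module over
   the localization Lam_loc v, with basis the monomials in the u_(i,r); the term
   c u^a is << c *g a >>, and u^a acts on Lam_loc v by w_p |-> w_p + a_p hbar. *)
Definition Atilde v : pzRingType := skew (wshift_action v).

Definition Acoef v (c : Lam_loc v) : Atilde v := << c *g 0 >>.

Definition uvar v i (r : 'I_(v i)) : Atilde v :=
  << 1 *g [ffun p => (p == mkidx r) : nat] >>.

Definition Sv_act v (s : forall i, 'S_(v i)) (p : widx v) : widx v :=
  mkidx (s (tag p) (tagged p)).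

Definition symmetric_poly v (f : Lam v) : Prop :=
  forall s : (forall i, 'S_(v i)),
    psubst (fun p => pvar baseR (Sv_act s p)) f = f.

(* All of hbar / 2, theta_e and w_(i,r) have degree 1. *)
Definition homogeneous (V : choiceType) (d : nat) (f : mvpoly baseR V) : Prop :=
  forall (m : {cmonom V}) (n : {cmonom option E}),
    (f@_m : mvpoly k (option E))@_n != 0 -> (mdeg m + mdeg n)%N = d.

(* f evaluated at the lists of values vals i, of length m i, for the variables
   of color i. When f is symmetric the order in the lists is irrelevant. *)
Definition evaluate (V : choiceType) m (vals : I -> seq (mvpoly baseR V))
    (f : Lam m) : mvpoly baseR V :=
  psubst (fun p : widx m => nth 0 (vals (tag p)) (tagged p)) f.

Definition subset_tuple v : finType := {dffun forall i : I, {set 'I_(v i)}}.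

Definition M_num v (G : subset_tuple v) : Lam v :=
  \prod_e \prod_(r in G (src e)) \prod_(s in ~: G (tgt e))
    (wvar s - wvar r + pconst _ (theta e - hhbar)).

Definition M_den v (G : subset_tuple v) : Lam v :=
  \prod_i \prod_(r in G i) \prod_(s in ~: G i) (wvar r - wvar s).

Lemma M_den_mulset v (G : subset_tuple v) : generated_mulset (@wset v) (M_den G).
Proof.
have gm := @cmsM _ (generated_mulset (@wset v)).
have g1 := cms1 (generated_mulset (@wset v)).
apply: (big_ind (generated_mulset (@wset v)) g1 gm) => i _.
apply: (big_ind (generated_mulset (@wset v)) g1 gm) => r rG.
apply: (big_ind (generated_mulset (@wset v)) g1 gm) => s; rewrite inE => sG.
rewrite -[X in _ X]mulr1; apply: mulset_genM; last exact: mulset_gen1.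
exists i, r, s, 0; split; last by rewrite mulr0z rmorph0 addr0.
by apply: contraNneq sG => <-.
Qed.

Definition Mop v m (f : Lam m) : Atilde v :=
  \sum_(G : subset_tuple v | [forall i, #|G i| == m i])
    Acoef (frac _ (evaluate (fun i => [seq wvar r | r <- enum (G i)]) f * M_num G)
                  (M_den G))
    * \prod_i \prod_(r in G i) uvar r.

(* Products of homogeneous generators M_m(f), with their degree in Z^I x Z; they
   span the component of A^+(v) of that degree. *)
Inductive Aplus_monomial v : dimvec -> int -> Atilde v -> Prop :=
| Aplus_monomial1 : Aplus_monomial 0 0 1
| Aplus_monomialM n d x m c (f : Lam m) :
    Aplus_monomial n d x -> dimvec_le m v -> symmetric_poly f ->
    homogeneous c f ->
    Aplus_monomial (n + m) (d + (c%:Z + (pairing m m %/ 2)%Z)) (x * Mop v f).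

Definition Aplus_deg v n d : Atilde v -> Prop := zspan (@Aplus_monomial v n d).

(* The graph of the ring morphism A^+(v) -> A^+(v') with the given values on the
   generators M_m(f). *)
Definition transition v v' : Atilde v * Atilde v' -> Prop :=
  subring_gen (fun p => exists m (f : Lam m),
    [/\ dimvec_le m v, symmetric_poly f
      & p = (Mop v f, if dimvec_le m v' then Mop v' f else 0)]).

Definition Aprod : pzRingType := prod_ring (fun v => Atilde v).

(* The limit in the category of graded rings is the direct sum, over all
   (n, d), of the limits of the components of degree (n, d). It is a subring of
   the product of the rings Atilde v; Aplus n is its component of degree n. *)
Definition Aplus_bideg n d (x : Aprod) : Prop :=
  (forall v, Aplus_deg n d (x v)) /\
  (forall v v', dimvec_le v' v -> transition (x v, x v')).

Definition Aplus n : Aprod -> Prop :=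
  zspan (fun x => exists d, Aplus_bideg n d x).

Definition Acoef_const v (r : baseR) : Atilde v := Acoef (frac _ (pconst _ r) 1).

Fact Acoef_const_monoid_morphism v : monoid_morphism (@Acoef_const v).
Proof.
have g1 := cms1 (generated_mulset (@wset v)).
split=> [|r q]; first by rewrite /Acoef_const rmorph1.
rewrite /Acoef_const /Acoef [RHS]skew_mulUU addr0 act0 fracM // mulr1.
by rewrite rmorphM.
Qed.

Lemma wshift_action_const v a (r : baseR) :
  wshift_action v a (frac _ (pconst _ r) 1) = frac _ (pconst _ r) 1.
Proof.
have g1 := cms1 (generated_mulset (@wset v)).
by rewrite [LHS]loc_rmorphismE // wshift_const rmorph1.
Qed.

Fact Acoef_const_central v r x : @Acoef_const v r * x = x * Acoef_const v r.
Proof.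
rewrite [LHS]skew_mulEr [RHS]skew_mulEl; apply: eq_bigr => a _.
by rewrite !skew_mulUU act0 wshift_action_const addr0 add0r mulrC.
Qed.

Definition Aprod_const (r : baseR) : Aprod := fun v => Acoef_const v r.

Fact Aprod_const_monoid_morphism : monoid_morphism Aprod_const.
Proof.
split=> [|r q]; apply: functional_extensionality_dep => v.
  exact: (Acoef_const_monoid_morphism v).1.
exact: (Acoef_const_monoid_morphism v).2.
Qed.

Fact Aprod_const_central r (x : Aprod) : Aprod_const r * x = x * Aprod_const r.
Proof.
by apply: functional_extensionality_dep => v; exact: Acoef_const_central.
Qed.

Definition Aprod_mulset : central_mulset Aprod :=
  base_mulset Aprod_const_monoid_morphism Aprod_const_central.

(* The elements of degree m are the f in R[x_(i,a) : a < m i] symmetric under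
   S_m, here of type Lam m with w_(i,a) in the role of x_(i,a). Such an f is
   encoded as the function sending a finite set C of pairs (i, a) with m i
   elements of each color i to f evaluated at the variables x_p, p in C, and any
   other finite set to 0. A coset of S_m' x S_m'' in S_(m'+m'') amounts to the set
   A of the variables to which it moves the arguments of f, so that the shuffle
   product of f and g becomes, at C,
     \sum_(A \subset C) f|_A g|_(C \ A) \prod_(p in A, q in C \ A) zeta(x_p - x_q)
   (see Sembed_mulE), the usual formula being the case where C is the set of the
   (i, a) with a < m' i + m'' i. The values lie in the localization Xloc at the
   x_(i,a) - x_(i,b), because zeta has a pole. *)
Definition Xidx : choiceType := (I * nat)%type.
Definition Xpoly : comNzRingType := mvpoly baseR Xidx.
Definition xvar i (a : nat) : Xpoly := pvar baseR ((i, a) : Xidx).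

Definition xset (p : Xpoly) : Prop :=
  exists i (a b : nat), a != b /\ p = xvar i a - xvar i b.

Definition Xloc : comPzRingType := loc (generated_mulset xset).

Definition zeta i j (x : Xpoly) : Xloc :=
  frac _
    ((if i == j then x - pconst _ hbar else 1)
     * \prod_(e | (src e == i) && (tgt e == j))
         (- x + pconst _ (theta e - hhbar))
     * \prod_(e | (src e == j) && (tgt e == i))
         (x + pconst _ (theta e + hhbar)))
    (if i == j then x else 1).

Definition zeta_var (p q : Xidx) : Xloc :=
  zeta p.1 q.1 (xvar p.1 p.2 - xvar q.1 q.2).

Definition Sambient : pzRingType := setfun zeta_var.

Lemma zeta_den_mulset i a b : a != b ->
  generated_mulset xset (xvar i a - xvar i b).
Proof.
move=> ne; rewrite -[X in _ X]mulr1.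
by apply: mulset_genM; [exists i, a, b | exact: mulset_gen1].
Qed.

Definition has_color_type m (C : {fset Xidx}) :=
  [forall i, count (fun p : Xidx => p.1 == i) C == m i].

Definition color_vars (C : {fset Xidx}) i : seq Xpoly :=
  [seq xvar i a | a <- sort leq [seq p.2 | p : Xidx <- C & p.1 == i]].

Definition Sembed m (f : Lam m) : Sambient :=
  fun C => if has_color_type m C then frac _ (evaluate (color_vars C) f) 1 else 0.

Lemma Sembed_mulE m n (f : Lam m) (g : Lam n) C :
  (Sembed f * Sembed g : Sambient) C =
  \sum_(A <- fpowerset C | has_color_type m A && has_color_type n (C `\` A)%fset)
    frac _ (evaluate (color_vars A) f) 1
    * frac _ (evaluate (color_vars (C `\` A)%fset) g) 1
    * \prod_(p <- A) \prod_(q <- (C `\` A)%fset) zeta_var p q.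
Proof.
rewrite [RHS]big_mkcond; apply: eq_bigr => A _; rewrite /Sembed.
by case: ifP => _; [case: ifP => _|]; rewrite ?mulr0 ?mul0r.
Qed.

Definition Sconst (r : baseR) : Sambient :=
  setfun_const zeta_var (frac _ (pconst _ r) 1).

Fact Sconst_monoid_morphism : monoid_morphism Sconst.
Proof.
have g1 := cms1 (generated_mulset xset).
have [h1 hM] := setfun_const_monoid_morphism zeta_var.
split=> [|r q]; first by rewrite /Sconst rmorph1 -[RHS]h1.
by rewrite /Sconst -[RHS]hM fracM // mulr1 rmorphM.
Qed.

Fact Sconst_central r (x : Sambient) : Sconst r * x = x * Sconst r.
Proof. exact: setfun_const_central. Qed.

Definition S_mulset : central_mulset Sambient :=
  base_mulset Sconst_monoid_morphism Sconst_central.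

(* x^(underline m . overline n). *)
Definition updown v (x : Lam v) (m n : nat) : Lam v :=
  \prod_(r < m) \prod_(s < n) (x + pconst _ (hbar *~ (s%:Z - r%:Z))).

Definition strings v (A : forall i, 'I_(v i) -> nat) i : seq (Lam v) :=
  flatten [seq [seq wvar r + pconst _ (hbar *+ c) | c <- iota 0 (A i r)]
          | r <- enum 'I_(v i)].

Definition divides (B : comNzRingType) (d f : B) : Prop :=
  exists q, f = q * d.

(* When A _ r = 0 or A _ s = 0, the truncated predecessor gives an empty product,
   so that the corresponding condition is vacuous. *)
Definition wheel_conditions m (f : Lam m) : Prop :=
  forall v (A : forall i, 'I_(v i) -> nat),
    (forall i, (\sum_(r < v i) A i r)%N = m i) ->
  forall e (r : 'I_(v (src e))) (s : 'I_(v (tgt e))),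
    ((A _ s <= A _ r)%N ->
       divides (updown (wvar s - wvar r + pconst _ (theta e - hhbar))
                       (A _ r).-1 (A _ s))
               (evaluate (strings A) f : Lam v)) /\
    ((A _ r <= A _ s)%N ->
       divides (updown (wvar s - wvar r + pconst _ (theta e + hhbar))
                       (A _ r) (A _ s).-1)
               (evaluate (strings A) f : Lam v)).

Definition Shuffle m (x : Sambient) : Prop :=
  exists f : Lam m, [/\ symmetric_poly f, wheel_conditions f & x = Sembed f].

(* B n is the component of degree n of a graded subring of A. *)
Definition spherically_generated (A : pzRingType) (B : dimvec -> A -> Prop) :=
  forall x, zspan (fun y => exists n, B n y) x ->
    subring_gen (fun y => B 0 y \/ exists i, B (simple_root i) y) x.

(* As localization is exact, for a subalgebra B of A the localization of B is the
   set of fractions with numerator in B. *)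
Definition localized (A : pzRingType) (S : central_mulset A) (B : A -> Prop)
    (x : loc S) : Prop :=
  exists b s, [/\ B b, S s & x = frac S b s].

Definition Aplus_loc m : loc Aprod_mulset -> Prop := localized (Aplus m).
Definition Shuffle_loc m : loc S_mulset -> Prop := localized (Shuffle m).

End Zastava.

(* Main.v *)
(** Both algebras are compared with the words in the letters x^d of degree alpha_i,
    which lie in the components of degree alpha_i.  Since the value of a word is a
    symmetrization, it suffices to show that a regular scalar multiple of each
    element is an R-linear combination of words; this is what spherical generation
    of the localization amounts to.

    Layering the variables by lam and deleting from the kernel of the shuffle
    product the edge factors between variables of one layer, and restoring the root
    factors there, gives a product P_lam.  The symmetrization of h P_lam is a
    combination of words when lam is injective.  In general, the polynomials b for
    which all the symmetrizations of h b P_lam are combinations of words form an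
    ideal.  It contains a regular scalar: on the locus where some of the deleted
    factors vanish and the others do not, either the vanishing ones form a cycle, and
    add up to a scalar n hbar/2 + sum_e c_e theta_e with n > 0, or they can be sorted,
    and P_mu divides P_lam up to nonvanishing factors for an injective refinement mu
    of lam.

    A shuffle element is determined by its specializations at tuples of strings
    w, w + hbar, ...  They are cleared in the order of decreasing potential, the sum
    of the positions of the variables in their strings.  If F vanishes at all strings
    of larger potential, then the wheel conditions, together with the zeros where two
    strings can be recut into a longer and a shorter one, make the specialization of
    F divisible by that of P_lam over the discriminant, where lam is the position in
    the string.  The latter vanishes at all other types of strings of the same or a
    larger potential.  So a suitable symmetrization of h P_lam is subtracted from F.

    In A^+, the coefficient of a word at prod u^A is, up to a fixed fraction, the word
    polynomial evaluated at the strings w, ..., w + (A - 1) hbar.  The element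
    M_m(f) corresponds to the symmetrization of f P_lam with lam constant.  The
    combination of words obtained for M_m(f) does not depend on v, so it represents
    the element of the limit. *)

From HB Require Import structures.
Require Import Defs.
From mathcomp Require Import all_boot all_order all_algebra.
From mathcomp Require Import perm finmap.
From mathcomp Require Import boolp.
From mathcomp Require Import monalg ring zify.

Set Implicit Arguments.
Unset Strict Implicit.
Unset Printing Implicit Defensive.

Import GRing.Theory.
Local Open Scope ring_scope.

Local Notation frac := Defs.frac.
Local Notation skew := Defs.skew.

(** * Regular elements and divisibility in polynomial rings *)

(** Regularity comes from linear forms with an invertible coefficient, which is where the rational
    numbers enter, and divisibility by a product comes from the relation [coprime_to] between its
    factors.

    Words contain every edge factor between two different letters, so their span is too small to be
    compared with the wheel conditions directly. A layering keeps only edge factors that the wheel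
    conditions can account for. That the missing ones cost no more than a scalar is due to a sign:
    written for the order that it forces, each vanishing factor contributes +hbar/2, and these
    contributions cannot cancel along a cycle.

    Larger potentials are treated first because gluing the end of one string to another raises the
    potential. The vanishing obtained there supplies those zeros of P_lam that come from root
    factors and not from edges. After division by the discriminant P_lam has no other zeros, whence
    the exact match with the known zeros of F. *)

Lemma lreg0 (B : pzRingType) (a : B) :
  GRing.lreg a <-> forall h, a * h = 0 -> h = 0.
Proof.
split=> [la h e|H x y e]; first by apply: la; rewrite e mulr0.
by apply/eqP; rewrite -subr_eq0; apply/eqP/H; rewrite mulrBr e subrr.
Qed.

Lemma lregW (B : comPzRingType) (a b : B) : GRing.lreg (a * b) -> GRing.lreg b.
Proof.
move=> /lreg0 H; apply/lreg0 => h e; apply: H.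
by rewrite -mulrA e mulr0.
Qed.

Lemma lreg_prod (B : comPzRingType) (T : Type) (r : seq T) (P : pred T) (F : T -> B) :
  (forall i, P i -> GRing.lreg (F i)) -> GRing.lreg (\prod_(i <- r | P i) F i).
Proof. by move=> H; apply: big_ind => //; [exact: lreg1 | exact: lregM]. Qed.

Section PolynomialBasics.
Variable R : comNzRingType.

Lemma mvpoly_ind (V : choiceType) (P : mvpoly R V -> Prop) :
  (forall c, P (pconst V c)) -> (forall x, P (pvar R x)) ->
  (forall f g, P f -> P g -> P (f + g)) ->
  (forall f g, P f -> P g -> P (f * g)) -> forall f, P f.
Proof.
move=> PC PX PD PM f; rewrite (monalgE f).
have P0 : P 0 by move: (PC 0); rewrite rmorph0.
have P1 : P 1 by move: (PC 1); rewrite rmorph1.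
apply: (big_ind P P0 PD) => m _.
have -> : << f@_m *g m >> = pconst V (f@_m) * cmonom_eval (@pvar R V) m.
  by rewrite cmonom_eval_pvar pconst.unlock malg_mulUU mulr1 mul1m.
apply: (PM) => //; rewrite /cmonom_eval; apply: (big_ind P P1 PM) => x _.
by elim: (m x) => [//|n IH]; rewrite exprS; exact: PM.
Qed.

Lemma lreg_pvar (V : choiceType) (x : V) : GRing.lreg (pvar R x).
Proof.
apply/lreg0 => h e; apply/malgP => m; rewrite mcoeff0.
have := congr1 (mcoeff (mmul (ucm x) m)) e; rewrite mcoeff0 => <-.
rewrite pvar.unlock [_ * h]fgmulUg raddf_sum /=.
under eq_bigr do rewrite mcoeffU mul1r.
have eqm (m' : {cmonom V}) : (mmul (ucm x) m' == mmul (ucm x) m) = (m' == m).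
  apply/eqP/eqP => [e'|->//]; apply/eqP/cmP => y.
  by have := congr1 (fun z : {cmonom V} => z y) e'; rewrite !cmM => /addnI.
under eq_bigr do rewrite eqm mulrb.
case: (boolP (m \in msupp h)) => mh.
  rewrite (bigD1_seq m mh (fset_uniq _)) /= eqxx big1 ?addr0 // => m'.
  by move/negbTE=> ->.
rewrite mcoeff_outdom // big_seq big1 // => m' m'h; case: eqP => // e'.
by rewrite -e' m'h in mh.
Qed.

Lemma pconst_coef (V : choiceType) c (f : mvpoly R V) m :
  (pconst V c * f)@_m = c * f@_m.
Proof. by rewrite pconst.unlock; exact: mcoeffCM. Qed.

Lemma lreg_pconst (V : choiceType) (c : R) : GRing.lreg c -> GRing.lreg (pconst V c).
Proof.
move=> /lreg0 lc; apply/lreg0 => h e; apply/malgP => m; rewrite mcoeff0.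
by apply: lc; rewrite -pconst_coef e mcoeff0.
Qed.

End PolynomialBasics.

(* Keeping polynomial rings abstract prevents the unfolding of their
   operations during unification. *)
Record poly_functor (R : comNzRingType) := PolyFunctor {
  pring :> choiceType -> comNzRingType;
  pC : forall V, {rmorphism R -> pring V};
  pX : forall V : choiceType, V -> pring V;
  pS : forall V W : choiceType, (V -> pring W) -> {rmorphism pring V -> pring W};
  pSC : forall (V W : choiceType) (s : V -> pring W) c, pS s (pC V c) = pC W c;
  pSX : forall (V W : choiceType) (s : V -> pring W) x, pS s (pX x) = s x;
  pring_ind : forall (V : choiceType) (P : pring V -> Prop),
    (forall c, P (pC V c)) -> (forall x, P (pX x)) ->
    (forall f g, P f -> P g -> P (f + g)) ->
    (forall f g, P f -> P g -> P (f * g)) -> forall f, P f;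
  lreg_pX : forall (V : choiceType) (x : V), GRing.lreg (pX x);
  lreg_pC : forall (V : choiceType) c, GRing.lreg c -> GRing.lreg (pC V c)
}.
Arguments pX {R} p {V} x.
Arguments pS {R} p {V W} s.
Arguments pC {R} p V.

Definition mvpoly_functor (R : comNzRingType) : poly_functor R :=
  @PolyFunctor R (fun V => mvpoly R V) (fun V => @pconst R V)
    (fun V => @pvar R V) (fun V W s => @psubst R V W s)
    (fun V W s c => psubst_const s c) (fun V W s x => psubst_var s x)
    (@mvpoly_ind R) (@lreg_pvar R) (@lreg_pconst R).

Section PolyFunctor.
Variables (R : comNzRingType) (P : poly_functor R).

Lemma pS_ext (V W : choiceType) (phi psi : {rmorphism P V -> P W}) :
  (forall c, phi (pC P V c) = psi (pC P V c)) ->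
  (forall x, phi (pX P x) = psi (pX P x)) -> phi =1 psi.
Proof.
move=> eC eX; elim/pring_ind => // f g ef eg; first by rewrite !rmorphD ef eg.
by rewrite !rmorphM ef eg.
Qed.

Lemma pS_comp (U V W : choiceType) (s : U -> P V) (t : V -> P W) f :
  pS P t (pS P s f) = pS P (fun x => pS P t (s x)) f.
Proof.
apply: (@pS_ext _ _ (pS P t \o pS P s)) => [c|x] /=; first by rewrite !pSC.
by rewrite !pSX.
Qed.

Lemma pS_id (V : choiceType) (f : P V) : pS P (@pX _ P V) f = f.
Proof.
by apply: (@pS_ext _ _ _ idfun) => [c|x] /=; rewrite ?pSC ?pSX.
Qed.

Lemma eq_pS (V W : choiceType) (s t : V -> P W) : s =1 t -> pS P s =1 pS P t.
Proof. by move=> /funext ->. Qed.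

(** Expresses that x does not occur in g without reference to monomials, so that it makes sense in
    every [poly_functor]. *)
Definition var_free (V : choiceType) (x : V) (g : P V) :=
  forall s : V -> P V, (forall y, y != x -> s y = pX P y) -> pS P s g = g.

Lemma var_freeB (V : choiceType) (x : V) (g h : P V) :
  var_free x g -> var_free x h -> var_free x (g - h).
Proof. by move=> gx hx s sx; rewrite rmorphB gx ?hx. Qed.

Lemma var_freeD (V : choiceType) (x : V) (g h : P V) :
  var_free x g -> var_free x h -> var_free x (g + h).
Proof. by move=> gx hx s sx; rewrite rmorphD gx ?hx. Qed.

Lemma var_freeMz (V : choiceType) (x : V) (g : P V) (n : int) :
  var_free x g -> var_free x (g *~ n).
Proof. by move=> gx s sx; rewrite raddfMz /= gx. Qed.

Lemma var_freeN (V : choiceType) (x : V) (g : P V) :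
  var_free x g -> var_free x (- g).
Proof. by move=> gx s sx; rewrite rmorphN gx. Qed.

Lemma var_free_sum (V : choiceType) (x : V) (T : Type) (r : seq T) (F : T -> P V) :
  (forall i, var_free x (F i)) -> var_free x (\sum_(i <- r) F i).
Proof.
by move=> gx s sx; rewrite rmorph_sum; apply: eq_bigr => i _; rewrite gx.
Qed.

Lemma var_freeC (V : choiceType) (x : V) c : var_free x (pC P V c).
Proof. by move=> s _; exact: pSC. Qed.

Lemma var_freeX (V : choiceType) (x y : V) : y != x -> var_free x (pX P y).
Proof. by move=> yx s sx; rewrite pSX sx. Qed.

Definition subst1 (V : choiceType) (x : V) (g : P V) (y : V) :=
  if y == x then g else pX P y.

Lemma subst1_id (V : choiceType) (x : V) g h :
  var_free x h -> pS P (subst1 x g) h = h.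
Proof. by apply=> y /negbTE yx; rewrite /subst1 yx. Qed.

(* An automorphism turns u x + g into the variable x. *)
Lemma lreg_linear (V : choiceType) (x : V) (u u' : R) (g : P V) :
  u' * u = 1 -> var_free x g -> GRing.lreg (pC P V u * pX P x + g).
Proof.
move=> uu' gx; apply/lreg0 => h e.
pose a := subst1 x (pC P V u' * (pX P x - g)).
pose b := subst1 x (pC P V u * pX P x + g).
have uu : pC P V u' * pC P V u = 1 by rewrite -rmorphM uu' rmorph1.
have ba f : pS P b (pS P a f) = f.
  rewrite pS_comp -[RHS]pS_id; apply: eq_pS => y.
  rewrite /a {1}/subst1; case: eqVneq => [->|/negbTE yx].
    rewrite rmorphM rmorphB pSC pSX subst1_id //.
    by rewrite /b /subst1 eqxx addrK mulrA uu mul1r.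
  by rewrite pSX /b /subst1 yx.
have : pS P a (pC P V u * pX P x + g) * pS P a h = 0.
  by rewrite -rmorphM e rmorph0.
rewrite rmorphD rmorphM pSC pSX subst1_id //.
rewrite {1}/a /subst1 eqxx mulrA [pC P V u * _]mulrC uu mul1r subrK.
have /lreg0 H := @lreg_pX _ P V x; move=> /H e0.
by rewrite -(ba h) e0 rmorph0.
Qed.

Lemma lreg_var_sub (V : choiceType) (x y : V) g : x != y -> var_free x g ->
  GRing.lreg (pX P x - pX P y + g).
Proof.
move=> xy gx.
have -> : pX P x - pX P y + g = pC P V 1 * pX P x + (g - pX P y).
  by rewrite rmorph1 mul1r addrAC addrA.
apply: (@lreg_linear V x 1 1); first exact: mulr1.
by apply: var_freeB => //; apply: var_freeX; rewrite eq_sym.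
Qed.

Lemma lreg_int_linear (V : choiceType) (x : V) (a : int) (u : R) (g : P V) :
  u * a%:~R = 1 -> var_free x g -> GRing.lreg (pX P x *~ a + g).
Proof. by move=> ua gx; have := lreg_linear ua gx; rewrite rmorph_int mulrzl. Qed.

End PolyFunctor.

(** * Divisibility by products of linear forms *)

Lemma dividesW (B : comNzRingType) (d f g : B) : divides d f -> divides d (f * g).
Proof. by case=> q ->; exists (q * g); ring. Qed.

Lemma dividesMl (B : comNzRingType) (d f g : B) : divides d f -> divides d (g * f).
Proof. by case=> q ->; exists (g * q); ring. Qed.

Lemma divides_refl (B : comNzRingType) (d : B) : divides d d.
Proof. by exists 1; rewrite mul1r. Qed.

Lemma divides0 (B : comNzRingType) (d : B) : divides d 0.
Proof. by exists 0; rewrite mul0r. Qed.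

Lemma dividesD (B : comNzRingType) (d f g : B) :
  divides d f -> divides d g -> divides d (f + g).
Proof. by move=> [q ->] [p ->]; exists (q + p); ring. Qed.

Lemma dividesB (B : comNzRingType) (d f g : B) :
  divides d f -> divides d g -> divides d (f - g).
Proof. by move=> [q ->] [p ->]; exists (q - p); ring. Qed.

Lemma divides_sum (B : comNzRingType) (T : Type) (r : seq T) (P : pred T) (F : T -> B) d :
  (forall i, P i -> divides d (F i)) -> divides d (\sum_(i <- r | P i) F i).
Proof. by move=> H; apply: big_ind => //; [exact: divides0 | exact: dividesD]. Qed.

(** In other words, b is a nonzerodivisor modulo a. The relation is not symmetric in general; it
    replaces coprimality in the absence of unique factorization. *)
Definition coprime_to (B : comNzRingType) (a b : B) :=
  forall f, divides a (b * f) -> divides a f.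

Section Coprime.
Variable B : comNzRingType.
Implicit Types a b c f : B.

Lemma coprime_to1r a : coprime_to a 1.
Proof. by move=> f; rewrite mul1r. Qed.

Lemma coprime_toMr a b c : coprime_to a b -> coprime_to a c -> coprime_to a (b * c).
Proof. by move=> ab ac f; rewrite -mulrA => /ab /ac. Qed.

Lemma coprime_toMl a b c : GRing.lreg a ->
  coprime_to a c -> coprime_to b c -> coprime_to (a * b) c.
Proof.
move=> la ac bc f [q e].
have /ac [f1 e1] : divides a (c * f) by exists (q * b); rewrite e; ring.
have /bc [f2 e2] : divides b (c * f1).
  by exists q; apply: la; transitivity (c * f); [rewrite e1 | rewrite e]; ring.
by exists f2; rewrite e1 e2; ring.
Qed.

Lemma coprime_to_prodr (T : Type) (r : seq T) (P : pred T) (F : T -> B) a :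
  (forall i, P i -> coprime_to a (F i)) ->
  coprime_to a (\prod_(i <- r | P i) F i).
Proof.
by move=> H; apply: big_ind => //; [exact: coprime_to1r | exact: coprime_toMr].
Qed.

Lemma coprime_to1l a : coprime_to 1 a.
Proof. by move=> f _; exists f; rewrite mulr1. Qed.

Lemma coprime_to_prodl (T : Type) (r : seq T) (P : pred T) (F : T -> B) a :
  (forall i, P i -> GRing.lreg (F i) /\ coprime_to (F i) a) ->
  coprime_to (\prod_(i <- r | P i) F i) a.
Proof.
move=> H; elim: r => [|x r IH]; first by rewrite big_nil; exact: coprime_to1l.
rewrite big_cons; case: ifP => // Px; have [lx cx] := H x Px.
exact: coprime_toMl.
Qed.

Lemma divides_coprimeM a b f :
  divides a f -> divides b f -> coprime_to a b -> divides (a * b) f.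
Proof.
by move=> af [q e] ab; move: af; rewrite e mulrC => /ab [p ->]; exists p; ring.
Qed.

Lemma divides_prod (T : eqType) (r : seq T) (F : T -> B) f :
  uniq r -> (forall i, i \in r -> divides (F i) f) ->
  (forall i j, i \in r -> j \in r -> i != j -> coprime_to (F i) (F j)) ->
  divides (\prod_(i <- r) F i) f.
Proof.
elim: r => [_ _ _|x r IH /= /andP[xr ur] Fd Fc].
  by rewrite big_nil; exists f; rewrite mulr1.
rewrite big_cons; apply: divides_coprimeM.
- by apply: Fd; rewrite inE eqxx.
- apply: IH => // [i ir|i j ir jr]; first by apply: Fd; rewrite inE ir orbT.
  by apply: Fc; rewrite inE ?ir ?jr orbT.
rewrite big_seq; apply: coprime_to_prodr => i ir; apply: Fc; rewrite ?inE ?eqxx ?ir ?orbT //.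
by apply: contraNneq xr => ->.
Qed.

End Coprime.

Section LinearDivisors.
Variables (R : comNzRingType) (P : poly_functor R) (V : choiceType).
Implicit Types f g h : P V.

(** Factor theorem: modulo [x - g] every polynomial is congruent to its value at x = g, by induction
    on the polynomial. *)
Lemma divides_linear (x : V) g h : var_free x g ->
  divides (pX P x - g) h <-> pS P (subst1 x g) h = 0.
Proof.
move=> gx; split=> [[q ->]|e].
  by rewrite rmorphM rmorphB pSX (subst1_id _ gx) /subst1 eqxx subrr mulr0.
suff : divides (pX P x - g) (h - pS P (subst1 x g) h) by rewrite e subr0.
elim/pring_ind: h {e} => [c|y|f1 f2 d1 d2|f1 f2 d1 d2].
- by rewrite pSC subrr; exact: divides0.
- rewrite pSX /subst1; case: eqVneq => [->|_]; first exact: divides_refl.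
  by rewrite subrr; exact: divides0.
- rewrite rmorphD opprD addrACA; exact: dividesD.
- rewrite rmorphM.
  have -> : f1 * f2 - pS P (subst1 x g) f1 * pS P (subst1 x g) f2 =
     (f1 - pS P (subst1 x g) f1) * f2 +
     pS P (subst1 x g) f1 * (f2 - pS P (subst1 x g) f2) by ring.
  by apply: dividesD; [exact: dividesW | exact: dividesMl].
Qed.

(** The substitution x = g presents the quotient by [x - g], so regularity after substitution is
    regularity modulo [x - g]. *)
Lemma coprime_to_linear (x : V) g h : var_free x g ->
  GRing.lreg (pS P (subst1 x g) h) -> coprime_to (pX P x - g) h.
Proof.
move=> gx /lreg0 lh f /(divides_linear _ gx); rewrite rmorphM => /lh e.
exact/divides_linear.
Qed.

End LinearDivisors.

(** The scalars that the proof has to divide by: orders of permutation groups, constants arising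
    inside one string, resultants of two wheel factors ([lreg_bthB], [lreg_bthD]) and sums around
    cycles ([lreg_bcycle]). *)
Record base_ring (E : finType) := BaseRing {
  bring :> comNzRingType;
  bhh : bring;
  bth : E -> bring;
  lreg_bnat : forall n : nat, (0 < n)%N -> GRing.lreg (n%:R : bring);
  lreg_bhbar : forall n : int, n != 0 -> GRing.lreg (bhh *~ n);
  lreg_bth : forall e (n : int), GRing.lreg (bth e + bhh *~ n);
  lreg_bthB : forall (e e' : E) (n : int), e != e' ->
    GRing.lreg (bth e - bth e' + bhh *~ n);
  lreg_bthD : forall (e e' : E) (n : int), GRing.lreg (bth e + bth e' + bhh *~ n);
  lreg_bcycle : forall (n : nat) (c : E -> int), (0 < n)%N ->
    GRing.lreg (bhh *+ n + \sum_e bth e *~ c e)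
}.
Arguments bhh {E} b.
Arguments bth {E} b e.

Section BaseRing.
Variables (k : comNzRingType) (rat_in_k : {rmorphism rat -> k}) (Q : quiver).
Notation E := (edge Q).
Notation R := (baseR k Q).
Let P := mvpoly_functor k.

(** The inclusion of the rationals enters through the invertibility of nonzero integers. *)
Let int_unit (a : int) : a != 0 -> exists u : k, u * a%:~R = 1.
Proof.
move=> a0; exists (rat_in_k (a%:~R)^-1).
by rewrite -(rmorph_int rat_in_k) -rmorphM mulVf ?rmorph1 // intr_eq0.
Qed.

Let lin (x : option E) (a : int) (g : R) :
  a != 0 -> @var_free _ P _ x g -> GRing.lreg (pvar k x *~ a + g).
Proof.
by move=> /int_unit[u ua] gx; exact: (@lreg_int_linear _ P _ x a u g ua gx).
Qed.

Let free_hh e n : @var_free _ P _ (Some e) (hhbar k Q *~ n).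
Proof. by apply: var_freeMz; apply: var_freeX. Qed.

Let free_th (o : option E) e : o != Some e -> @var_free _ P _ o (theta k e).
Proof. by move=> oe; apply: var_freeX; rewrite eq_sym. Qed.

Fact baseR_nat n : (0 < n)%N -> GRing.lreg (n%:R : R).
Proof.
move=> n0; have /int_unit[u ua] : n%:Z != 0 by rewrite -lt0n.
move: ua; rewrite -pmulrn => ua.
apply: (@lregW _ (pconst _ u)); rewrite (_ : _ * _ = 1); first exact: lreg1.
rewrite -(rmorph_nat (@pconst k _)) -rmorphM ua; exact: rmorph1.
Qed.

Fact baseR_hbar (n : int) : n != 0 -> GRing.lreg (hhbar k Q *~ n).
Proof.
move=> n0; rewrite -[_ *~ _]addr0; apply: lin => //.
by move=> s _; exact: rmorph0.
Qed.

Fact baseR_th e (n : int) : GRing.lreg (theta k e + hhbar k Q *~ n).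
Proof. by rewrite -[theta k e]mulr1z; apply: lin => //; exact: free_hh. Qed.

Fact baseR_thB (e e' : E) (n : int) : e != e' ->
  GRing.lreg (theta k e - theta k e' + hhbar k Q *~ n).
Proof.
move=> ne; rewrite -[theta k e]mulr1z -addrA; apply: lin => //.
apply: (var_freeD (P := P)); last exact: free_hh.
by apply: (var_freeN (P := P)); exact: free_th.
Qed.

Fact baseR_thD (e e' : E) (n : int) :
  GRing.lreg (theta k e + theta k e' + hhbar k Q *~ n).
Proof.
(* For equal edges the coefficient of theta_e is 2, which is invertible as well. *)
have [->|ne] := eqVneq e e'; first by rewrite -mulr2n pmulrn; apply: lin.
rewrite -[theta k e]mulr1z -addrA; apply: lin => //.
by apply: (var_freeD (P := P)); [exact: free_th | exact: free_hh].
Qed.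

Fact baseR_cycle (n : nat) (c : E -> int) : (0 < n)%N ->
  GRing.lreg (hhbar k Q *+ n + \sum_e theta k e *~ c e).
Proof.
move=> n0; rewrite pmulrn; apply: lin; first by rewrite -lt0n.
by apply: (var_free_sum (P := P)) => e; apply: (var_freeMz (P := P)); exact: free_th.
Qed.

Definition quiver_base : base_ring E :=
  BaseRing baseR_nat baseR_hbar baseR_th baseR_thB baseR_thD baseR_cycle.

End BaseRing.

(** * Words and symmetrizations *)

Lemma count_fsetD1 (Z : choiceType) (Y : {fset Z}) p (P : pred Z) : p \in Y ->
  count P Y = (P p + count P (Y `\ p)%fset)%N.
Proof.
move=> pY; have pe : perm_eq Y (p :: (Y `\ p)%fset).
  apply: uniq_perm => [||q]; rewrite /= ?fset_uniq ?andbT ?inE ?eqxx //=.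
  by case: eqVneq => [->|].
by rewrite (seq.permP pe).
Qed.

Section WordSum.
Variables (B : comNzRingType) (K : eqType) (Z : choiceType) (col : Z -> K).
Variables (x : Z -> B) (g : Z -> Z -> B) (e : {fset Z} -> B).

(** A sum over the injective assignments of the letters to elements of Y, one letter at a time. The
    weights g and e stay general: words use the kernel of the shuffle product, and [inj_sum] below
    takes both equal to 1. *)
Fixpoint word_sum (s : seq (K * nat)) (Y : {fset Z}) : B :=
  if s is (i, d) :: s' then
    \sum_(p <- Y | col p == i)
      x p ^+ d * (\prod_(q <- (Y `\ p)%fset) g p q) * word_sum s' (Y `\ p)%fset
  else e Y.

End WordSum.

Section Words.
Variables (Q : quiver) (R : base_ring (edge Q)).
Notation I := (vertex Q).
Notation E := (edge Q).

Definition bhbar : R := bhh R *+ 2.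

Definition word := seq (I * nat).

Definition content (s : word) : {ffun I -> nat} :=
  [ffun i => count (fun l : I * nat => l.1 == i) s].

Section Factors.
Variables (B : comNzRingType) (c : {rmorphism R -> B}).
Variables (Z : choiceType) (col : Z -> I) (x : Z -> B).

Definition edge_factor p q : B :=
  \prod_(e | (src e == col p) && (tgt e == col q))
     (x q - x p + c (bth R e - bhh R))
  * \prod_(e | (src e == col q) && (tgt e == col p))
     (x p - x q + c (bth R e + bhh R)).

Definition root_factor p q : B :=
  if col p == col q then x p - x q - c bhbar else 1.

Definition diff_factor p q : B :=
  if col p == col q then x q - x p else 1.

(* The numerator of zeta_{col p, col q}(x_p - x_q), times the difference in its
   denominator. *)
Definition word_factor p q : B :=
  root_factor p q * edge_factor p q * diff_factor p q.

(* The value at the variables in Y of the shuffle product of the x^d in degree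
   alpha_i for the letters (i, d) of s, times the product of the x_p - x_q for
   p != q of the same color. *)
Definition word_poly : word -> {fset Z} -> B :=
  word_sum col x word_factor (fun Y => if Y == fset0 then 1 else 0).

Lemma content_cons (i : I) (d : nat) s j :
  content ((i, d) :: s) j = ((i == j) + content s j)%N.
Proof. by rewrite !ffunE. Qed.

(** Every letter consumes a variable of its color and none may be left over. Identities between
    homogeneous combinations therefore need checking on sets of one color type only. *)
Lemma word_poly_content s (Y : {fset Z}) i :
  count (fun p => col p == i) Y != content s i -> word_poly s Y = 0.
Proof.
rewrite /word_poly; elim: s Y => [|[j d] s IH] Y /=.
  by rewrite ffunE /=; case: ifP => // /eqP ->.
move=> ne; rewrite big_seq_cond big1 // => p /andP[pY /eqP pj].
rewrite IH ?mulr0 //; move: ne; rewrite content_cons (count_fsetD1 _ pY) pj.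
by rewrite eqn_add2l.
Qed.

End Factors.

Section Naturality.
Variables (B B' : comNzRingType) (c : {rmorphism R -> B}) (c' : {rmorphism R -> B'}).
Variables (phi : {rmorphism B -> B'}).
Hypothesis phi_c : forall r, phi (c r) = c' r.
Variables (Z Z' : choiceType) (col : Z -> I) (col' : Z' -> I).
Variables (x : Z -> B) (x' : Z' -> B') (f : Z -> Z').

Lemma word_factor_map p q :
  col' (f p) = col p -> col' (f q) = col q ->
  phi (x p) = x' (f p) -> phi (x q) = x' (f q) ->
  phi (word_factor c col x p q) = word_factor c' col' x' (f p) (f q).
Proof.
move=> cp cq xp xq; rewrite /word_factor /edge_factor !rmorphM !rmorph_prod.
rewrite /root_factor /diff_factor cp cq; congr (_ * (_ * _) * _).
- by case: ifP => _; rewrite ?rmorph1 // !rmorphB !phi_c xp xq.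
- by apply: eq_bigr => e _; rewrite rmorphD rmorphB phi_c xp xq.
- by apply: eq_bigr => e _; rewrite rmorphD rmorphB phi_c xp xq.
- by case: ifP => _; rewrite ?rmorph1 // rmorphB xp xq.
Qed.

(** Naturality in the ring and in the variables at once. Specialization at strings, renaming of
    variables and the shift by u_p are instances. *)
Lemma word_poly_map s (Y : {fset Z}) :
  {in Y &, injective f} ->
  {in Y, forall p, col' (f p) = col p} ->
  {in Y, forall p, phi (x p) = x' (f p)} ->
  phi (word_poly c col x s Y) = word_poly c' col' x' s [fset f p | p in Y]%fset.
Proof.
rewrite /word_poly; elim: s Y => [|[i d] s IH] Y fI fc fx /=.
  have -> : ([fset f p | p in Y]%fset == fset0) = (Y == fset0).
    by rewrite -!cardfs_eq0 card_in_imfset.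
  by case: ifP => _; rewrite ?rmorph1 ?rmorph0.
rewrite big_mkcond [RHS]big_mkcond big_imfset //= rmorph_sum.
rewrite [LHS]big_seq_cond [RHS]big_seq_cond; apply: eq_bigr => p /andP[pY _].
rewrite fc //; case: ifP => _; last by rewrite rmorph0.
have eD : ([fset f q | q in Y] `\ f p)%fset = [fset f q | q in (Y `\ p)%fset]%fset.
  apply/fsetP => z; rewrite !inE; apply/andP/imfsetP => /= [[zp /imfsetP[q qY e]]|[q]].
    by exists q => //; rewrite !inE qY andbT; apply: contraNneq zp => <-; rewrite e.
  rewrite !inE => /andP[qp qY] ->; split; last by apply/imfsetP; exists q.
  by apply: contraNneq qp => /fI -> //.
rewrite !rmorphM rmorphXn rmorph_prod fx // eD; congr (_ * _ * _).
  rewrite [RHS]big_imfset /=; last first.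
    by move=> q r; rewrite !inE => /andP[_ qY] /andP[_ rY]; apply: fI.
  rewrite [LHS]big_seq [RHS]big_seq; apply: eq_bigr => q; rewrite !inE => /andP[_ qY].
  by apply: word_factor_map; rewrite ?fc ?fx.
apply: IH => [q r|q|q]; rewrite !inE.
- by move=> /andP[_ qY] /andP[_ rY]; apply: fI.
- by move=> /andP[_ qY]; apply: fc.
- by move=> /andP[_ qY]; apply: fx.
Qed.

End Naturality.

End Words.

Lemma map_nth_index (T : eqType) (l t : seq T) : uniq l -> size t = size l ->
  [seq @nth T q t (index q l) | q <- l] = t.
Proof.
elim: l t => [|a l IH] [|b t] //= /andP[al ul] [st]; rewrite eqxx /=.
congr (_ :: _); rewrite -[RHS](IH t ul st); apply/eq_in_map => q ql.
by case: eqVneq => // aq; rewrite aq ql in al.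
Qed.

Section WordCombinations.
Variables (Q : quiver) (R : base_ring (edge Q)) (B : comNzRingType).
Variables (c : {rmorphism R -> B}) (Z : choiceType) (col : Z -> vertex Q) (x : Z -> B).

Definition word_comb := seq (R * word Q).

Definition word_comb_poly (T : word_comb) Y : B :=
  \sum_(t <- T) c t.1 * word_poly c col x t.2 Y.

Definition word_comb_scale r (T : word_comb) : word_comb :=
  [seq (r * t.1, t.2) | t <- T].

Lemma word_comb_poly_cat T1 T2 Y :
  word_comb_poly (T1 ++ T2) Y = word_comb_poly T1 Y + word_comb_poly T2 Y.
Proof. exact: big_cat. Qed.

Lemma word_comb_poly_scale r T Y :
  word_comb_poly (word_comb_scale r T) Y = c r * word_comb_poly T Y.
Proof.
rewrite /word_comb_poly big_map mulr_sumr; apply: eq_bigr => t _ /=.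
by rewrite rmorphM mulrA.
Qed.

Definition homogeneous_comb (n : {ffun vertex Q -> nat}) (T : word_comb) :=
  all (fun t => content t.2 == n) T.

Lemma homogeneous_comb_cat n T1 T2 :
  homogeneous_comb n (T1 ++ T2) = homogeneous_comb n T1 && homogeneous_comb n T2.
Proof. exact: all_cat. Qed.

Lemma homogeneous_comb_scale n r T :
  homogeneous_comb n (word_comb_scale r T) = homogeneous_comb n T.
Proof. by rewrite /homogeneous_comb all_map. Qed.

End WordCombinations.

(** * Words as sums over color-preserving permutations *)

Section ColorPerms.
Variables (B : comNzRingType) (K : eqType) (V : finType) (col : V -> K).
Variables (x : V -> B) (g : V -> V -> B) (e : {fset V} -> B).
Hypothesis e0 : e fset0 = 1.
Implicit Types (s : {perm V}) (p q : V).

Definition color_perm s := [forall p, col (s p) == col p].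

Lemma color_permP s : reflect (forall p, col (s p) = col p) (color_perm s).
Proof. exact: 'forall_eqP. Qed.

Lemma color_permM s t : color_perm s -> color_perm t -> color_perm (s * t)%g.
Proof.
by move=> /color_permP cs /color_permP ct; apply/color_permP => p; rewrite permM ct cs.
Qed.

Definition full : {fset V} := [fset p | p in V]%fset.

Fixpoint list_prod (l : seq V) : B :=
  if l is p :: l' then (\prod_(q <- l') g p q) * list_prod l' else 1.

Definition letters (l : seq V) (m : V -> nat) : seq (K * nat) := [seq (col p, m p) | p <- l].

Definition avoid (t : seq V) : {fset V} := [fset p in enum V | p \notin t]%fset.

Lemma in_avoid t p : (p \in avoid t) = (p \notin t).
Proof. by rewrite !inE mem_enum. Qed.

(** Induction on the letters still to be placed: t' lists the images of the letters l' placed so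
    far, and the choice of the next variable fixes one more value of the permutation. *)
Lemma letters_sum_aux (l' l t' : seq V) m :
  uniq (l' ++ l) -> (forall p, p \in l' ++ l) ->
  uniq t' -> map col t' = map col l' ->
  word_sum col x g e (letters l m) (avoid t') =
  \sum_(s | color_perm s && (map s l' == t'))
    (\prod_(p <- l) x (s p) ^+ m p) * list_prod (map s l).
Proof.
elim: l l' t' => [|p l IH] l' t' /=.
  rewrite cats0 => ul lV ut ct.
  have st : size t' = size l' by rewrite -(size_map col) ct size_map.
  have mt p : p \in t'.
    have /esym/eqP : #|t'| = #|V|.
      by rewrite (card_uniqP ut) st -(card_uniqP ul); apply/eq_card => q; rewrite lV.
    by move=> /eqP/esym ec; have /(_ p) := (subset_cardP ec (subset_predT _)); rewrite inE.
  rewrite (_ : avoid t' = fset0) ?e0; last first.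
    by apply/fsetP => p; rewrite in_avoid mt inE.
  have idx q : (index q l' < size l')%N by rewrite index_mem lV.
  pose f q := nth q t' (index q l').
  have fI : injective f.
    move=> p q; rewrite /f (set_nth_default p) ?st // => /eqP.
    by rewrite nth_uniq ?st // => /eqP; apply: index_inj; rewrite ?lV.
  pose s0 := perm fI.
  have s0E : map s0 l' = t'.
    by rewrite -[RHS](map_nth_index ul st); apply: eq_map => q; rewrite permE.
  rewrite (big_pred1 s0) ?big_nil ?mul1r // => s /=; apply/andP/eqP => [[_ /eqP es]|->].
    apply/permP => q; move: es; rewrite -s0E => /eq_in_map; exact.
  rewrite s0E eqxx; split=> //; apply/color_permP => q.
  by move: ct; rewrite -s0E -map_comp => /eq_in_map; exact.
move=> ul lV ut ct.
have ul' : uniq (rcons l' p ++ l) by rewrite cat_rcons.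
have pl' : p \notin l' by move: ul'; rewrite cat_uniq rcons_uniq => /andP[/andP[]].
(* The value at p is the variable taken by the letter of p. Values already used or of the wrong
   color occur for no permutation in the sum. *)
rewrite [RHS](partition_big (fun s : {perm V} => s p) predT) //=.
rewrite [RHS](bigID (fun q => (q \in avoid t') && (col q == col p))) /=.
rewrite [X in _ + X]big1 ?addr0; last first.
  move=> q nq; rewrite big_pred0 // => s; apply/negP => /andP[/andP[cs /eqP st'] /eqP sp].
  case/negP: nq; rewrite -sp (color_permP _ cs) eqxx andbT in_avoid -st'.
  by rewrite mem_map //; exact: perm_inj.
rewrite -[LHS]big_filter -[RHS]big_filter.
rewrite (perm_big [seq q <- index_enum V | (q \in avoid t') && (col q == col p)]); last first.
  apply: uniq_perm => [||q]; rewrite ?filter_uniq ?fset_uniq ?index_enum_uniq //.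
  by rewrite !mem_filter mem_index_enum andbT andbC.
rewrite [LHS]big_seq [RHS]big_seq; apply: eq_bigr => q.
rewrite mem_filter in_avoid => /andP[/andP[qt /eqP cq] _].
have -> : (avoid t' `\ q)%fset = avoid (rcons t' q).
  by apply/fsetP => r; rewrite in_fsetD1 !in_avoid mem_rcons inE negb_or.
have ut' : uniq (rcons t' q) by rewrite rcons_uniq qt.
rewrite (IH (rcons l' p)) //; first last.
- by rewrite !map_rcons ct cq.
- by move=> r; rewrite cat_rcons; exact: lV.
rewrite mulr_sumr; apply: eq_big => s.
  by rewrite map_rcons eqseq_rcons andbA.
rewrite map_rcons eqseq_rcons => /andP[cs /andP[/eqP sl' /eqP sp]].
rewrite big_cons sp.
have pe : perm_eq (map s l) (avoid (rcons t' q)).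
  have usl : uniq (map s (rcons l' p ++ l)) by rewrite map_inj_uniq //; exact: perm_inj.
  move: (usl); rewrite map_cat map_rcons sl' sp cat_uniq => /and3P[_ dis ul2].
  apply: uniq_perm => //; first exact: fset_uniq.
  move=> r; rewrite in_avoid; have : r \in map s (rcons l' p ++ l).
    rewrite -(permKV s r) mem_map; last exact: perm_inj.
    by rewrite cat_rcons; exact: lV.
  rewrite map_cat map_rcons sl' sp mem_cat; case: (boolP (r \in rcons _ _)) => /= [rt _|//].
  by apply/negP => rl; move/hasPn: dis => /(_ r rl); rewrite /= rt.
by rewrite (perm_big _ pe) /=; ring.
Qed.

Lemma avoid_nil : avoid [::] = full.
Proof. by apply/fsetP => p; rewrite in_avoid !inE. Qed.

Lemma letters_sum (l : seq V) m : uniq l -> (forall p, p \in l) ->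
  word_sum col x g e (letters l m) full =
  \sum_(s | color_perm s) (\prod_(p <- l) x (s p) ^+ m p) * list_prod (map s l).
Proof.
move=> ul lV; rewrite -avoid_nil (letters_sum_aux (l' := [::])) //.
by apply: eq_bigl => s; rewrite andbT.
Qed.

End ColorPerms.
Arguments full {V}.

(** * Layerings and the span of words *)

Section Symmetrization.
Variables (Q : quiver) (R : base_ring (edge Q)) (P : poly_functor R).
Variables (V : finType) (col : V -> vertex Q).
Notation I := (vertex Q).
Notation E := (edge Q).
Notation x := (pX P).
Notation C := (pC P V).
Implicit Types (lam mu : V -> nat) (p q : V) (f g h : P V) (s : {perm V}).
Notation color_perm := (color_perm col).
Notation letters := (letters col).

Definition perm_act s : {rmorphism P V -> P V} := pS P (fun p => x (s p)).

Lemma perm_actX s p : perm_act s (x p) = x (s p).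
Proof. exact: pSX. Qed.

Lemma perm_actC s r : perm_act s (C r) = C r.
Proof. exact: pSC. Qed.

Lemma perm_actM s t f : perm_act s (perm_act t f) = perm_act (t * s)%g f.
Proof.
by rewrite [LHS]pS_comp; apply: eq_pS => p; rewrite perm_actX permM.
Qed.

Definition color_symmetric f := forall s, color_perm s -> perm_act s f = f.

Definition symmetrize f := \sum_(s | color_perm s) perm_act s f.

Lemma symmetrize_sym f : color_symmetric (symmetrize f).
Proof.
move=> s cs; rewrite /symmetrize rmorph_sum /=.
under eq_bigr do rewrite perm_actM.
rewrite [RHS](reindex_inj (mulIg s)) /=; apply: eq_bigl => t.
apply/idP/idP => [ct|cts]; first exact: color_permM.
have /color_permP cs' := cs; have /color_permP cts' := cts.
by apply/color_permP => p; rewrite -cs' -permM cts'.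
Qed.

Lemma symmetrizeB f g : symmetrize (f - g) = symmetrize f - symmetrize g.
Proof. by rewrite -sumrB; apply: eq_bigr => s _; rewrite rmorphB. Qed.

Lemma symmetrizeD f g : symmetrize (f + g) = symmetrize f + symmetrize g.
Proof. by rewrite -big_split; apply: eq_bigr => s _; rewrite rmorphD. Qed.

Lemma symmetrizeMl f g : color_symmetric f -> symmetrize (f * g) = f * symmetrize g.
Proof.
by move=> sf; rewrite mulr_sumr; apply: eq_bigr => s cs; rewrite rmorphM sf.
Qed.

Definition root_weight lam : P V :=
  \prod_p \prod_(q | [&& p != q, col p == col q & (lam p <= lam q)%N])
     (x p - x q - C (bhbar R)).

Definition edge_weight lam : P V :=
  \prod_e \prod_(p | col p == src e) \prod_(q | col q == tgt e)
    (if (lam p < lam q)%N then x q - x p + C (bth R e - bhh R)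
     else if (lam q < lam p)%N then x q - x p + C (bth R e + bhh R) else 1).

Definition same_weight lam : P V :=
  \prod_p \prod_(q | [&& p != q, col p == col q & lam p == lam q]) (x p - x q).

Definition cross_weight lam : P V :=
  \prod_p \prod_(q | (col p == col q) && (lam p < lam q)%N) (x q - x p).

(* The layers of lam are multiplied in increasing order; inside a layer the edge
   factors are missing and both root factors are present. *)
Definition layer_weight lam : P V :=
  root_weight lam * edge_weight lam * (same_weight lam * cross_weight lam).

Lemma layer_weightE lam : layer_weight lam =
  root_weight lam * edge_weight lam * (same_weight lam * cross_weight lam).
Proof. by []. Qed.

Notation list_weight := (list_prod (word_factor C col x)).

Lemma perm_act_list_weight s l : color_perm s ->
  perm_act s (list_weight l) = list_weight (map s l).
Proof.
move=> /color_permP cs; elim: l => [|p l IH] /=; first by rewrite rmorph1.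
rewrite rmorphM IH rmorph_prod big_map; congr (_ * _).
apply: eq_bigr => q _; apply: (@word_factor_map _ _ _ _ C C) => //.
- exact: perm_actC.
- exact: perm_actX.
- exact: perm_actX.
Qed.

Lemma list_weight_sorted mu (l : seq V) :
  pairwise (fun p q => mu p < mu q)%N l ->
  list_weight l = \prod_(p <- l) \prod_(q <- l | (mu p < mu q)%N) word_factor C col x p q.
Proof.
elim: l => [|p l IH] /=; first by rewrite big_nil.
move=> /andP[/allP pl /IH ->]; rewrite big_cons big_cons ltnn; congr (_ * _).
  by rewrite big_seq [RHS]big_seq_cond; apply: eq_bigl => q; rewrite andb_idr // => /pl.
rewrite big_seq [RHS]big_seq; apply: eq_bigr => q ql; rewrite big_cons.
by rewrite ltnNge ltnW ?pl.
Qed.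

(** With one variable per layer no factor is missing: the product is the kernel of the shuffle
    product along the order given by mu. *)
Lemma layer_weight_inj mu : injective mu ->
  layer_weight mu = \prod_p \prod_(q | (mu p < mu q)%N) word_factor C col x p q.
Proof.
move=> muI.
have same1 : same_weight mu = 1.
  rewrite /same_weight big1 // => p _; rewrite big_pred0 // => q.
  by apply/and3P => -[pq _ /eqP /muI e]; rewrite e eqxx in pq.
have rootE : root_weight mu =
    \prod_p \prod_(q | (mu p < mu q)%N) root_factor C col x p q.
  apply: eq_bigr => p _; rewrite [RHS](bigID (fun q => col p == col q)) /=.
  rewrite [X in _ * X]big1 ?mulr1; last by move=> q /andP[_ /negbTE cpq]; rewrite /root_factor cpq.
  apply: eq_big => [q|q /and3P[_ cpq _]]; last by rewrite /root_factor cpq.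
  by rewrite ltn_neqAle (inj_eq muI); case: (p == q) => //=; rewrite andbC.
have crossE : cross_weight mu =
    \prod_p \prod_(q | (mu p < mu q)%N) diff_factor col x p q.
  apply: eq_bigr => p _; rewrite [RHS](bigID (fun q => col p == col q)) /=.
  rewrite [X in _ * X]big1 ?mulr1; last by move=> q /andP[_ /negbTE cpq]; rewrite /diff_factor cpq.
  by apply: eq_big => [q|q /andP[cpq _]]; [rewrite andbC | rewrite /diff_factor cpq].
have edgeE : edge_weight mu =
    \prod_p \prod_(q | (mu p < mu q)%N) edge_factor C col x p q.
  pose F e p q : P V := x q - x p + C (bth R e - bhh R).
  pose G e p q : P V := x q - x p + C (bth R e + bhh R).
  (* The edge weight runs over source and target, the kernel over earlier and later variable. The
     second product collects the edges whose source is the later variable, with the roles of p and q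
     exchanged. *)
  transitivity ((\prod_e \prod_p \prod_q
      if [&& src e == col p, tgt e == col q & (mu p < mu q)%N] then F e p q else 1) *
     (\prod_e \prod_p \prod_q
      if [&& src e == col q, tgt e == col p & (mu p < mu q)%N] then G e q p else 1)).
    rewrite -big_split; apply: eq_bigr => e _ /=.
    rewrite [X in _ * X]exchange_big -big_split big_mkcond /=.
    apply: eq_bigr => p _; rewrite -big_split /= [col p == _]eq_sym.
    case: ifP => [_|sp]; last by rewrite big1 // => q _; rewrite mul1r.
    rewrite big_mkcond; apply: eq_bigr => q _ /=; rewrite [col q == _]eq_sym.
    case: ifP => _ /=; last by rewrite mul1r.
    by case: ltngtP => _ /=; rewrite ?mulr1 ?mul1r.
  rewrite exchange_big [X in _ * X]exchange_big -big_split; apply: eq_bigr => p _ /=.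
  rewrite exchange_big [X in _ * X]exchange_big -big_split [RHS]big_mkcond.
  apply: eq_bigr => q _ /=; rewrite /edge_factor.
  case: ifP => mpq; last first.
    by rewrite !big1 ?mulr1 // => e _; rewrite !andbF.
  by congr (_ * _); rewrite [RHS]big_mkcond; apply: eq_bigr => e _; rewrite andbT.
rewrite /layer_weight same1 mul1r rootE crossE edgeE -!big_split /=.
by apply: eq_bigr => p _; rewrite -!big_split.
Qed.

Definition colors : {ffun I -> nat} := [ffun i => #|[pred p | col p == i]|].

(** The content is recorded because combinations are later evaluated on sets and strings of every
    color type, and homogeneity forces zero on all types but one. *)
Definition word_span f :=
  exists2 T : word_comb R, homogeneous_comb colors T
                         & f = word_comb_poly C col x T full.

Lemma word_span0 : word_span 0.
Proof. by exists [::] => //; rewrite /word_comb_poly big_nil. Qed.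

Lemma word_spanD f g : word_span f -> word_span g -> word_span (f + g).
Proof.
move=> [T hT ->] [T' hT' ->]; exists (T ++ T'); first by rewrite homogeneous_comb_cat hT.
by rewrite word_comb_poly_cat.
Qed.

Lemma word_spanZ r f : word_span f -> word_span (C r * f).
Proof.
move=> [T hT ->]; exists (word_comb_scale r T); first by rewrite homogeneous_comb_scale.
by rewrite word_comb_poly_scale.
Qed.

Lemma word_spanB f g : word_span f -> word_span g -> word_span (f - g).
Proof.
move=> sf sg; have := word_spanD sf (word_spanZ (-1) sg).
by rewrite rmorphN1 mulN1r.
Qed.

(** The word has one letter per variable, in increasing order of mu, with the exponents of the
    monomial. *)
Lemma word_span_monomial mu m : injective mu ->
  word_span (symmetrize (\prod_p x p ^+ m p * layer_weight mu)).
Proof.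
move=> muI; pose l := sort (fun p q => mu p <= mu q)%N (enum V).
have pl : perm_eq l (enum V) by rewrite perm_sort.
have ul : uniq l by rewrite (perm_uniq pl) enum_uniq.
have lV p : p \in l by rewrite (perm_mem pl) mem_enum.
have sl : pairwise (fun p q => mu p < mu q)%N l.
  have : pairwise (fun p q => mu p <= mu q)%N l.
    rewrite -sorted_pairwise; last by move=> ? ? ?; exact: leq_trans.
    by apply: sort_sorted => ? ?; exact: leq_total.
  elim: (l) ul => //= p l' IH /andP[pl' ul'] /andP[/allP al pw].
  rewrite IH // andbT; apply/allP => q ql; rewrite ltn_neqAle al // andbT.
  by apply: contraNneq pl' => /muI ->.
have bigl (F : V -> P V) : \prod_p F p = \prod_(p <- l) F p.
  by rewrite (perm_big _ pl) big_enum.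
have biglP (F : V -> P V) (D : pred V) :
    \prod_(q | D q) F q = \prod_(q <- l | D q) F q.
  by rewrite (perm_big _ pl) big_enum_cond.
exists [:: (1, letters l m)].
  rewrite /homogeneous_comb /= andbT; apply/eqP/ffunP => i; rewrite !ffunE.
  rewrite count_map cardE size_filter (seq.permP pl).
  by rewrite enumT; apply: eq_count.
rewrite /word_comb_poly big_seq1 rmorph1 mul1r /word_poly letters_sum ?eqxx //.
apply: eq_bigr => s cs; rewrite rmorphM; congr (_ * _).
  by rewrite bigl rmorph_prod; apply: eq_bigr => p _; rewrite rmorphXn perm_actX.
rewrite -perm_act_list_weight // (list_weight_sorted sl) layer_weight_inj // bigl.
by congr (perm_act s _); apply: eq_bigr => p _; rewrite biglP.
Qed.

Lemma zspan_monomial f :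
  zspan (fun g => exists r m, g = C r * \prod_p x p ^+ m p) f.
Proof.
set M := zspan _.
have MD f1 f2 : M f1 -> M f2 -> M (f1 + f2).
  move=> M1 M2; rewrite -[f2]opprK -[- f2]sub0r.
  by apply: zspanB => //; apply: zspanB => //; exact: zspan0.
(* In this form the case of a product in the induction on f is immediate. *)
suff H : forall g, M g -> M (f * g).
  rewrite -[f]mulr1; apply: H; apply: zspan_in; exists 1, (fun=> 0)%N.
  by rewrite rmorph1 mul1r big1.
elim/pring_ind: f => [r|p|f1 f2 H1 H2|f1 f2 H1 H2] g Mg.
- elim: Mg => [_ [q [m ->]]||g1 g2 _ IH1 _ IH2].
  + by apply: zspan_in; exists (r * q), m; rewrite rmorphM mulrA.
  + by rewrite mulr0; exact: zspan0.
  + by rewrite mulrBr; exact: zspanB.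
- elim: Mg => [_ [q [m ->]]||g1 g2 _ IH1 _ IH2].
  + apply: zspan_in; exists q, (fun p' => (p' == p) + m p')%N.
    rewrite mulrCA (bigD1 p) //= [X in _ = C q * X](bigD1 p) //= eqxx exprS.
    rewrite -mulrA; congr (_ * (_ * (_ * _))).
    by apply: eq_bigr => p' /negbTE ->.
  + by rewrite mulr0; exact: zspan0.
  + by rewrite mulrBr; exact: zspanB.
- by rewrite mulrDl; apply: MD; [exact: H1 | exact: H2].
- by rewrite -mulrA; apply/H1/H2.
Qed.

Lemma word_span_symmetrize mu h : injective mu ->
  word_span (symmetrize (h * layer_weight mu)).
Proof.
move=> muI; elim: (zspan_monomial h) => [_ [r [m ->]]||g1 g2 _ IH1 _ IH2].
- rewrite -mulrA symmetrizeMl; last by move=> s _; exact: perm_actC.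
  exact/word_spanZ/word_span_monomial.
- rewrite mul0r /symmetrize big1; first exact: word_span0.
  by move=> s _; rewrite rmorph0.
- by rewrite mulrBl symmetrizeB; exact: word_spanB.
Qed.

End Symmetrization.

(** * Covering by vanishing and nonvanishing loci *)

Section Dichotomy.
Variables (A : comNzRingType) (S : central_mulset A).

Definition is_ideal (K : A -> Prop) :=
  [/\ K 0, forall f g, K f -> K g -> K (f + g) & forall f g, K g -> K (f * g)].

Definition adjoin (f : A) (K : A -> Prop) (g : A) := exists a, K (g - a * f).

Lemma is_ideal_adjoin f K : is_ideal K -> is_ideal (adjoin f K).
Proof.
move=> [K0 KD KM]; split; first by exists 0; rewrite mul0r subr0.
  move=> g h [a Ka] [b Kb]; exists (a + b).
  by rewrite mulrDl opprD addrACA; exact: KD.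
by move=> g h [a Ka]; exists (g * a); rewrite -mulrA -mulrBr; exact: KM.
Qed.

Variables (T : eqType) (F : T -> A) (K : A -> Prop).
Hypothesis KI : is_ideal K.

Definition adjoin_seq (Z : seq T) := foldr (fun t => adjoin (F t)) K Z.

Lemma is_ideal_adjoin_seq Z : is_ideal (adjoin_seq Z).
Proof. by elim: Z => //= t Z IH; exact: is_ideal_adjoin. Qed.

Lemma sub_adjoin_seq Z f : K f -> adjoin_seq Z f.
Proof.
by elim: Z => //= t Z IH Kf; exists 0; rewrite mul0r subr0; exact: IH.
Qed.

Lemma mem_adjoin_seq Z t : t \in Z -> adjoin_seq Z (F t).
Proof.
elim: Z => //= t' Z IH; rewrite inE => /predU1P[->|/IH H].
  exists 1; rewrite mul1r subrr; by case: (is_ideal_adjoin_seq Z).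
by exists 0; rewrite mul0r subr0.
Qed.

(* Some element of S vanishes on the locus where K and Z vanish and N does not. *)
Let covered Z N := exists r m, S r /\ adjoin_seq Z (r * (\prod_(t <- N) F t) ^+ m).

(** Glues the closed piece where [F t] vanishes and the open piece where it does not. *)
Lemma covered_split t Z N : covered (t :: Z) N -> covered Z (t :: N) -> covered Z N.
Proof.
move=> [r [m [Sr [a Ka]]]] [r' [m' [Sr' Kb]]].
have [J0 JD JM] := is_ideal_adjoin_seq Z.
set n := \prod_(i <- N) F i in Ka *; rewrite big_cons -/n in Kb.
have powJ u w j : adjoin_seq Z (u - w) -> adjoin_seq Z (u ^+ j - w ^+ j).
  by move=> Juw; rewrite subrXX mulrC; exact: JM.
(* Modulo the ideal of Z the first relation says that r n^m equals a times [F t]. Its power with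
   exponent m', multiplied by r' n^m', becomes a multiple of the element of the second relation. *)
exists (r' * r ^+ m'), (m * m' + m')%N; split.
  by apply: cmsM => //; elim: (m') => [|j IH]; [exact: cms1 | rewrite exprS; exact: cmsM].
have := JD _ _ (JM (r' * n ^+ m') _ (powJ _ _ m' Ka)) (JM (a ^+ m') _ Kb).
by congr adjoin_seq; rewrite !exprMn exprD exprM; ring.
Qed.

(** Each [F t] is either put into the ideal or inverted. The hypothesis settles every resulting pair
    (Z, N), and [covered_split] eliminates the elements one at a time. *)
Lemma ideal_dichotomy (l : seq T) :
  (forall Z N, perm_eq (Z ++ N) l ->
     (exists2 r, S r & adjoin_seq Z r) \/ K (\prod_(t <- N) F t)) ->
  exists2 r, S r & K r.
Proof.
move=> H; suff [r [m [Sr /= Kr]]] : covered [::] [::].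
  by exists r => //; move: Kr; rewrite big_nil expr1n mulr1.
have : forall Z N, perm_eq (Z ++ N) (l ++ [::] ++ [::]) -> covered Z N.
  move=> Z N; rewrite !cats0 => /H[[r Sr Kr]|Kn].
    by exists r, 0%N; rewrite expr0 mulr1.
  exists 1, 1%N; split; first exact: cms1.
  by rewrite mul1r expr1; exact: sub_adjoin_seq.
suff aux Z0 N0 : (forall Z N, perm_eq (Z ++ N) (l ++ Z0 ++ N0) -> covered Z N) ->
  covered Z0 N0 by exact: aux.
elim: l Z0 N0 {H} => [|t l IH] Z0 N0 H; first exact: H.
apply: (@covered_split t); apply: IH => Z N pe; apply: H; apply: (perm_trans pe);
  by apply/seq.permP => a; rewrite /= !count_cat /= ?count_cat /=; lia.
Qed.

End Dichotomy.

(** * A regular scalar in the ideal of a layering *)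

Section UnitIdeal.
Variables (Q : quiver) (R : base_ring (edge Q)) (P : poly_functor R).
Variables (V : finType) (col : V -> vertex Q).
Notation I := (vertex Q).
Notation E := (edge Q).
Notation x := (pX P).
Notation C := (pC P V).
Implicit Types (lam mu : V -> nat) (p q : V) (f g h : P V).

Notation layer_weight := (layer_weight P col).
Notation symmetrize := (symmetrize col).
Notation word_span := (word_span col).

Fact lreg_const1 : exists2 r : R, GRing.lreg r & (1 : P V) = C r.
Proof. by exists 1; [exact: lreg1 | rewrite rmorph1]. Qed.

Fact lreg_constM f g : (exists2 r, GRing.lreg r & f = C r) ->
  (exists2 r, GRing.lreg r & g = C r) -> exists2 r, GRing.lreg r & f * g = C r.
Proof.
move=> [r lr ->] [s ls ->]; exists (r * s); first exact: lregM.
by rewrite rmorphM.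
Qed.

Definition const_mulset : central_mulset (P V) :=
  CentralMulset lreg_const1 lreg_constM (fun f g _ => mulrC f g).

Variable lam : V -> nat.

(* Putting p before q, resp. q before p, multiplies by the form with sign false,
   resp. true. *)
Definition form (t : E * V * V * bool) : P V :=
  let: (e, p, q, b) := t in
  x q - x p + C (if b then bth R e + bhh R else bth R e - bhh R).

Definition in_layer (t : E * V * V * bool) : bool :=
  let: (e, p, q, b) := t in
  [&& p != q, col p == src e, col q == tgt e & lam p == lam q].

Let K f := forall h, word_span (symmetrize (h * f * layer_weight lam)).

Let K_ideal : is_ideal K.
Proof.
split=> [h|f g Kf Kg h|f g Kg h].
- rewrite mulr0 mul0r /symmetrize big1; first exact: word_span0.
  by move=> s _; rewrite rmorph0.
- by rewrite mulrDr mulrDl symmetrizeD; exact: word_spanD.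
- by rewrite mulrA; exact: Kg.
Qed.

Section Order.
Variable Z : seq (E * V * V * bool).

(** Where a form vanishes, the order of its two variables that multiplies by this form gives
    nothing, so the other order is imposed: a has to precede b. *)
Definition before : rel V := fun a b =>
  [exists e, ((e, b, a, false) \in Z) || ((e, a, b, true) \in Z)].

Let J := adjoin_seq form K Z.

(** Written for the imposed direction from a to b, a form of either sign contains +hbar/2. This
    common sign is what makes the sum around a cycle nonzero. *)
Lemma before_form a b : before a b ->
  exists c : E -> int, J (x b - x a + C (bhh R + \sum_e bth R e *~ c e)).
Proof.
have [J0 JD JM] := is_ideal_adjoin_seq form K_ideal Z.
have delta e (n : int) : \sum_e' bth R e' *~ ((e' == e)%:Z * n) = bth R e *~ n.
  rewrite (bigD1 e) //= eqxx mul1r big1 ?addr0 // => e' /negbTE ->.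
  by rewrite mul0r mulr0z.
move=> /existsP[e /orP[] /(mem_adjoin_seq form K_ideal) /= H].
  exists (fun e' => (e' == e)%:Z * -1); rewrite delta mulrN1z.
  have := JM (-1) _ H; congr J; rewrite !rmorphB; ring.
exists (fun e' => (e' == e)%:Z * 1); rewrite delta mulr1z.
by move: H; congr J; rewrite !rmorphD; ring.
Qed.

Lemma connect_form a b : connect before a b ->
  exists m (c : E -> int), J (x b - x a + C (bhh R *+ m + \sum_e bth R e *~ c e)).
Proof.
have [J0 JD JM] := is_ideal_adjoin_seq form K_ideal Z.
move=> /connectP[l pl ->]; elim: l a pl => [|a' l IH] a /=.
  move=> _; exists 0%N, (fun=> 0); rewrite mulr0n big1 ?addr0; last by move=> ? _; exact: mulr0z.
  by rewrite rmorph0 addr0 subrr.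
move=> /andP[/before_form[c Jc] /IH[m [c' Jc']]].
exists m.+1, (fun e => c e + c' e); have := JD _ _ Jc Jc'; congr J.
under [X in _ = _ + C (_ + X)]eq_bigr do rewrite mulrzDr.
by rewrite big_split /= mulrS !rmorphD; ring.
Qed.

(** The variables telescope around the cycle, and its m + 1 steps leave (m + 1) hbar/2 plus a
    combination of the theta_e. *)
Lemma cycle_const a b : before a b -> connect before b a ->
  exists2 r, const_mulset r & J r.
Proof.
have [J0 JD JM] := is_ideal_adjoin_seq form K_ideal Z.
move=> /before_form[c Jc] /connect_form[m [c' Jc']].
exists (C (bhh R *+ m.+1 + \sum_e bth R e *~ (c e + c' e))).
  by exists (bhh R *+ m.+1 + \sum_e bth R e *~ (c e + c' e)) => //; exact: lreg_bcycle.
have := JD _ _ Jc Jc'; congr J.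
under [X in _ = C (_ + X)]eq_bigr do rewrite mulrzDr.
by rewrite big_split /= mulrS !rmorphD; ring.
Qed.

Definition height p := #|[pred a | connect before a p]|.

(** Lexicographic in the layer, the height for [before], and an arbitrary rank that breaks ties. The
    radices exceed the possible heights and ranks. *)
Definition refinement p := ((lam p * #|V|.+1 + height p) * #|V| + enum_rank p)%N.

Lemma height_le p : (height p < #|V|.+1)%N.
Proof. by rewrite ltnS max_card. Qed.

Lemma lex_lt (a b c d n : nat) : (b < n)%N -> (a < c)%N -> (a * n + b < c * n + d)%N.
Proof. by move=> bn ac; have := leq_mul ac (leqnn n); rewrite mulSn; lia. Qed.

Lemma refinement_lam p q : (lam p < lam q)%N -> (refinement p < refinement q)%N.
Proof.
move=> pq; apply: lex_lt; first exact: ltn_ord.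
by apply: lex_lt => //; exact: height_le.
Qed.

Lemma refinement_height p q : lam p = lam q -> (height p < height q)%N ->
  (refinement p < refinement q)%N.
Proof.
by move=> e pq; apply: lex_lt; [exact: ltn_ord | rewrite e ltn_add2l].
Qed.

Lemma refinement_inj : injective refinement.
Proof.
move=> p q /(congr1 (modn^~ #|V|)); rewrite /refinement !modnMDl !modn_small //.
by move=> e; apply: enum_rank_inj; apply: val_inj.
Qed.

Lemma height_before a b : before a b -> ~~ connect before b a ->
  (height a < height b)%N.
Proof.
move=> ab nba; apply: proper_card; apply/properP; split.
  apply/subsetP => p; rewrite !inE => pa; apply: connect_trans pa _.
  exact: connect1.
by exists b; rewrite !inE ?connect0.
Qed.

End Order.

(** Inside a layer both root factors and both differences of a pair are present and mu keeps one of
    each, so refining only removes them. Edge factors are missing inside a layer and have to be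
    supplied; these are the forms in the dividend. *)
Lemma divides_refined mu : injective mu ->
  (forall p q, (lam p < lam q)%N -> (mu p < mu q)%N) ->
  divides (layer_weight mu)
    (\prod_(t | in_layer t && (t.2 == (mu t.1.2 < mu t.1.1.2)%N)) form t
     * layer_weight lam).
Proof.
move=> muI lm.
have lm' p q : (mu p <= mu q)%N -> (lam p <= lam q)%N.
  by rewrite leqNgt => /negP H; rewrite leqNgt; apply/negP => /lm.
have [a ea] : divides (root_weight P col mu) (root_weight P col lam).
  rewrite /root_weight.
  exists (\prod_p \prod_(q | [&& p != q, col p == col q, (lam p <= lam q)%N
                               & ~~ (mu p <= mu q)%N]) (x p - x q - C (bhbar R))).
  rewrite -big_split; apply: eq_bigr => p _ /=.
  rewrite (bigID (fun q => mu p <= mu q)%N) /= mulrC; congr (_ * _).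
    by apply: eq_bigl => q; rewrite -!andbA.
  apply: eq_bigl => q; case: (boolP (mu p <= mu q)%N) => [/lm' ->|]; rewrite ?andbT ?andbF //.
have [b eb] : divides (same_weight P col mu * cross_weight P col mu)
                 (same_weight P col lam * cross_weight P col lam).
  have -> : same_weight P col mu = 1.
    rewrite /same_weight big1 // => p _; rewrite big_pred0 // => q.
    by apply/and3P => -[pq _ /eqP /muI e]; rewrite e eqxx in pq.
  pose D (p q : V) := [&& col p == col q, lam p == lam q & (mu p < mu q)%N].
  have e1 : cross_weight P col mu =
      cross_weight P col lam * \prod_p \prod_(q | D p q) (x q - x p).
    rewrite -big_split; apply: eq_bigr => p _ /=.
    rewrite (bigID (fun q => lam p < lam q)%N) /=; congr (_ * _).
      apply: eq_bigl => q; case: (boolP (lam p < lam q)%N) => [/lm ->|]; rewrite ?andbT ?andbF //.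
    apply: eq_bigl => q; rewrite /D -andbA; congr (_ && _).
    case: (ltngtP (lam p) (lam q)) => [h|h|_]; rewrite ?andbF ?andbT //=.
    by rewrite ltnNge ltnW // lm.
  have e2 : same_weight P col lam =
      \prod_p \prod_(q | D p q) (x p - x q) * \prod_p \prod_(q | D p q) (x q - x p).
    rewrite [X in _ = _ * X](exchange_big_dep predT) //= -big_split.
    apply: eq_bigr => p _ /=; rewrite (bigID (fun q => mu p < mu q)%N) /=.
    congr (_ * _); apply: eq_bigl => q; rewrite /D.
      case: eqVneq => [->|_] //=; last by rewrite -andbA.
      by rewrite ltnn !andbF.
    rewrite eq_sym [col p == _]eq_sym [lam p == _]eq_sym -leqNgt leq_eqVlt (inj_eq muI).
    by case: eqVneq => [->|_] //=; rewrite ?ltnn ?andbF // -andbA.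
  exists (\prod_p \prod_(q | D p q) (x p - x q)).
  by rewrite mul1r e1 e2; ring.
have [c ec] : divides (edge_weight P col mu)
    (\prod_(t | in_layer t && (t.2 == (mu t.1.2 < mu t.1.1.2)%N)) form t
      * edge_weight P col lam).
  exists 1; rewrite mul1r /edge_weight.
  transitivity ((\prod_e \prod_p \prod_q \prod_b
      if in_layer (e, p, q, b) && (b == (mu q < mu p)%N) then form (e, p, q, b) else 1)
       * edge_weight P col lam).
    congr (_ * _); rewrite big_mkcond !pair_big /=.
    by apply: eq_bigr => -[[[e p] q] b'].
  rewrite /edge_weight -big_split; apply: eq_bigr => e _ /=.
  rewrite [X in _ * X = _]big_mkcond [RHS]big_mkcond -big_split; apply: eq_bigr => p _ /=.
  case: ifP => cp; last first.
    by rewrite mulr1 big1 // => q _; rewrite big1 // => b' _; rewrite andbF.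
  rewrite [X in _ * X = _]big_mkcond [RHS]big_mkcond -big_split; apply: eq_bigr => q _ /=.
  case: ifP => cq; last first.
    by rewrite mulr1 big1 // => b' _; rewrite !andbF.
  rewrite big_bool /=.
  case: (ltngtP (lam p) (lam q)) => lpq.
  - by rewrite !andbF !mul1r (lm _ _ lpq).
  - by rewrite !andbF !mul1r ltnNge ltnW ?lm.
  - case: (ltngtP (mu p) (mu q)) => mpq; rewrite /= ?mulr1 ?mul1r ?andbT ?andbF.
    + by case: eqVneq mpq => [->|]; rewrite ?ltnn ?mulr1 ?mul1r.
    + by case: eqVneq mpq => [->|]; rewrite ?ltnn ?mulr1 ?mul1r.
    + by rewrite (muI _ _ mpq) eqxx ?mulr1 ?mul1r.
exists (a * b * c); rewrite !layer_weightE ea eb.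
move: ec; move: (\prod_(t | _) _) (edge_weight P col lam) (edge_weight P col mu).
move: (root_weight P col mu) (same_weight P col mu * cross_weight P col mu).
move=> rm sm F el em ec; transitivity ((F * el) * a * rm * b * sm); first by ring.
by rewrite ec; ring.
Qed.

Lemma unit_ideal : exists2 r : R, GRing.lreg r &
  forall h, word_span (symmetrize (h * C r * layer_weight lam)).
Proof.
have := @ideal_dichotomy _ const_mulset _ form K K_ideal
  [seq t <- enum predT | in_layer t].
case=> [Z N pe|_ [r lr ->] Kr]; last by exists r.
have [[a b] /= /andP[ab ba]|nocycle] :=
    pickP [pred ab : V * V | before Z ab.1 ab.2 && connect (before Z) ab.2 ab.1].
  by left; exact: cycle_const ab ba.
right=> h; set mu := refinement Z.
have muI : injective mu by exact: refinement_inj.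
have mub a b : lam a = lam b -> before Z a b -> (mu a < mu b)%N.
  move=> e ab; apply: refinement_height => //; apply: height_before => //.
  by have := nocycle (a, b); rewrite /= ab /= => ->.
have [g eg] := divides_refined muI (@refinement_lam Z).
have uZN : uniq (Z ++ N) by rewrite (perm_uniq pe) filter_uniq // enum_uniq.
have [_ _ uN] := and3P (etrans (esym (cat_uniq Z N)) uZN).
have memZN t : (t \in Z) || (t \in N) = in_layer t.
  by rewrite -mem_cat (perm_mem pe) mem_filter mem_enum andbT.
(* Every form needed by mu occurs in N: if it were in Z, [before] would impose the opposite order on
   its variables. *)
have -> : \prod_(t <- N) form t =
   \prod_(t <- N | ~~ (in_layer t && (t.2 == (mu t.1.2 < mu t.1.1.2)%N))) form t *
   \prod_(t | in_layer t && (t.2 == (mu t.1.2 < mu t.1.1.2)%N)) form t.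
  rewrite (bigID (fun t => in_layer t && (t.2 == (mu t.1.2 < mu t.1.1.2)%N))) /= mulrC.
  congr (_ * _); rewrite -big_filter -[RHS]big_filter; apply: perm_big.
  apply: uniq_perm; rewrite ?filter_uniq ?index_enum_uniq // => -[[[e p] q] b].
  rewrite !mem_filter mem_index_enum andbT andb_idr // => /andP[inl /eqP /= eb].
  have : ((e, p, q, b) \in Z) || ((e, p, q, b) \in N) by rewrite memZN.
  case/orP => // tZ; have /and4P[_ _ _ /eqP lpq] := inl.
  case: b eb tZ {inl} => eb tZ.
    have : before Z p q by apply/existsP; exists e; rewrite tZ orbT.
    by move/(mub _ _ lpq); rewrite ltnNge ltnW.
  have : before Z q p by apply/existsP; exists e; rewrite tZ.
  by move/(mub _ _ (esym lpq)); rewrite -eb.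
set A := \prod_(t <- N | _) _; set B := \prod_(t | _) _ in eg *.
have -> : h * (A * B) * layer_weight lam = h * A * g * layer_weight mu.
  by transitivity (h * A * (B * layer_weight lam)); [ring | rewrite eg; ring].
exact: word_span_symmetrize.
Qed.

End UnitIdeal.

(** * Specialization at strings *)

Section Placements.
Variables (Q : quiver) (R : base_ring (edge Q)) (P : poly_functor R).
Variables (V W : finType) (col : V -> vertex Q) (colW : W -> vertex Q).
Notation I := (vertex Q).
Notation E := (edge Q).
Notation x := (pX P).
Implicit Types (A B : {ffun W -> nat}) (b : V -> W * nat) (lam : V -> nat).
Implicit Types (p q : V) (r s : W) (f g h : P V).

(* The variable in position c of the string r of length A r is specialized to
   w_r + c hbar. *)
Record placement A b : Prop := Placement {
  place_inj : injective b;
  place_col : forall p, colW (b p).1 = col p;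
  place_lt : forall p, ((b p).2 < A (b p).1)%N;
  place_surj : forall r c, (c < A r)%N -> exists p, b p = (r, c)
}.

Definition string_val r (c : nat) : P W := x r + pC P W (bhbar R *+ c).

Definition place_subst b : {rmorphism P V -> P W} :=
  pS P (fun p => string_val (b p).1 (b p).2).

Lemma place_substX b p : place_subst b (x p) = string_val (b p).1 (b p).2.
Proof. exact: pSX. Qed.

Lemma place_substC b a : place_subst b (pC P V a) = pC P W a.
Proof. exact: pSC. Qed.

Lemma place_subst_act b (t : {perm V}) f :
  place_subst b (perm_act P t f) = place_subst (b \o t) f.
Proof.
by rewrite /place_subst /perm_act pS_comp; apply: eq_pS => p; rewrite pSX.
Qed.

Lemma eq_place_subst b b' f : b =1 b' -> place_subst b f = place_subst b' f.
Proof. by move=> e; apply: eq_pS => p; rewrite e. Qed.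

(** Hence the vanishing of a color-symmetric polynomial at a placement depends on A alone. *)
Lemma placement_perm A b b' : placement A b -> placement A b' ->
  exists2 t : {perm V}, color_perm col t & b' =1 b \o t.
Proof.
move=> [bI bc blt bs] [bI' bc' blt' bs'].
have /fin_all_exists[t ht] : forall p, exists q, b q = b' p.
  by move=> p; have [q e] := bs _ _ (blt' p); exists q; rewrite e -surjective_pairing.
have tI : injective t by move=> p q e; apply: bI'; rewrite -!ht e.
exists (perm tI); last by move=> p; rewrite /= permE ht.
by apply/color_permP => p; rewrite permE -bc ht bc'.
Qed.

Lemma placement_act A b (t : {perm V}) : placement A b -> color_perm col t ->
  placement A (b \o t).
Proof.
move=> [bI bc blt bs] /color_permP ct; split=> [|p|p|r c cr] /=.
- by apply: inj_comp => //; exact: perm_inj.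
- by rewrite bc ct.
- exact: blt.
- by have [p e] := bs _ _ cr; exists (t^-1%g p); rewrite /= permKV.
Qed.

Lemma big_placement (M : Type) (e : M) (op : Monoid.com_law e) A b (F : W * nat -> M) :
  placement A b ->
  \big[op/e]_p F (b p) = \big[op/e]_r \big[op/e]_(c < A r) F (r, val c).
Proof.
move=> [bI bc blt bs].
pose l := [seq (r, c) | r <- enum W, c <- iota 0 (A r)].
have memE rc : (rc \in l) = (rc.2 < A rc.1)%N.
  apply/allpairsPdep/idP => [[r [c [_ + ->]]]|]; first by rewrite mem_iota add0n.
  by case: rc => r c cr; exists r, c; rewrite mem_enum mem_iota.
transitivity (\big[op/e]_(rc <- [seq b p | p <- enum V]) F rc).
  by rewrite big_map big_enum.
rewrite (perm_big l) /=.
  rewrite big_allpairs_dep big_enum; apply: eq_bigr => r _.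
  by rewrite -(big_mkord xpredT (fun c => F (r, c))) /index_iota subn0.
apply: uniq_perm; first by rewrite map_inj_uniq ?enum_uniq.
  apply: allpairs_uniq_dep; first exact: enum_uniq.
    by move=> r _; exact: iota_uniq.
  by move=> [r c] [r' c'] _ _ /= [-> ->].
move=> rc; rewrite memE; apply/mapP/idP => [[p _ ->]|]; first exact: blt.
by case: rc => r c /= /bs[p ep]; exists p; rewrite ?mem_enum // ep.
Qed.

Definition potential A := (\sum_r \sum_(c < A r) c)%N.

Lemma potentialE A b : placement A b -> potential A = (\sum_p (b p).2)%N.
Proof. by move=> pb; rewrite (big_placement _ (fun rc : W * nat => rc.2) pb). Qed.

Lemma card_placement A b i : placement A b ->
  #|[pred p | col p == i]| = (\sum_(r | colW r == i) A r)%N.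
Proof.
move=> pb; rewrite -sum1_card big_mkcond /=.
transitivity (\sum_p (if colW (b p).1 == i then 1 else 0))%N.
  by apply: eq_bigr => p _; rewrite inE (place_col pb).
rewrite (big_placement _ (fun rc : W * nat => if colW rc.1 == i then 1 else 0)%N pb).
rewrite [RHS]big_mkcond; apply: eq_bigr => r _ /=.
by rewrite sum_nat_const card_ord; case: ifP; rewrite ?muln1 ?muln0.
Qed.

(* The weight of a layering survives the specialization only if the layers
   increase along the strings. *)
Lemma chain_increasing A b lam : placement A b ->
  place_subst b (root_weight P col lam) <> 0 ->
  forall p q, (b p).1 = (b q).1 -> ((b p).2 < (b q).2)%N -> (lam p < lam q)%N.
Proof.
move=> pb nz.
(* If q directly follows p without lying in a larger layer, the root weight contains x_q - x_p -
   hbar, which vanishes at this placement. *)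
have step p q : (b p).1 = (b q).1 -> (b q).2 = (b p).2.+1 -> (lam p < lam q)%N.
  move=> e1 e2; rewrite ltnNge; apply/negP => le; apply: nz.
  rewrite /root_weight rmorph_prod (bigD1 q) //= rmorph_prod (bigD1 p) /=.
    rewrite !rmorphB !place_substX place_substC /string_val e1 e2.
    by rewrite mulrS rmorphD [_ - _ - _](_ : _ = 0) ?mul0r //; ring.
  apply/and3P; split=> //.
    by apply/eqP => e; move: e2; rewrite e => /eqP; rewrite eqn_leq ltnn andbF.
  by rewrite -!(place_col pb) e1.
move=> p q e lt; have [d ed] : exists d, (b q).2 = ((b p).2 + d).+1.
  by exists ((b q).2 - (b p).2).-1; move: lt; lia.
elim: d q e ed {lt} => [|d IH] q e ed; first by apply: step; rewrite ?ed ?addn0.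
have [|q' eq'] := @place_surj _ _ pb (b q).1 ((b p).2 + d).+1.
  by have := place_lt pb q; rewrite ed addnS; apply: ltn_trans.
apply: (ltn_trans (IH q' _ _)); rewrite ?eq' //; apply: step; rewrite eq' //=.
by rewrite ed addnS.
Qed.

Lemma chain_height A b lam : placement A b ->
  place_subst b (root_weight P col lam) <> 0 -> forall p, ((b p).2 <= lam p)%N.
Proof.
move=> pb nz p; have [c ec] : exists c, (b p).2 = c by exists (b p).2.
elim: c p ec => [|c IH] p ec; rewrite ec //.
have [|q eq] := @place_surj _ _ pb (b p).1 c.
  by have := place_lt pb p; rewrite ec; apply: ltn_trans.
apply: (leq_ltn_trans (n := lam q)); first by rewrite -{1}[c]/((b p).1, c).2 -eq IH ?eq.
by apply: (chain_increasing pb nz); rewrite eq ?ec //=.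
Qed.

(** The sum of the bounds [chain_height]; equal sums force equality for every variable. This makes
    the specializations of the weights triangular with respect to the potential. *)
Lemma potential_le A b lam : placement A b ->
  place_subst b (root_weight P col lam) <> 0 ->
  (potential A <= \sum_p lam p)%N /\
  (potential A = \sum_p lam p -> forall p, lam p = (b p).2)%N.
Proof.
move=> pb nz; have le := chain_height pb nz; rewrite (potentialE pb).
split=> [|e p]; first by apply: leq_sum => p _; exact: le.
apply/eqP; rewrite eq_sym eqn_leq le /= leqNgt; apply/negP => lt.
suff : (\sum_p (b p).2 < \sum_p lam p)%N by rewrite e ltnn.
rewrite (bigD1 p) //= [X in (_ < X)%N](bigD1 p) //= -addSn.
by apply: leq_add => //; apply: leq_sum => q _; exact: le.
Qed.

End Placements.

(** * Coprime linear forms *)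

Section Forms.
Variables (R : comNzRingType) (P : poly_functor R) (W : choiceType).
Notation x := (pX P).
Notation C := (pC P W).
Implicit Types (r s : W) (a : R).

Lemma lreg_form r s a : r != s -> GRing.lreg (x s - x r + C a).
Proof. by move=> rs; apply: lreg_var_sub; [rewrite eq_sym | exact: var_freeC]. Qed.

Lemma form_linear r s a : x s - x r + C a = x s - (x r - C a).
Proof. by rewrite opprB addrA addrAC. Qed.

Lemma form_free r s a : r != s -> var_free s (x r - C a).
Proof. by move=> rs; apply: var_freeB; [exact: var_freeX | exact: var_freeC]. Qed.

(** Eliminating x_s from the second form leaves a linear form, or a constant when both forms have
    the same two variables: [a' - a] for equal and [a' + a] for opposite orientation. *)
Lemma coprime_forms r s r' s' a a' : r != s -> r' != s' ->
  (s' = s -> r' = r -> GRing.lreg (a' - a)) ->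
  (s' = r -> r' = s -> GRing.lreg (a' + a)) ->
  coprime_to (x s - x r + C a) (x s' - x r' + C a').
Proof.
move=> rs rs' same opp; rewrite form_linear; apply: coprime_to_linear.
  exact: form_free.
rewrite rmorphD rmorphB !pSX pSC /subst1.
case: (eqVneq s' s) => [es|ns]; case: (eqVneq r' s) => [er|nr].
- by rewrite es er eqxx in rs'.
- have [er'|ner'] := eqVneq r' r.
    rewrite er' (_ : _ + _ = C (a' - a)); last by rewrite rmorphB; ring.
    by apply: lreg_pC; exact: same.
  by have := @lreg_form _ _ (a' - a) ner'; rewrite rmorphB; congr GRing.lreg; ring.
- have [es'|nes'] := eqVneq s' r.
    rewrite es' (_ : _ + _ = C (a' + a)); last by rewrite rmorphD; ring.
    by apply: lreg_pC; exact: opp.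
  rewrite eq_sym in nes'.
  by have := @lreg_form _ _ (a' + a) nes'; rewrite rmorphD; congr GRing.lreg; ring.
- exact: lreg_form.
Qed.

Lemma coprime_form_const r s a a' : r != s -> GRing.lreg a' ->
  coprime_to (x s - x r + C a) (C a').
Proof.
move=> rs la; rewrite form_linear; apply: coprime_to_linear; first exact: form_free.
by rewrite pSC; exact: lreg_pC.
Qed.

End Forms.

(** * Division of symmetrizations by the discriminant *)

Section Discriminant.
Variables (Q : quiver) (R : base_ring (edge Q)) (P : poly_functor R).
Variables (V : finType) (col : V -> vertex Q).
Notation x := (pX P).
Notation C := (pC P V).
Implicit Types (lam : V -> nat) (p q : V) (f g h : P V).

Definition discriminant : P V :=
  \prod_p \prod_(q | (p != q) && (col p == col q)) (x p - x q).

Lemma lreg_diff p q : p != q -> GRing.lreg (x p - x q : P V).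
Proof.
move=> pq; have := @lreg_form _ P V q p 0; rewrite rmorph0 addr0.
by apply; rewrite eq_sym.
Qed.

Lemma lreg_discriminant : GRing.lreg discriminant.
Proof.
by apply: lreg_prod => p _; apply: lreg_prod => q /andP[pq _]; exact: lreg_diff.
Qed.

Lemma discriminant_sym : color_symmetric col discriminant.
Proof.
move=> s /color_permP cs; rewrite /discriminant rmorph_prod.
rewrite [RHS](reindex_inj (@perm_inj _ s)); apply: eq_bigr => p _ /=.
rewrite rmorph_prod [RHS](reindex_inj (@perm_inj _ s)); apply: eq_big => q /=.
  by rewrite (inj_eq perm_inj) !cs.
by rewrite rmorphB !perm_actX.
Qed.

Lemma divides_opp (A : comNzRingType) (d f : A) : divides d f -> divides (- d) f.
Proof. by move=> [q ->]; exists (- q); ring. Qed.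

Lemma diff_divides_layer_weight lam p q : p != q -> col p = col q ->
  divides (x p - x q) (layer_weight P col lam).
Proof.
move=> pq cpq; rewrite layer_weightE; apply: dividesMl.
have big_div (F : V -> V -> P V) (D : V -> V -> bool) a b : D a b ->
    divides (F a b) (\prod_p \prod_(q | D p q) F p q).
  move=> Dab; rewrite (bigD1 a) //= (bigD1 b) //=.
  by do 2!apply: dividesW; exact: divides_refl.
have [lpq|lqp|e] := ltngtP (lam p) (lam q).
- apply: dividesMl; rewrite -opprB; apply: divides_opp.
  by apply: (big_div (fun p q => x q - x p)); rewrite cpq eqxx.
- apply: dividesMl.
  by apply: (big_div (fun p q => x q - x p)); rewrite cpq eqxx.
- apply: dividesW; apply: (big_div (fun p q => x p - x q)).
  by rewrite pq cpq e !eqxx.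
Qed.

Lemma diff_divides_symmetrize h lam p q : p != q -> col p = col q ->
  divides (x p - x q) (symmetrize col (h * layer_weight P col lam)).
Proof.
move=> pq cpq; apply: divides_sum => s cs; rewrite rmorphM; apply: dividesMl.
have [||g ->] := @diff_divides_layer_weight lam (s^-1 p)%g (s^-1 q)%g.
- by rewrite (inj_eq (@perm_inj _ _)).
- have /color_permP cs' := cs.
  by rewrite -[X in X = _]cs' -[X in _ = X]cs' !permKV.
by exists (perm_act P s g); rewrite rmorphM rmorphB !perm_actX !permKV.
Qed.

(** Each term is divisible by x_p - x_q. Since the sum is invariant, the quotient changes sign under
    the transposition of p and q; as 2 is regular it vanishes at x_p = x_q, and a second factor
    splits off. *)
Lemma sqr_diff_divides_symmetrize h lam p q : p != q -> col p = col q ->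
  divides ((x p - x q) * (x q - x p)) (symmetrize col (h * layer_weight P col lam)).
Proof.
move=> pq cpq; have [g eg] := diff_divides_symmetrize h lam pq cpq.
have ct : color_perm col (tperm p q).
  by apply/color_permP => r; case: tpermP => // ->.
have := symmetrize_sym (h * layer_weight P col lam) ct; rewrite eg.
rewrite rmorphM rmorphB !perm_actX tpermL tpermR => e.
have {e} tg : perm_act P (tperm p q) g = - g.
  apply: (lreg_diff pq); rewrite [RHS](_ : _ = - (g * (x p - x q))); last by ring.
  by rewrite -e; ring.
have [g' ->] : divides (x p - x q) g.
  have fq : var_free p (x q : P V) by apply: var_freeX; rewrite eq_sym.
  apply/(divides_linear _ fq).
  have e : pS P (subst1 p (x q)) (perm_act P (tperm p q) g) = pS P (subst1 p (x q)) g.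
    rewrite pS_comp; apply: eq_pS => r; rewrite pSX /subst1.
    case: tpermP => [->|->|/eqP/negbTE rp _].
    - by rewrite eq_sym (negbTE pq) eqxx.
    - by rewrite eqxx eq_sym (negbTE pq).
    - by rewrite rp.
  have : GRing.lreg (2%:R : P V) by rewrite -(rmorph_nat C); apply/lreg_pC/lreg_bnat.
  move=> /lreg0; apply; rewrite mulr_natl mulr2n -{1}e tg rmorphN addNr //.
by exists (- g'); ring.
Qed.

Lemma discriminantE : discriminant =
  \prod_(pq <- [seq pq <- enum predT | (col pq.1 == col pq.2)
                                  && (enum_rank pq.1 < enum_rank pq.2)%N])
     ((x pq.1 - x pq.2) * (x pq.2 - x pq.1)).
Proof.
rewrite big_filter big_enum_cond /=.
rewrite big_split -(pair_big_dep predT (fun p q => (col p == col q)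
  && (enum_rank p < enum_rank q)%N) (fun p q => x p - x q)) /=.
rewrite -(pair_big_dep predT (fun p q => (col p == col q)
  && (enum_rank p < enum_rank q)%N) (fun p q => x q - x p)) /=.
rewrite [X in _ = _ * X](exchange_big_dep predT) //= -big_split.
apply: eq_bigr => p _ /=; rewrite (bigID (fun q => enum_rank p < enum_rank q)%N) /=.
congr (_ * _); apply: eq_bigl => q.
  by case: eqVneq => [->|_] //=; rewrite ltnn andbF.
rewrite [col p == _]eq_sym -leqNgt leq_eqVlt -[(_ == _ :> nat)]/(enum_rank q == enum_rank p).
rewrite (inj_eq enum_rank_inj) [q == p]eq_sym.
by case: eqVneq => [->|_] //=; rewrite ltnn andbF.
Qed.

Lemma discriminant_divides h lam :
  divides discriminant (symmetrize col (h * layer_weight P col lam)).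
Proof.
rewrite discriminantE; apply: divides_prod.
- by rewrite filter_uniq ?enum_uniq.
- move=> [p q]; rewrite mem_filter /= => /andP[/andP[/eqP cpq rk] _].
  apply: sqr_diff_divides_symmetrize => //.
  by apply: contraTneq rk => ->; rewrite ltnn.
move=> [p q] [p' q']; rewrite !mem_filter /= => /andP[/andP[_ r1] _] /andP[/andP[_ r2] _] ne.
have pq : p != q by apply: contraTneq r1 => ->; rewrite ltnn.
have pq' : p' != q' by apply: contraTneq r2 => ->; rewrite ltnn.
have cop a b a' b' : (a = p /\ b = q) \/ (a = q /\ b = p) ->
    (a' = p' /\ b' = q') \/ (a' = q' /\ b' = p') -> coprime_to (x a - x b : P V) (x a' - x b').
  move=> H H'; have := @coprime_forms _ P V b a b' a' 0 0; rewrite rmorph0 !addr0; apply.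
  - by case: H => -[-> ->] //; rewrite eq_sym.
  - by case: H' => -[-> ->] //; rewrite eq_sym.
  - case: H => -[-> ->]; case: H' => -[-> ->] e1 e2; subst;
    by [rewrite eqxx in ne | have := ltn_trans r1 r2; rewrite ltnn].
  - case: H => -[-> ->]; case: H' => -[-> ->] e1 e2; subst;
    by [rewrite eqxx in ne | have := ltn_trans r1 r2; rewrite ltnn].
apply: coprime_toMl; first exact: lreg_diff.
  by apply: coprime_toMr; apply: cop; tauto.
by apply: coprime_toMr; apply: cop; tauto.
Qed.

(** The discriminant only clears the poles of zeta; g is the element of the big shuffle algebra. *)
Lemma layer_quotient h lam : exists2 g, color_symmetric col g &
  symmetrize col (h * layer_weight P col lam) = discriminant * g.
Proof.
have [g e] := discriminant_divides h lam; exists g; last by rewrite e mulrC.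
move=> s cs; apply: lreg_discriminant; rewrite -{1}(discriminant_sym cs) -rmorphM.
by rewrite [_ * g]mulrC -e symmetrize_sym.
Qed.

End Discriminant.

Lemma divides_reindex (B : comNzRingType) (T T' : finType) (D : pred T) (F : T -> B)
    (G : T' -> B) (f : T -> T') :
  {in D &, injective f} -> (forall i, D i -> F i = G (f i)) ->
  divides (\prod_(i | D i) F i) (\prod_j G j).
Proof.
move=> fI FG; exists (\prod_(j | j \notin [set f i | i in D]) G j).
rewrite (bigID (mem [set f i | i in D])) /= mulrC; congr (_ * _).
by rewrite big_imset //=; apply: eq_bigr => i /FG.
Qed.

Lemma divides_trans (B : comNzRingType) (d e f : B) :
  divides d e -> divides e f -> divides d f.
Proof. by move=> [q ->] [p ->]; exists (p * q); ring. Qed.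

(** * Wheel conditions in terms of placements *)

Section Wheels.
Variables (Q : quiver) (R : base_ring (edge Q)) (P : poly_functor R).
Variables (V W : finType) (col : V -> vertex Q) (colW : W -> vertex Q).
Notation I := (vertex Q).
Notation E := (edge Q).
Notation x := (pX P).
Notation C := (pC P W).
Notation hh := (bhh R).
Notation th := (bth R).
Notation sv := (string_val P).
Notation placement := (placement col colW).
Implicit Types (A B : {ffun W -> nat}) (b : V -> W * nat) (lam : V -> nat).
Implicit Types (p q : V) (r s : W) (f g h : P V).

Lemma bhbarE (c : nat) : bhbar R *+ c = hh *~ (c%:Z * 2).
Proof. by rewrite /bhbar -mulrnA mulnC pmulrn PoszM. Qed.

Lemma string_diff r s c d :
  sv s d - sv r c = x s - x r + C (hh *~ ((d%:Z - c%:Z) * 2)).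
Proof. by rewrite /string_val !bhbarE mulrBl mulrzBr rmorphB; ring. Qed.

Lemma string_form_minus (e : E) r s c d :
  sv s d - sv r c + C (th e - hh) = x s - x r + C (th e + hh *~ ((d%:Z - c%:Z) * 2 - 1)).
Proof. by rewrite string_diff mulrzBr mulr1z !rmorphD rmorphN; ring. Qed.

Lemma string_form_plus (e : E) r s c d :
  sv s d - sv r c + C (th e + hh) = x s - x r + C (th e + hh *~ ((d%:Z - c%:Z) * 2 + 1)).
Proof. by rewrite string_diff mulrzDr mulr1z !rmorphD; ring. Qed.

Lemma string_valS r c : sv r c.+1 = sv r c + C (bhbar R).
Proof. by rewrite /string_val mulrSr rmorphD addrA. Qed.

(** The edge factor for the layering by position, where two cells in equal positions share a layer
    and contribute 1. *)
Definition wheel_factor e r s (c d : nat) : P W :=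
  if (c < d)%N then sv s d - sv r c + C (th e - hh)
  else if (d < c)%N then sv s d - sv r c + C (th e + hh) else 1.

Definition wheel_divisor A e r s : P W :=
  \prod_(cd : 'I_(A r) * 'I_(A s)) wheel_factor e r s cd.1 cd.2.

Lemma wheel_factor_form e r s c d : c != d ->
  exists n : int, wheel_factor e r s c d = x s - x r + C (th e + hh *~ n).
Proof.
rewrite /wheel_factor; case: ltngtP => // _ _.
  by rewrite string_form_minus; eexists.
by rewrite string_form_plus; eexists.
Qed.

Lemma wheel_factor_eq e r s c : wheel_factor e r s c c = 1.
Proof. by rewrite /wheel_factor ltnn. Qed.

(** The refined wheel conditions for two different strings; [wheel_divisor_down] and
    [wheel_divisor_up] below identify the divisor with the products in their definition. *)
Definition wheel_condition f := forall A b, placement A b ->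
  forall e r s, r != s -> colW r = src e -> colW s = tgt e ->
  divides (wheel_divisor A e r s) (place_subst P b f).

(* A pair of positions (c, d) with c < d whose edge factor has the wrong sign is
   matched with (c, d - 1), whose factor has the same value; similarly for d < c. *)
Lemma wheel_divides_layer_weight A b lam e r s : placement A b ->
  colW r = src e -> colW s = tgt e ->
  divides (wheel_divisor A e r s) (place_subst P b (layer_weight P col lam)).
Proof.
move=> pb cr cs; rewrite layer_weightE !rmorphM.
have [->|/eqP nz] := eqVneq (place_subst P b (root_weight P col lam)) 0.
  by rewrite !mul0r; exact: divides0.
apply/dividesW/dividesMl.
have inc := chain_increasing pb nz.
have /fin_all_exists[fr hr] : forall c : 'I_(A r), exists p, b p = (r, val c).
  by move=> c; apply: (place_surj pb); exact: ltn_ord.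
have /fin_all_exists[fs hs] : forall d : 'I_(A s), exists p, b p = (s, val d).
  by move=> d; apply: (place_surj pb); exact: ltn_ord.
have incr (c c' : 'I_(A r)) : (c < c')%N -> (lam (fr c) < lam (fr c'))%N.
  by move=> cc; apply: inc; rewrite !hr.
have incs (d d' : 'I_(A s)) : (d < d')%N -> (lam (fs d) < lam (fs d'))%N.
  by move=> dd; apply: inc; rewrite !hs.
pose prc (c : 'I_(A r)) : 'I_(A r) := Ordinal (leq_ltn_trans (leq_pred c) (ltn_ord c)).
pose prd (d : 'I_(A s)) : 'I_(A s) := Ordinal (leq_ltn_trans (leq_pred d) (ltn_ord d)).
pose F (pq : V * V) : P W :=
  if (lam pq.1 < lam pq.2)%N
  then sv (b pq.2).1 (b pq.2).2 - sv (b pq.1).1 (b pq.1).2 + C (th e - hh)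
  else if (lam pq.2 < lam pq.1)%N
  then sv (b pq.2).1 (b pq.2).2 - sv (b pq.1).1 (b pq.1).2 + C (th e + hh) else 1.
have edgeE : divides (\prod_(pq : V * V)
      if (col pq.1 == src e) && (col pq.2 == tgt e) then F pq else 1)
    (place_subst P b (edge_weight P col lam)).
  rewrite /edge_weight rmorph_prod (bigD1 e) //= -big_mkcond /=.
  apply: dividesW; rewrite rmorph_prod; under [X in divides _ X]eq_bigr do rewrite rmorph_prod.
  rewrite pair_big_dep /=; exists 1; rewrite mul1r; apply: eq_bigr => -[p q] _ /=.
  rewrite /F /=.
  by case: ifP => _; [|case: ifP => _]; rewrite ?rmorph1 // rmorphD rmorphB !place_substX place_substC.
apply: divides_trans edgeE.
pose ok (cd : 'I_(A r) * 'I_(A s)) :=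
  if (cd.1 < cd.2)%N then (lam (fr cd.1) < lam (fs cd.2))%N
  else (lam (fs cd.2) < lam (fr cd.1))%N.
pose phi (cd : 'I_(A r) * 'I_(A s)) :=
  if ok cd then cd else if (cd.1 < cd.2)%N then (cd.1, prd cd.2) else (prc cd.1, cd.2).
have -> : wheel_divisor A e r s =
    \prod_(cd : 'I_(A r) * 'I_(A s) | val cd.1 != val cd.2) wheel_factor e r s cd.1 cd.2.
  rewrite /wheel_divisor (bigID (fun cd : 'I_(A r) * 'I_(A s) => val cd.1 != val cd.2)) /=.
  by rewrite [X in _ * X]big1 ?mulr1 // => cd; rewrite negbK => /eqP ->; exact: wheel_factor_eq.
have notok1 (c : 'I_(A r)) (d : 'I_(A s)) : (c < d)%N -> ok (c, d) = false ->
    (lam (fs (prd d)) < lam (fr c))%N.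
  rewrite /ok /= => lt; rewrite lt => /negbT; rewrite -leqNgt; apply: leq_trans.
  by apply: incs; rewrite /= ltn_predL; lia.
have notok2 (c : 'I_(A r)) (d : 'I_(A s)) : (d < c)%N -> ok (c, d) = false ->
    (lam (fr (prc c)) < lam (fs d))%N.
  rewrite /ok /= => lt; rewrite ltnNge ltnW //= => /negbT; rewrite -leqNgt => le.
  by apply: leq_trans le; apply: incr; rewrite /= ltn_predL; lia.
(* A left inverse of [phi] on the pairs of different positions: a pair was moved exactly when the
   order of its layers is not the strict order of its positions. *)
pose psi (cd : 'I_(A r) * 'I_(A s)) : nat * nat :=
  if (lam (fr cd.1) < lam (fs cd.2))%N
  then if (cd.1 < cd.2)%N then (val cd.1, val cd.2) else (cd.1.+1, val cd.2)
  else if (cd.1 <= cd.2)%N then (val cd.1, cd.2.+1) else (val cd.1, val cd.2).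
have phiK (c : 'I_(A r)) (d : 'I_(A s)) : val c != val d ->
    psi (phi (c, d)) = (val c, val d).
  rewrite /phi; case: ifP => okcd; case: ltngtP => //= lt _; rewrite /psi /=.
  - by move: okcd; rewrite /ok /= lt => ->.
  - move: okcd; rewrite /ok /= ltnNge ltnW //= => okcd.
    by rewrite ltnNge ltnW //= leqNgt lt.
  - rewrite ltnNge ltnW ?notok1 //=.
    have -> : (c <= d.-1)%N by lia.
    by rewrite prednK //; lia.
  - rewrite notok2 //; have -> : (c.-1 < d)%N = false by lia.
    by rewrite prednK //; lia.
apply: (@divides_reindex _ _ _ _ _ _ (fun cd => (fr (phi cd).1, fs (phi cd).2))).
  have frI : injective fr.
    by move=> c c' e'; apply: val_inj; have := hr c; rewrite e' hr => -[].
  have fsI : injective fs.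
    by move=> d d' e'; apply: val_inj; have := hs d; rewrite e' hs => -[].
  move=> [c d] [c' d'] ne ne' /= [/frI e1 /fsI e2].
  have {e1 e2} : phi (c, d) = phi (c', d').
    by rewrite [LHS]surjective_pairing e1 e2 -surjective_pairing.
  by move/(congr1 psi); rewrite (phiK _ _ ne) (phiK _ _ ne') => -[/val_inj -> /val_inj ->].
move=> [c d] /= ne; rewrite -!(place_col pb) !hr !hs /= cr cs !eqxx /= /F /= !hr !hs /=.
rewrite /phi /wheel_factor /=; case okcd: (ok (c, d)); case: (ltngtP c d) ne => //= lt _.
- by move: okcd; rewrite /ok /= lt => ->.
- move: okcd; rewrite /ok /= ltnNge ltnW //= => okcd.
  by rewrite okcd ltnNge ltnW.
- have nO := notok1 _ _ lt okcd; rewrite nO ltnNge ltnW //=.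
  have -> : val d = d.-1.+1 by rewrite prednK //; lia.
  by rewrite /= string_valS /bhbar mulr2n !rmorphD ?rmorphN; ring.
- rewrite (notok2 _ _ lt okcd); have -> : val c = c.-1.+1 by rewrite prednK //; lia.
  by rewrite /= string_valS /bhbar mulr2n !rmorphD ?rmorphN; ring.
Qed.

End Wheels.

Section Divisors.
Variables (Q : quiver) (R : base_ring (edge Q)) (P : poly_functor R).
Variables (V W : finType) (col : V -> vertex Q) (colW : W -> vertex Q).
Notation I := (vertex Q).
Notation E := (edge Q).
Notation x := (pX P).
Notation C := (pC P W).
Notation hh := (bhh R).
Notation th := (bth R).
Notation sv := (string_val P).
Notation placement := (placement col colW).
Implicit Types (A B : {ffun W -> nat}) (b : V -> W * nat) (lam : V -> nat).
Implicit Types (p q : V) (r s : W) (f g h : P V).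

Lemma lreg_th_sub e (m n : int) : GRing.lreg (th e + hh *~ m - hh *~ n).
Proof. by rewrite -addrA -mulrzBr; exact: lreg_bth. Qed.

Lemma lreg_th_add e (m n : int) : GRing.lreg (th e + hh *~ m + hh *~ n).
Proof. by rewrite -addrA -mulrzDr; exact: lreg_bth. Qed.

Lemma lreg_wheel_factor e r s c d : r != s -> GRing.lreg (wheel_factor P e r s c d).
Proof.
move=> rs; have [->|/(wheel_factor_form P e r s)[n ->]] := eqVneq c d.
  by rewrite wheel_factor_eq; exact: lreg1.
exact: lreg_form.
Qed.

Lemma lreg_wheel_divisor A e r s : r != s -> GRing.lreg (wheel_divisor P A e r s).
Proof. by move=> rs; apply: lreg_prod => cd _; exact: lreg_wheel_factor. Qed.

Lemma coprime_wheel_divisor A e r s (g : P W) : r != s ->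
  (forall n : int, coprime_to (x s - x r + C (th e + hh *~ n)) g) ->
  coprime_to (wheel_divisor P A e r s) g.
Proof.
move=> rs H; apply: coprime_to_prodl => -[c d] _ /=; split.
  exact: lreg_wheel_factor.
have [->|/(wheel_factor_form P e r s)[n ->]] := eqVneq (c : nat) d; last exact: H.
by rewrite wheel_factor_eq; exact: coprime_to1l.
Qed.

Lemma lreg_string_diff r s c d : (r, c) != (s, d) -> GRing.lreg (sv s d - sv r c).
Proof.
move=> ne; rewrite string_diff; have [e|rs] := eqVneq r s; last exact: lreg_form.
rewrite e subrr add0r; apply/lreg_pC/lreg_bhbar.
by move: ne; rewrite e xpair_eqE eqxx /=; lia.
Qed.

Lemma place_subst_discriminant A b : placement A b ->
  GRing.lreg (place_subst P b (discriminant P col)).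
Proof.
move=> pb; rewrite rmorph_prod; apply: lreg_prod => p _; rewrite rmorph_prod.
apply: lreg_prod => q /andP[pq _]; rewrite rmorphB !place_substX.
by apply: lreg_string_diff; rewrite -!surjective_pairing (inj_eq (place_inj pb)) eq_sym.
Qed.

(** The constants in the wheel factors involve theta_e and those in the differences of cells do not,
    so their sums and differences are regular. *)
Lemma coprime_wheel_discriminant A b e r s : placement A b -> r != s ->
  coprime_to (wheel_divisor P A e r s) (place_subst P b (discriminant P col)).
Proof.
move=> pb rs; apply: coprime_wheel_divisor => // n.
rewrite rmorph_prod; apply: coprime_to_prodr => p _; rewrite rmorph_prod.
apply: coprime_to_prodr => q /andP[pq _]; rewrite rmorphB !place_substX.
have ne : b q != b p by rewrite (inj_eq (place_inj pb)) eq_sym.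
rewrite string_diff; have [e1|rs'] := eqVneq (b q).1 (b p).1.
  rewrite e1 subrr add0r; apply: coprime_form_const => //; apply: lreg_bhbar.
  move: ne; rewrite [b q]surjective_pairing [b p]surjective_pairing e1 xpair_eqE eqxx /=.
  lia.
apply: coprime_forms => // _ _; last by rewrite addrC; exact: lreg_th_add.
by rewrite -opprB; apply: lregN; exact: lreg_th_sub.
Qed.

(** Each term of the symmetrization is divisible by the wheel divisor, and coprimality carries this
    through the division by the discriminant. *)
Lemma quotient_wheel_condition h lam g :
  symmetrize col (h * layer_weight P col lam) = discriminant P col * g ->
  wheel_condition col colW g.
Proof.
move=> e A b pb ed r s rs cr cs.
apply: (@coprime_wheel_discriminant A b ed r s pb rs); rewrite -rmorphM -e.
rewrite rmorph_sum; apply: divides_sum => t ct.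
rewrite place_subst_act rmorphM; apply: dividesMl.
have pbt := placement_act pb ct; exact: (wheel_divides_layer_weight P lam pbt cr cs).
Qed.

Definition bad_factor A r s (c : nat) : P W := x r - x s - C (bhbar R *+ (A s - c)).

Definition bad_divisor A r s : P W :=
  \prod_(c < minn (A r) (A s)) bad_factor A r s c.

Lemma bad_factorE A r s c :
  bad_factor A r s c = x r - x s + C (hh *~ (- ((A s - c)%N%:Z * 2))).
Proof. by rewrite /bad_factor bhbarE mulrNz rmorphN. Qed.

(* Where x_r = x_s + (A s - c) hbar, the strings r and s can be cut into a string
   of length A s + A r - c and one of length c. *)
Lemma bad_factor_divides A b f r s c : placement A b ->
  (forall B b', placement B b' -> (potential A < potential B)%N ->
     place_subst P b' f = 0) ->
  r != s -> colW r = colW s -> (c < A r)%N -> (c < A s)%N ->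
  divides (bad_factor A r s c) (place_subst P b f).
Proof.
move=> pb vf rs crs cr cs.
pose B : {ffun W -> nat} := [ffun t => if t == s then (A s + A r - c)%N
                              else if t == r then c else A t].
pose b' p := if ((b p).1 == r) && (c <= (b p).2)%N then (s, (A s - c + (b p).2)%N) else b p.
have pb' : placement B b'.
  split.
  - move=> p q; rewrite /b'; case: ifP => [/andP[/eqP rp cp]|np];
      case: ifP => [/andP[/eqP rq cq]|nq].
    + move=> [/eqP]; rewrite eqn_add2l => /eqP e; apply: (place_inj pb).
      by rewrite [b p]surjective_pairing [b q]surjective_pairing rp rq e.
    + move=> e; have := place_lt pb q; rewrite -e /=; lia.
    + move=> e; have := place_lt pb p; rewrite e /=; lia.
    + exact: (place_inj pb).
  - move=> p; rewrite /b'; case: ifP => [/andP[/eqP rp _]|_]; last exact: (place_col pb).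
    by rewrite /= -crs -rp; exact: (place_col pb).
  - move=> p; rewrite /b' /B ffunE; have := place_lt pb p.
    case: ifP => [/andP[/eqP -> cp]|np] /=; first by rewrite eqxx; lia.
    case: eqVneq => [->|_]; first by lia.
    by case: eqVneq np => [->|_] //=; lia.
  - move=> t d; rewrite /B ffunE; case: eqVneq => [->|ts].
      have [lt|le] := ltnP d (A s) => dB.
        have [p ep] := place_surj pb lt; exists p; rewrite /b' ep /=.
        by rewrite eq_sym (negbTE rs).
      have [p ep] := @place_surj _ _ _ _ _ _ _ pb r (d - (A s - c))%N ltac:(lia).
      exists p; rewrite /b' ep /= eqxx /=; case: ifP; last by lia.
      by move=> _; congr (_, _); lia.
    case: eqVneq => [->|tr] dB.
      have [p ep] := @place_surj _ _ _ _ _ _ _ pb r d ltac:(lia).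
      by exists p; rewrite /b' ep /= eqxx /= leqNgt dB.
    by have [p ep] := place_surj pb dB; exists p; rewrite /b' ep /= (negbTE tr).
(* The cells of r from position c on move up by A s - c > 0, and c < A r provides at least one such
   cell. *)
have potB : (potential A < potential B)%N.
  rewrite (potentialE pb) (potentialE pb').
  have le p : ((b p).2 <= (b' p).2)%N by rewrite /b'; case: ifP => //= _; lia.
  have [p ep] := place_surj pb cr.
  rewrite (bigD1 p) //= [X in (_ < X)%N](bigD1 p) //= -addSn.
  apply: leq_add; last by apply: leq_sum => q _; exact: le.
  by rewrite /b' ep /= eqxx leqnn /=; lia.
have fr : var_free r (x s + C (bhbar R *+ (A s - c)) : P W).
  by apply: var_freeD; [apply: var_freeX; rewrite eq_sym | exact: var_freeC].
rewrite /bad_factor -addrA -opprD; apply/(divides_linear _ fr).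
suff -> : pS P (subst1 r (x s + C (bhbar R *+ (A s - c)))) (place_subst P b f) =
          pS P (subst1 r (x s + C (bhbar R *+ (A s - c)))) (place_subst P b' f).
  by rewrite (vf _ _ pb' potB) rmorph0.
rewrite /place_subst !pS_comp; apply: eq_pS => p.
rewrite /b'; case: ifP => [/andP[/eqP -> cp]|//] /=.
rewrite /string_val !rmorphD !pSX !pSC /subst1 eqxx eq_sym (negbTE rs).
by rewrite mulrnDr rmorphD addrA.
Qed.

End Divisors.

Lemma divides_prod_cond (B : comNzRingType) (T : finType) (D : pred T) (F : T -> B) f :
  (forall i, D i -> divides (F i) f) ->
  (forall i j, D i -> D j -> i != j -> coprime_to (F i) (F j)) ->
  divides (\prod_(i | D i) F i) f.
Proof.
move=> Fd Fc; rewrite -big_filter; apply: divides_prod.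
- by rewrite filter_uniq ?index_enum_uniq.
- by move=> i; rewrite mem_filter => /andP[/Fd].
- by move=> i j; rewrite !mem_filter => /andP[Di _] /andP[Dj _]; exact: Fc.
Qed.

(** * The leading coefficient at a type of strings *)

Section LeadingTerm.
Variables (Q : quiver) (R : base_ring (edge Q)) (P : poly_functor R).
Variables (V W : finType) (col : V -> vertex Q) (colW : W -> vertex Q).
Notation I := (vertex Q).
Notation E := (edge Q).
Notation x := (pX P).
Notation C := (pC P W).
Notation hh := (bhh R).
Notation th := (bth R).
Notation sv := (string_val P).
Notation placement := (placement col colW).
Variables (A : {ffun W -> nat}) (b : V -> W * nat).
Hypothesis pb : placement A b.
Notation psi := (place_subst P b).
Implicit Types (p q : V) (r s : W) (f g h : P V).

Definition position p := (b p).2.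

Definition opposite_cross_weight (lam : V -> nat) : P V :=
  \prod_p \prod_(q | (col p == col q) && (lam p < lam q)%N) (x p - x q).

Lemma discriminant_split (lam : V -> nat) : discriminant P col =
  same_weight P col lam * cross_weight P col lam * opposite_cross_weight lam.
Proof.
rewrite mulrAC /cross_weight [X in _ * X](exchange_big_dep predT) //= -!big_split.
apply: eq_bigr => p _ /=.
rewrite (bigID (fun q => lam p == lam q)) /= -mulrA; congr (_ * _).
  by apply: eq_bigl => q; rewrite -andbA.
rewrite (bigID (fun q => lam p < lam q)%N) /=; congr (_ * _); apply: eq_bigl => q.
  case: (ltngtP (lam p) (lam q)) => h; rewrite ?andbF ?andbT //.
  by case: eqVneq h => [->|_]; rewrite ?ltnn.
rewrite [col q == _]eq_sym.
case: (ltngtP (lam p) (lam q)) => h; rewrite ?andbF ?andbT //.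
by case: eqVneq h => [->|_]; rewrite ?ltnn.
Qed.

Lemma big_placement2 (F : W * nat -> W * nat -> P W) :
  \prod_p \prod_q F (b p) (b q) =
  \prod_r \prod_s \prod_(c < A r) \prod_(d < A s) F (r, val c) (s, val d).
Proof.
transitivity (\prod_p \prod_s \prod_(d < A s) F (b p) (s, val d)).
  by apply: eq_bigr => p _; rewrite (big_placement _ (F (b p)) pb).
rewrite (big_placement _ (fun rc => \prod_s \prod_(d < A s) F rc (s, val d)) pb).
by apply: eq_bigr => r _; rewrite exchange_big.
Qed.

Definition root_block r s : P W :=
  \prod_(c < A r) \prod_(d < A s | ((r, val c) != (s, val d)) && (c <= d)%N)
    (sv r c - sv s d - C (bhbar R)).

Definition cross_block r s : P W :=
  \prod_(c < A r) \prod_(d < A s | (c < d)%N) (sv r c - sv s d).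

Lemma shift_prod (F : nat -> P W) n c :
  \prod_(d < n | (c <= d)%N) F d.+1 =
  \prod_(d < n | (c < d)%N) F d * (if (c < n)%N then F n else 1).
Proof.
rewrite big_mkcond [X in _ = X * _]big_mkcond /=.
elim: n => [|n IH]; first by rewrite !big_ord0 mulr1.
by rewrite !big_ord_recr /= IH ltnS.
Qed.

(** The root factor at positions (c, d) is the difference at (c, d + 1). Compared with the
    differences themselves, only d + 1 = A s is left over, and this is the bad factor at c. *)
Lemma root_blockE r s : r != s ->
  root_block r s = cross_block r s * bad_divisor P A r s.
Proof.
move=> rs; rewrite /bad_divisor (big_ord_widen _ (bad_factor P A r s) (geq_minl (A r) (A s))).
rewrite [X in _ = _ * X]big_mkcond -big_split; apply: eq_bigr => c _ /=.
rewrite leq_min ltn_ord /=.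
transitivity (\prod_(d < A s | (c <= d)%N) (sv r c - sv s d.+1)).
  apply: eq_big => d; first by rewrite xpair_eqE (negbTE rs).
  by move=> _; rewrite string_valS; ring.
have := shift_prod (fun d => sv r c - sv s d) (A s) c; rewrite /= => ->.
congr (_ * _); case: ifP => // cs.
rewrite /bad_factor /string_val mulrnBr ?rmorphB; last exact: ltnW.
ring.
Qed.

(** Up to scalars this is P_lam over the discriminant at the strings ([leading_term]), and it
    divides the value of every F to be reduced ([obstruction_divides]). *)
Definition obstruction : P W :=
  \prod_(t : E * W * W | [&& t.1.2 != t.2, colW t.1.2 == src t.1.1
                          & colW t.2 == tgt t.1.1]) wheel_divisor P A t.1.1 t.1.2 t.2
  * \prod_(rs : W * W | (rs.1 != rs.2) && (colW rs.1 == colW rs.2))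
      bad_divisor P A rs.1 rs.2.

Notation is_const := (const_mulset P W).

Let is_const_prod (T : Type) (l : seq T) (D : pred T) (F : T -> P W) :
  (forall i, D i -> is_const (F i)) -> is_const (\prod_(i <- l | D i) F i).
Proof. by move=> H; apply: big_ind => //; [exact: cms1 | exact: cmsM]. Qed.

Let is_const_hh (n : int) : n != 0 -> is_const (C (hh *~ n)).
Proof. by exists (hh *~ n) => //; exact: lreg_bhbar. Qed.

Lemma place_root_weight : psi (root_weight P col position) =
  \prod_r \prod_(s | colW r == colW s) root_block r s.
Proof.
rewrite /root_weight rmorph_prod.
pose F (rc sd : W * nat) := if [&& rc != sd, colW rc.1 == colW sd.1 & (rc.2 <= sd.2)%N]
  then sv rc.1 rc.2 - sv sd.1 sd.2 - C (bhbar R) else 1.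
transitivity (\prod_p \prod_q F (b p) (b q)).
  apply: eq_bigr => p _; rewrite rmorph_prod big_mkcond; apply: eq_bigr => q _.
  rewrite /F (inj_eq (place_inj pb)) !(place_col pb) /position.
  by case: ifP => _ //; rewrite !rmorphB !place_substX place_substC.
rewrite big_placement2; apply: eq_bigr => r _; rewrite [RHS]big_mkcond.
apply: eq_bigr => s _; rewrite /root_block; case: ifP => crs.
  apply: eq_bigr => c _; rewrite [RHS]big_mkcond; apply: eq_bigr => d _.
  by rewrite /F /= crs.
by rewrite big1 // => c _; rewrite big1 // => d _; rewrite /F /= crs andbF.
Qed.

Lemma place_opposite_cross_weight : psi (opposite_cross_weight position) =
  \prod_r \prod_(s | colW r == colW s) cross_block r s.
Proof.
rewrite rmorph_prod.
pose F (rc sd : W * nat) := if (colW rc.1 == colW sd.1) && (rc.2 < sd.2)%N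
  then sv rc.1 rc.2 - sv sd.1 sd.2 else 1.
transitivity (\prod_p \prod_q F (b p) (b q)).
  apply: eq_bigr => p _; rewrite rmorph_prod big_mkcond; apply: eq_bigr => q _.
  rewrite /F !(place_col pb) /position.
  by case: ifP => _ //; rewrite !rmorphB !place_substX.
rewrite big_placement2; apply: eq_bigr => r _; rewrite [RHS]big_mkcond.
apply: eq_bigr => s _; rewrite /cross_block; case: ifP => crs.
  apply: eq_bigr => c _; rewrite [RHS]big_mkcond; apply: eq_bigr => d _.
  by rewrite /F /= crs.
by rewrite big1 // => c _; rewrite big1 // => d _; rewrite /F /= crs.
Qed.

Lemma place_edge_weight : psi (edge_weight P col position) =
  \prod_(t : E * W * W | (colW t.1.2 == src t.1.1) && (colW t.2 == tgt t.1.1))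
     wheel_divisor P A t.1.1 t.1.2 t.2.
Proof.
rewrite big_mkcond -(pair_big predT predT (fun er s => if (colW er.2 == src er.1)
   && (colW s == tgt er.1) then wheel_divisor P A er.1 er.2 s else 1)) /=.
rewrite -(pair_big predT predT (fun e r => \prod_s (if (colW r == src e)
   && (colW s == tgt e) then wheel_divisor P A e r s else 1))) /=.
rewrite /edge_weight rmorph_prod; apply: eq_bigr => e _.
pose F (rc sd : W * nat) := if (colW rc.1 == src e) && (colW sd.1 == tgt e)
  then wheel_factor P e rc.1 sd.1 rc.2 sd.2 else 1.
transitivity (\prod_p \prod_q F (b p) (b q)).
  rewrite rmorph_prod big_mkcond; apply: eq_bigr => p _.
  rewrite /F !(place_col pb); case: ifP => cp; last by rewrite big1.
  rewrite rmorph_prod big_mkcond; apply: eq_bigr => q _ /=.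
  rewrite !(place_col pb) /position /wheel_factor; case: ifP => // _.
  by do 2?case: ifP => _; rewrite ?rmorph1 // rmorphD rmorphB !place_substX place_substC.
rewrite big_placement2; apply: eq_bigr => r _; apply: eq_bigr => s _.
rewrite /wheel_divisor -(pair_big predT predT (fun (c : 'I_(A r)) (d : 'I_(A s)) =>
  wheel_factor P e r s c d)) /= /F /=; case: ifP => // _.
by rewrite big1 // => c _; rewrite big1.
Qed.

(** Once [same_weight] and [cross_weight] are cancelled, P_lam over the discriminant is the root and
    edge weight over the opposite differences; the identity is written without division. Pairs of
    cells in one string give the scalars a1 and a2. *)
Lemma leading_term : exists a1 a2, [/\ is_const a1, is_const a2 &
  a1 * psi (root_weight P col position * edge_weight P col position) =
  a2 * psi (opposite_cross_weight position) * obstruction].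
Proof.
pose d0 := \prod_r cross_block r r; pose l0 := \prod_r root_block r r.
pose e0 := \prod_(t : E * W * W | (t.1.2 == t.2) && ((colW t.1.2 == src t.1.1)
                          && (colW t.2 == tgt t.1.1))) wheel_divisor P A t.1.1 t.1.2 t.2.
exists d0, (l0 * e0); split.
- apply: is_const_prod => r _; apply: is_const_prod => c _; apply: is_const_prod => d cd.
  by rewrite string_diff subrr add0r; apply: is_const_hh; lia.
- apply: cmsM.
    apply: is_const_prod => r _; apply: is_const_prod => c _; apply: is_const_prod => d.
    rewrite xpair_eqE eqxx /= => /andP[ne le].
    have -> : sv r c - sv r d - C (bhbar R) = C (hh *~ ((c%:Z - d%:Z - 1) * 2)).
      rewrite string_diff subrr add0r -rmorphB; congr (C _).
      have -> : bhbar R = hh *~ 2 by [].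
      by rewrite -mulrzBr; congr (_ *~ _); ring.
    by apply: is_const_hh; lia.
  apply: is_const_prod => -[[e r] s] /= /andP[/eqP -> _].
  apply: is_const_prod => -[c d] _ /=.
  have [->|/(wheel_factor_form P e s s)[n ->]] := eqVneq (c : nat) d.
    by rewrite wheel_factor_eq; exact: lreg_const1.
  by rewrite subrr add0r; exists (th e + hh *~ n) => //; exact: lreg_bth.
rewrite rmorphM place_root_weight place_edge_weight place_opposite_cross_weight.
have split_diag (F : W -> W -> P W) : \prod_r \prod_(s | colW r == colW s) F r s =
    (\prod_r F r r) * \prod_(rs : W * W | (rs.1 != rs.2) && (colW rs.1 == colW rs.2)) F rs.1 rs.2.
  rewrite -(pair_big_dep predT (fun r s => (r != s) && (colW r == colW s)) F) -big_split.
  apply: eq_bigr => r _ /=; rewrite (bigD1 r) //=; congr (_ * _).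
  by apply: eq_bigl => s; rewrite andbC eq_sym.
rewrite !split_diag.
rewrite [X in _ * (_ * X) = _](bigID (fun t : E * W * W => t.1.2 == t.2)) /=.
have -> : \prod_(rs : W * W | (rs.1 != rs.2) && (colW rs.1 == colW rs.2))
      root_block rs.1 rs.2 =
    \prod_(rs : W * W | (rs.1 != rs.2) && (colW rs.1 == colW rs.2))
      cross_block rs.1 rs.2 *
    \prod_(rs : W * W | (rs.1 != rs.2) && (colW rs.1 == colW rs.2))
      bad_divisor P A rs.1 rs.2.
  by rewrite -big_split; apply: eq_bigr => rs /andP[ne _]; exact: root_blockE.
rewrite /obstruction (eq_bigl (fun t : E * W * W => (t.1.2 == t.2) &&
   ((colW t.1.2 == src t.1.1) && (colW t.2 == tgt t.1.1)))); last first.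
  by move=> t; rewrite andbC.
rewrite [X in _ * (_ * (_ * X)) = _](eq_bigl (fun t : E * W * W =>
   [&& t.1.2 != t.2, colW t.1.2 == src t.1.1 & colW t.2 == tgt t.1.1])); last first.
  by move=> t; rewrite andbC.
rewrite -/d0 -/l0 -/e0; ring.
Qed.

Lemma lreg_obstruction : GRing.lreg obstruction.
Proof.
apply: lregM.
  by apply: lreg_prod => -[[e r] s] /= /andP[rs _]; exact: lreg_wheel_divisor.
apply: lreg_prod => -[r s] /= /andP[rs _].
by apply: lreg_prod => c _; rewrite bad_factorE; apply: lreg_form; rewrite eq_sym.
Qed.

(** Coprimality is read off from the constants: different edges have independent theta, bad factors
    contain no theta, and all bad factors have negative multiples of hbar, so those for (r, s) and
    (s, r) cannot cancel. *)
Lemma obstruction_divides f : wheel_condition col colW f ->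
  (forall B b', placement B b' -> (potential A < potential B)%N ->
     place_subst P b' f = 0) ->
  divides obstruction (psi f).
Proof.
move=> wf vf; apply: divides_coprimeM.
- apply: divides_prod_cond => [[[e r] s]|[[e r] s] [[e' r'] s']] /=.
    by move=> /and3P[rs /eqP cr /eqP cs]; exact: wf.
  move=> /and3P[rs _ _] /and3P[rs' _ _] ne.
  apply: coprime_wheel_divisor => // n; apply: coprime_to_prodr => -[c d] _ /=.
  have [->|/(wheel_factor_form P e' r' s')[m ->]] := eqVneq (c : nat) d.
    by rewrite wheel_factor_eq; exact: coprime_to1r.
  apply: coprime_forms => // es er.
    have ee : e' != e by apply: contraNneq ne => ->; rewrite es er.
    rewrite [_ - _](_ : _ = th e' - th e + hh *~ (m - n)); last by rewrite mulrzBr; ring.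
    exact: lreg_bthB.
  rewrite [_ + _](_ : _ = th e' + th e + hh *~ (m + n)); last by rewrite mulrzDr; ring.
  exact: lreg_bthD.
- apply: divides_prod_cond => [[r s]|[r s] [r' s']] /=.
    move=> /andP[rs /eqP crs]; apply: divides_prod_cond => [c _|c d _ _ cd].
      have := ltn_ord c; rewrite leq_min => /andP[cr cs].
      exact: (bad_factor_divides pb).
    rewrite !bad_factorE; apply: coprime_forms; rewrite 1?eq_sym //.
      move=> _ _; rewrite -mulrzBr; apply: lreg_bhbar.
      have := ltn_ord c; have := ltn_ord d; rewrite !leq_min.
      by move: cd; rewrite -(inj_eq val_inj) /=; lia.
    by move=> e; rewrite e eqxx in rs.
  move=> /andP[rs _] /andP[rs' _] ne.
  apply: coprime_to_prodl => c _; split.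
    by rewrite bad_factorE; apply: lreg_form; rewrite eq_sym.
  apply: coprime_to_prodr => d _; rewrite !bad_factorE.
  apply: coprime_forms; rewrite 1?eq_sym // => e1 e2.
    by rewrite e1 e2 eqxx in ne.
  rewrite -mulrzDr; apply: lreg_bhbar.
  have := ltn_ord c; have := ltn_ord d; rewrite !leq_min; lia.
apply: coprime_to_prodl => -[[e r] s] /= /andP[rs _]; split; first exact: lreg_wheel_divisor.
apply: coprime_wheel_divisor => // n; apply: coprime_to_prodr => -[r' s'] /= /andP[rs' _].
apply: coprime_to_prodr => c _; rewrite bad_factorE.
apply: coprime_forms => // [|_ _|_ _]; first by rewrite eq_sym.
  by rewrite -opprB; apply: lregN; exact: lreg_th_sub.
by rewrite addrC; exact: lreg_th_add.
Qed.

End LeadingTerm.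

(** * Generation of symmetric functions under the wheel conditions *)

Section PowerSums.
Variables (Q : quiver) (R : base_ring (edge Q)) (P : poly_functor R).
Variables (V : finType) (K : eqType) (kap : V -> K).
Notation x := (pX P).
Notation C := (pC P V).
Implicit Types (l : seq (K * nat)) (Y : {fset V}) (r s : V).

Fixpoint picks l : seq (K * nat * seq (K * nat)) :=
  if l is a :: l' then (a, l') :: [seq (p.1, a :: p.2) | p <- picks l'] else [::].

Lemma size_picks l p : p \in picks l -> size l = (size p.2).+1.
Proof.
elim: l p => //= a l IH p; rewrite inE => /predU1P[->//|/mapP[q /IH e ->]].
by rewrite /= e.
Qed.

(* Sums over injective maps respecting kap. *)
Definition inj_sum l Y : P V := word_sum kap x (fun _ _ => 1) (fun=> 1) l Y.
Arguments inj_sum : simpl never.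

Let inj_sum_cons a d l Y :
  inj_sum ((a, d) :: l) Y = \sum_(s <- Y | kap s == a) x s ^+ d * inj_sum l (Y `\ s)%fset.
Proof. by apply: eq_bigr => s _; rewrite big1 // mulr1. Qed.

(** An injective assignment either avoids r or sends exactly one letter to r; [picks] lists the
    candidates for that letter. *)
Lemma inj_sum_remove l Y r : r \in Y ->
  inj_sum l Y = inj_sum l (Y `\ r)%fset
    + \sum_(p <- picks l | p.1.1 == kap r) x r ^+ p.1.2 * inj_sum p.2 (Y `\ r)%fset.
Proof.
elim: l Y => [|[a d] l IH] Y rY; first by rewrite /= big_nil addr0.
rewrite !inj_sum_cons /= big_mkcond (big_fsetD1 r) //= -big_mkcond /=.
rewrite addrC big_cons /= eq_sym.
have -> : \sum_(s <- (Y `\ r)%fset | kap s == a) x s ^+ d * inj_sum l (Y `\ s)%fset =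
   \sum_(s <- (Y `\ r)%fset | kap s == a) x s ^+ d * inj_sum l (Y `\ r `\ s)%fset
   + \sum_(p <- [seq (p.1, (a, d) :: p.2) | p <- picks l] | p.1.1 == kap r)
       x r ^+ p.1.2 * inj_sum p.2 (Y `\ r)%fset.
  have -> : \sum_(p <- [seq (p.1, (a, d) :: p.2) | p <- picks l] | p.1.1 == kap r)
       x r ^+ p.1.2 * inj_sum p.2 (Y `\ r)%fset =
     \sum_(p <- picks l | p.1.1 == kap r) \sum_(s <- (Y `\ r)%fset | kap s == a)
       x r ^+ p.1.2 * (x s ^+ d * inj_sum p.2 (Y `\ r `\ s)%fset).
    by rewrite big_map; apply: eq_bigr => p _; rewrite /= inj_sum_cons mulr_sumr.
  rewrite exchange_big -big_split /= big_seq_cond [RHS]big_seq_cond.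
  apply: eq_bigr => s /andP[sY _]; rewrite (IH (Y `\ s)%fset); last first.
    by move: sY; rewrite !inE rY andbT eq_sym => /andP[].
  have -> : (Y `\ s `\ r = Y `\ r `\ s)%fset by rewrite !fsetDDl fsetUC.
  rewrite mulrDr mulr_sumr; congr (_ + _); apply: eq_bigr => p _; ring.
by rewrite -addrA; congr (_ + _); case: ifP => _; rewrite ?addr0 // addrC.
Qed.

Variable T : P V -> Prop.
Hypotheses (TC : forall c, T (C c)) (TB : forall f g, T f -> T g -> T (f - g)).
Hypotheses (TM : forall f g, T f -> T g -> T (f * g)).
Hypothesis Tpow : forall a d, T (\sum_(r | kap r == a) x r ^+ d).

Let T0 : T 0. Proof. by rewrite -(rmorph0 C). Qed.

Let TD f g : T f -> T g -> T (f + g).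
Proof.
by move=> Tf Tg; rewrite -[g]opprK; apply: TB => //; rewrite -sub0r; exact: TB.
Qed.

Let full_sum (F : V -> P V) a :
  \sum_(s <- full | kap s == a) F s = \sum_(s | kap s == a) F s.
Proof.
rewrite -big_filter -[RHS]big_filter; apply: perm_big; apply: uniq_perm.
- by rewrite filter_uniq ?fset_uniq.
- by rewrite filter_uniq ?index_enum_uniq.
- by move=> s; rewrite !mem_filter mem_index_enum !inE andbT.
Qed.

(** A power sum times [inj_sum l] places the new letter on an arbitrary variable. Subtracting the
    cases where it meets a letter of l, whose exponents then add up, leaves the sum for the longer
    word. *)
Lemma inj_sum_closed l : T (inj_sum l full).
Proof.
have [n] := ubnP (size l); elim: n l => // n IH [|[a d] l] /= sl.
  by rewrite /inj_sum /= -(rmorph1 C).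
have -> : inj_sum ((a, d) :: l) full =
    (\sum_(s | kap s == a) x s ^+ d) * inj_sum l full -
    \sum_(p <- picks l | p.1.1 == a) inj_sum ((a, (d + p.1.2)%N) :: p.2) full.
  rewrite inj_sum_cons full_sum mulr_suml; apply/eqP; rewrite eq_sym subr_eq eq_sym; apply/eqP.
  under [X in _ + X]eq_bigr do rewrite inj_sum_cons full_sum.
  rewrite exchange_big -big_split /=; apply: eq_bigr => s /eqP ks.
  rewrite [in RHS](@inj_sum_remove l full s) ?inE // mulrDr mulr_sumr ks; congr (_ + _).
  by apply: eq_bigr => p _; rewrite exprD mulrA.
apply: TB; first by apply: TM => //; apply: IH; lia.
rewrite big_seq_cond; apply: big_ind => // p /andP[pl _]; apply: IH => /=.
by rewrite -(size_picks pl) -ltnS.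
Qed.

(** A symmetric polynomial times the group order is its symmetrization, and the symmetrization of a
    monomial is an [inj_sum] over all variables. *)
Lemma symmetric_closed f :
  (forall t, color_perm kap t -> perm_act P t f = f) ->
  T (#|[pred t : {perm V} | color_perm kap t]|%:R * f).
Proof.
move=> sf; have <- : \sum_(t | color_perm kap t) perm_act P t f =
    #|[pred t : {perm V} | color_perm kap t]|%:R * f.
  rewrite (eq_bigr (fun=> f)) => [|t /sf //].
  by rewrite big_const iter_addr addr0 mulr_natl.
elim: (zspan_monomial f) => [_ [c [m ->]]||g1 g2 _ IH1 _ IH2].
- have -> : \sum_(t | color_perm kap t) perm_act P t (C c * \prod_p x p ^+ m p) =
      C c * \sum_(t | color_perm kap t) perm_act P t (\prod_p x p ^+ m p).
    by rewrite mulr_sumr; apply: eq_bigr => t _; rewrite rmorphM perm_actC.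
  apply: TM => //.
  have := @inj_sum_closed (letters kap (enum V) m).
  rewrite /inj_sum letters_sum ?enum_uniq // => [|p]; last by rewrite mem_enum.
  congr T; apply: eq_bigr => t _.
  have -> (l : seq V) : list_prod (fun _ _ => 1) l = 1 :> P V.
    by elim: l => //= p l ->; rewrite big1 // mulr1.
  rewrite mulr1 big_enum rmorph_prod; apply: eq_bigr => p _.
  by rewrite rmorphXn perm_actX.
- by rewrite big1 // => t _; rewrite rmorph0.
- have -> : \sum_(t | color_perm kap t) perm_act P t (g1 - g2) =
      \sum_(t | color_perm kap t) perm_act P t g1 - \sum_(t | color_perm kap t) perm_act P t g2.
    by rewrite -sumrB; apply: eq_bigr => t _; rewrite rmorphB.
  exact: TB.
Qed.

End PowerSums.

Lemma perm_of_counts (K : eqType) (W : finType) (f g : W -> K) :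
  (forall k, #|[pred r | f r == k]| = #|[pred r | g r == k]|) ->
  exists s : {perm W}, forall r, g (s r) = f r.
Proof.
move=> fg.
have cnt (h : W -> K) k : count_mem k (map h (enum W)) = #|[pred r | h r == k]|.
  by rewrite count_map cardE size_filter enumT.
have pe : perm_eq (map_tuple f (enum_tuple W)) (map_tuple g (enum_tuple W)).
  by apply/allP => k _ /=; rewrite !cnt fg.
have [s es] := tuple_permP pe.
pose h r : W := enum_val (s (enum_rank r)).
have hI : injective h by move=> p q /enum_val_inj /perm_inj /enum_rank_inj.
exists (perm hI) => r; rewrite permE.
have fE (u : W -> K) (i : 'I_#|W|) : tnth (map_tuple u (enum_tuple W)) i = u (enum_val i).
  by rewrite tnth_map (tnth_nth r) (enum_val_nth r).
have {}es := val_inj es.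
by rewrite -[in RHS](enum_rankK r) -[RHS]fE es tnth_mktuple fE.
Qed.

(** * Lifting values at strings to partially symmetric polynomials *)

Section Lifting.
Variables (Q : quiver) (R : base_ring (edge Q)) (P : poly_functor R).
Variables (V W : finType) (col : V -> vertex Q) (colW : W -> vertex Q).
Notation x := (pX P).
Notation C := (pC P W).
Notation placement := (placement col colW).
Variables (A : {ffun W -> nat}) (b : V -> W * nat).
Hypothesis pb : placement A b.
Notation psi := (place_subst P b).
Implicit Types (p q : V) (r s : W) (f g h : P V).

Definition label p := (col p, position b p).
Definition string_type r := (colW r, A r).

(** Invariance is asked for the stabilizer of the layering by position, so that its elements
    contribute equal terms to the symmetrization of h P_lam at b. *)
Definition lifts (g : P W) :=
  exists2 h, forall t, color_perm label t -> perm_act P t h = h & psi h = g.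

Lemma lifts_const a : lifts (C a).
Proof. by exists (pC P V a) => [t _|]; rewrite (perm_actC, place_substC). Qed.

Lemma liftsB (g1 g2 : P W) : lifts g1 -> lifts g2 -> lifts (g1 - g2).
Proof.
move=> [h1 s1 <-] [h2 s2 <-]; exists (h1 - h2); last by rewrite rmorphB.
by move=> t ct; rewrite rmorphB s1 ?s2.
Qed.

Lemma liftsM (g1 g2 : P W) : lifts g1 -> lifts g2 -> lifts (g1 * g2).
Proof.
move=> [h1 s1 <-] [h2 s2 <-]; exists (h1 * h2); last by rewrite rmorphM.
by move=> t ct; rewrite rmorphM s1 ?s2.
Qed.

Lemma lifts_layer i c d : lifts (\sum_(r | (colW r == i) && (c < A r)%N) x r ^+ d).
Proof.
exists (\sum_(p | label p == (i, c)) (x p - pC P V (bhbar R *+ c)) ^+ d).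
  move=> t /color_permP ct; rewrite rmorph_sum [RHS](reindex_inj (@perm_inj _ t)) /=.
  apply: eq_big => p; first by rewrite ct.
  by move=> _; rewrite rmorphXn rmorphB perm_actX perm_actC.
rewrite rmorph_sum big_mkcond /=.
transitivity (\sum_p (if (colW (b p).1, (b p).2) == (i, c) then x (b p).1 ^+ d else 0)).
  apply: eq_bigr => p _; rewrite (place_col pb) -/(position b p) -/(label p).
  case: eqP => // - [_ <-].
  by rewrite rmorphXn rmorphB place_substX place_substC /string_val addrK.
rewrite (big_placement _ (fun rc : W * nat => if (colW rc.1, rc.2) == (i, c)
  then x rc.1 ^+ d else 0) pb) [RHS]big_mkcond; apply: eq_bigr => r _ /=.
case: (ltnP c (A r)) => cr; last first.
  rewrite andbF big1 // => d' _; rewrite xpair_eqE.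
  by case: eqP => //= _; case: eqP => // e; have := ltn_ord d'; lia.
rewrite andbT (bigD1 (Ordinal cr)) //= xpair_eqE eqxx andbT big1 ?addr0 // => d' ne.
by rewrite xpair_eqE -[(_ == c)]/(d' == Ordinal cr) (negbTE ne) andbF.
Qed.

(** The variables of empty strings do not occur in values at b, while the power sum over the strings
    of length 0 consists of them. Setting them to 0 turns that sum into a constant and leaves the
    values at b unchanged. *)
Definition drop_empty : {rmorphism P W -> P W} :=
  pS P (fun r => if A r == 0%N then 0 else x r).

Lemma drop_emptyX r c : (c < A r)%N -> drop_empty (string_val P r c) = string_val P r c.
Proof.
by move=> cr; rewrite rmorphD pSX pSC ifN // -lt0n; apply: leq_trans cr.
Qed.

Lemma drop_empty_psi f : drop_empty (psi f) = psi f.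
Proof.
rewrite [LHS]pS_comp; apply: eq_pS => p; apply: drop_emptyX; exact: (place_lt pb).
Qed.

Lemma drop_empty_wheel e r s : drop_empty (wheel_divisor P A e r s) = wheel_divisor P A e r s.
Proof.
rewrite rmorph_prod; apply: eq_bigr => -[c d] _ /=; rewrite /wheel_factor.
by do 2?case: ifP => _; rewrite ?rmorph1 // rmorphD rmorphB !drop_emptyX // pSC.
Qed.

Lemma drop_empty_bad r s : drop_empty (bad_divisor P A r s) = bad_divisor P A r s.
Proof.
rewrite rmorph_prod; apply: eq_bigr => c _; rewrite /bad_factor !rmorphB !pSX pSC.
have := ltn_ord c; rewrite leq_min => /andP[/(leq_ltn_trans (leq0n _)) ar
  /(leq_ltn_trans (leq0n _)) as_].
by rewrite !ifN // -lt0n.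
Qed.

Lemma drop_empty_obstruction : drop_empty (obstruction P colW A) = obstruction P colW A.
Proof.
rewrite rmorphM !rmorph_prod; congr (_ * _); apply: eq_bigr => t _.
  exact: drop_empty_wheel.
exact: drop_empty_bad.
Qed.

Lemma lifts_symmetric (f : P W) :
  (forall t, color_perm string_type t -> perm_act P t f = f) -> drop_empty f = f ->
  lifts (#|[pred t | color_perm string_type t]|%:R * f).
Proof.
move=> sf ef; rewrite -{}ef -(rmorph_nat drop_empty) -rmorphM.
have := @symmetric_closed _ _ P W _ string_type (fun g : P W => lifts (drop_empty g)) _ _ _ _ f sf.
apply=> [c|g1 g2|g1 g2|[i c] d].
- by rewrite pSC; exact: lifts_const.
- by rewrite rmorphB; exact: liftsB.
- by rewrite rmorphM; exact: liftsM.
rewrite rmorph_sum; case: c => [|c].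
  rewrite (eq_bigr (fun=> C (0 ^+ d))) => [|r /eqP[_ ar]]; last first.
    by rewrite rmorphXn pSX ar eqxx rmorphXn rmorph0.
  by rewrite -rmorph_sum; exact: lifts_const.
(* Strings of length c + 1 are those with a cell in position c except those with a cell in position
   c + 1, and [lifts_layer] covers both sums. *)
have -> : \sum_(r | string_type r == (i, c.+1)) drop_empty (x r ^+ d) =
    \sum_(r | (colW r == i) && (c < A r)%N) x r ^+ d
    - \sum_(r | (colW r == i) && (c.+1 < A r)%N) x r ^+ d.
  rewrite [X in X - _](bigID (fun r => A r == c.+1)) /= [X in _ + X - _](eq_bigl
      (fun r => (colW r == i) && (c.+1 < A r)%N)) ?addrK => [|r]; last by lia.
  apply: eq_big => r; first by rewrite xpair_eqE; lia.
  by rewrite xpair_eqE => /andP[_ /eqP ar]; rewrite rmorphXn pSX ar.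
by apply: liftsB; exact: lifts_layer.
Qed.

Lemma perm_act_string t r c : perm_act P t (string_val P r c) = string_val P (t r) c.
Proof. by rewrite rmorphD perm_actX perm_actC. Qed.

Lemma string_typeP t : color_perm string_type t ->
  forall r, colW (t r) = colW r /\ A (t r) = A r.
Proof. by move=> /color_permP ct r; have [] := ct r. Qed.

Lemma obstruction_act t : color_perm string_type t ->
  perm_act P t (obstruction P colW A) = obstruction P colW A.
Proof.
move=> ct; have ctr r := (string_typeP ct r).1; have atr r := (string_typeP ct r).2.
rewrite rmorphM !rmorph_prod; congr (_ * _).
  pose T (u : edge Q * W * W) := (u.1.1, t u.1.2, t u.2).
  have TI : injective T by move=> [[e r] s] [[e' r'] s'] [-> /perm_inj -> /perm_inj ->].
  rewrite [RHS](reindex_inj TI); apply: eq_big => -[[e r] s] /=.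
    by rewrite !ctr (inj_eq perm_inj).
  move=> _; rewrite /wheel_divisor !atr rmorph_prod; apply: eq_bigr => -[c d] _ /=.
  rewrite /wheel_factor; do 2?case: ifP => _; rewrite ?rmorph1 //;
  by rewrite rmorphD rmorphB !perm_act_string perm_actC.
pose T (u : W * W) := (t u.1, t u.2).
have TI : injective T by move=> [r s] [r' s'] [/perm_inj -> /perm_inj ->].
rewrite [RHS](reindex_inj TI); apply: eq_big => -[r s] /=.
  by rewrite !ctr (inj_eq perm_inj).
move=> _; rewrite /bad_divisor !atr rmorph_prod; apply: eq_bigr => c _ /=.
by rewrite /bad_factor !rmorphB !perm_actX perm_actC atr.
Qed.

Lemma place_subst_string_perm (t : {perm W}) (B : {ffun W -> nat}) : (forall r, colW (t r) = colW r) ->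
  (forall r, B (t r) = A r) -> placement B (fun p => (t (b p).1, (b p).2)) /\
  forall f, perm_act P t (psi f) = place_subst P (fun p => (t (b p).1, (b p).2)) f.
Proof.
move=> ctr btr; split; last first.
  by move=> f; rewrite [LHS]pS_comp; apply: eq_pS => p; rewrite perm_act_string.
split=> [p q [/perm_inj e1 e2]|p|p|r c].
- by apply: (place_inj pb); rewrite [LHS]surjective_pairing e1 e2 -surjective_pairing.
- by rewrite /= ctr (place_col pb).
- by rewrite /= btr (place_lt pb).
- rewrite -(permKV t r) btr => /(place_surj pb)[p ep].
  by exists p; rewrite ep.
Qed.

Lemma psi_symmetric f t : color_symmetric col f -> color_perm string_type t ->
  perm_act P t (psi f) = psi f.
Proof.
move=> sf ct; have [pb' ->] := @place_subst_string_perm t A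
  (fun r => (string_typeP ct r).1) (fun r => (string_typeP ct r).2).
have [u cu eu] := placement_perm pb pb'.
by rewrite (eq_place_subst _ eu) -place_subst_act sf.
Qed.

End Lifting.

Section LayerWeightAction.
Variables (Q : quiver) (R : base_ring (edge Q)) (P : poly_functor R).
Variables (V : finType) (col : V -> vertex Q) (lam : V -> nat).
Notation x := (pX P).

Lemma perm_act_prod2 (t : {perm V}) (D : V -> V -> bool) (F : V -> V -> P V) :
  (forall p q, D (t p) (t q) = D p q) ->
  (forall p q, perm_act P t (F p q) = F (t p) (t q)) ->
  perm_act P t (\prod_p \prod_(q | D p q) F p q) = \prod_p \prod_(q | D p q) F p q.
Proof.
move=> tD tF; rewrite rmorph_prod [RHS](reindex_inj (@perm_inj _ t)).
apply: eq_bigr => p _ /=; rewrite rmorph_prod [RHS](reindex_inj (@perm_inj _ t)).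
by apply: eq_big => q; rewrite ?tD.
Qed.

Lemma layer_weight_act (t : {perm V}) : color_perm (fun p => (col p, lam p)) t ->
  perm_act P t (layer_weight P col lam) = layer_weight P col lam.
Proof.
move=> /color_permP ct; have ctp p : col (t p) = col p by case: (ct p).
have ltp p : lam (t p) = lam p by case: (ct p).
rewrite layer_weightE !rmorphM; congr (_ * _ * (_ * _)).
- apply: perm_act_prod2 => p q; first by rewrite (inj_eq perm_inj) !ctp !ltp.
  by rewrite !rmorphB !perm_actX perm_actC.
- rewrite /edge_weight rmorph_prod; apply: eq_bigr => e _.
  rewrite rmorph_prod [RHS](reindex_inj (@perm_inj _ t)); apply: eq_big => p.
    by rewrite ctp.
  move=> _; rewrite rmorph_prod [RHS](reindex_inj (@perm_inj _ t)) /=.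
  apply: eq_big => q; first by rewrite ctp.
  move=> _; rewrite !ltp; do 2?case: ifP => _; rewrite ?rmorph1 //;
  by rewrite rmorphD rmorphB !perm_actX perm_actC.
- apply: perm_act_prod2 => p q; first by rewrite (inj_eq perm_inj) !ctp !ltp.
  by rewrite !rmorphB !perm_actX.
- apply: perm_act_prod2 => p q; first by rewrite !ctp !ltp.
  by rewrite !rmorphB !perm_actX.
Qed.

End LayerWeightAction.

(** * Descending induction on the potential *)

Section Reduction.
Variables (Q : quiver) (R : base_ring (edge Q)) (P : poly_functor R).
Variables (V W : finType) (col : V -> vertex Q) (colW : W -> vertex Q).
Notation x := (pX P).
Notation C := (pC P V).
Notation placement := (placement col colW).
Implicit Types (A B : {ffun W -> nat}) (b : V -> W * nat) (F f g h : P V).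

(** The factor [discriminant] matches the one built into the word polynomials. *)
Definition generated F :=
  exists2 r : R, GRing.lreg r & word_span col (C r * (discriminant P col * F)).

Lemma generated_sub F G (r : R) : GRing.lreg r ->
  generated G -> generated (C r * F - G) -> generated F.
Proof.
move=> lr [s ls sG] [t lt sF]; exists (s * (t * r)); first by do 2?apply: lregM.
have -> : C (s * (t * r)) * (discriminant P col * F) =
   C s * (C t * (discriminant P col * (C r * F - G)))
   + C t * (C s * (discriminant P col * G)) by rewrite !rmorphM; ring.
by apply: word_spanD; apply: word_spanZ.
Qed.

Lemma card_positions A b (i : vertex Q) c : placement A b ->
  #|[pred p | (col p == i) && ((b p).2 == c)]| = #|[pred r | (colW r == i) && (c < A r)%N]|.
Proof.
move=> pb; rewrite -sum1_card big_mkcond -[RHS]sum1_card [RHS]big_mkcond /=.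
transitivity (\sum_p (if (colW (b p).1 == i) && ((b p).2 == c) then 1 else 0))%N.
  by apply: eq_bigr => p _; rewrite inE (place_col pb).
rewrite (big_placement _ (fun rc : W * nat =>
  if (colW rc.1 == i) && (rc.2 == c) then 1 else 0)%N pb).
apply: eq_bigr => r _ /=; rewrite inE; case: (ltnP c (A r)) => cr; last first.
  rewrite andbF big1 // => d _; case: eqP => //= _; case: eqP => // e.
  by have := ltn_ord d; lia.
rewrite andbT (bigD1 (Ordinal cr)) //= eqxx andbT big1 ?addn0 // => d ne.
by rewrite -[(_ == c)]/(d == Ordinal cr) (negbTE ne) andbF.
Qed.

(* The positions of the variables determine the strings up to permutation. *)
Lemma vanishing_same_positions A b B b' F : placement A b -> placement B b' ->
  color_symmetric col F -> (forall p, (b' p).2 = (b p).2) ->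
  place_subst P b F = 0 -> place_subst P b' F = 0.
Proof.
move=> pb pb' sF e F0.
have cE i c : #|[pred r | (colW r == i) && (c < A r)%N]| =
    #|[pred r | (colW r == i) && (c < B r)%N]|.
  rewrite -(card_positions _ _ pb) -(card_positions _ _ pb'); apply: eq_card => p.
  by rewrite !inE e.
have cS (D : {ffun W -> nat}) i c : #|[pred r | (colW r == i) && (c < D r)%N]| =
    (#|[pred r | string_type colW D r == (i, c.+1)]|
     + #|[pred r | (colW r == i) && (c.+1 < D r)%N]|)%N.
  rewrite -[LHS](cardID [pred r | D r == c.+1]); congr (_ + _)%N; apply: eq_card => r;
  rewrite !inE ?xpair_eqE; lia.
have c0 (D : {ffun W -> nat}) i : #|[pred r | colW r == i]| =
    (#|[pred r | string_type colW D r == (i, 0%N)]|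
     + #|[pred r | (colW r == i) && (0 < D r)%N]|)%N.
  rewrite -[LHS](cardID [pred r | D r == 0%N]); congr (_ + _)%N; apply: eq_card => r;
  rewrite !inE ?xpair_eqE; lia.
have [[i c]|t et] := @perm_of_counts _ _ (string_type colW A) (string_type colW B).
  case: c => [|c].
    by apply: (@addIn #|[pred r | (colW r == i) && (0 < A r)%N]|); rewrite -c0 cE -c0.
  apply: (@addIn #|[pred r | (colW r == i) && (c.+1 < A r)%N]|).
  by rewrite -cS !cE -cS.
have [pbt ebt] := @place_subst_string_perm _ _ P _ _ _ _ _ _ pb t B
  (fun r => congr1 fst (et r)) (fun r => congr1 snd (et r)).
have [u cu eu] := placement_perm pbt pb'.
by rewrite (eq_place_subst _ eu) -place_subst_act sF // -ebt F0 rmorph0.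
Qed.

(** Some term of the symmetrization survives, and [potential_le] applies to the placement permuted
    accordingly. *)
Lemma place_symmetrize_neq0 B b' h lam : placement B b' ->
  place_subst P b' (symmetrize col (h * layer_weight P col lam)) <> 0 ->
  (potential B <= \sum_p lam p)%N /\
  (potential B = \sum_p lam p ->
     exists2 t, color_perm col t & forall p, (b' (t p)).2 = lam p)%N.
Proof.
move=> pb' nz.
have [t /andP[ct /eqP ne]|no] := pickP [pred t : {perm V} | color_perm col t &&
    (place_subst P (b' \o t) (h * layer_weight P col lam) != 0)]; last first.
  case: nz; rewrite rmorph_sum big1 // => t ct; rewrite place_subst_act; apply/eqP.
  by have := no t; rewrite /= ct => /negbFE.
have pbt := placement_act pb' ct.
have nzr : place_subst P (b' \o t) (root_weight P col lam) <> 0.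
  by move=> e; apply: ne; rewrite layer_weightE !rmorphM e !mul0r mulr0.
have [le eqc] := potential_le pbt nzr; split=> // /eqc e.
by exists t.
Qed.

(** The cofactor f0 of the obstruction is invariant under exchanging strings of the same type, so it
    lifts to some h after multiplication by the order N of that group. At b the symmetrization of h
    P_lam agrees with F up to N, the scalars of [leading_term] and the number M of equal terms. *)
Lemma reduction_step A b F : placement A b -> color_symmetric col F ->
  wheel_condition col colW F ->
  (forall B b', placement B b' -> (potential A < potential B)%N ->
     place_subst P b' F = 0) ->
  exists r G, [/\ GRing.lreg r, generated G, color_symmetric col G,
    wheel_condition col colW G & place_subst P b (C r * F - G) = 0 /\
    forall B b', placement B b' -> place_subst P b' G <> 0 ->
      (potential B <= potential A)%N /\ (potential B = potential A ->
        exists2 t, color_perm col t & forall p, (b' (t p)).2 = (b p).2)].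
Proof.
move=> pb sF wF vF.
have [f0 ef0] := obstruction_divides pb wF vF.
set obs := obstruction P colW A in ef0.
have lobs : GRing.lreg obs := @lreg_obstruction _ _ P _ colW A.
have sf0 t : color_perm (string_type colW A) t -> perm_act P t f0 = f0.
  move=> ct; apply: lobs; rewrite [RHS]mulrC -ef0 -(psi_symmetric pb sF ct) ef0.
  by rewrite rmorphM /obs (obstruction_act P ct) mulrC.
have df0 : drop_empty P A f0 = f0.
  apply: lobs; rewrite [RHS]mulrC -ef0 -(drop_empty_psi pb F) ef0.
  by rewrite rmorphM /obs drop_empty_obstruction mulrC.
have [h sh eh] := lifts_symmetric pb sf0 df0.
set N := #|_| in eh.
have N0 : (0 < N)%N.
  by apply/card_gt0P; exists 1%g; rewrite inE; apply/color_permP => p; rewrite perm1.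
have [a1 [a2 [[r1 lr1 ->] [r2 lr2 ->] lead]]] := @leading_term _ _ P _ _ _ _ _ _ pb.
pose lam := position b; rewrite -/lam in lead.
have [G sG eG] := layer_quotient col (C r1 * h) lam.
pose M := #|[pred t | color_perm (label col b) t]|.
have M0 : (0 < M)%N.
  by apply/card_gt0P; exists 1%g; rewrite inE; apply/color_permP => p; rewrite perm1.
have potA : potential A = (\sum_p lam p)%N by exact: potentialE pb.
have psiG : place_subst P b G = place_subst P b (C (M%:R * N%:R * r2) * F).
  apply: (@place_subst_discriminant _ R P _ _ _ _ _ _ pb); rewrite -rmorphM -eG rmorph_sum.
  transitivity (\sum_(t | color_perm (label col b) t)
      place_subst P b (C r1 * h * layer_weight P col lam)).
    (* Permutations that do not preserve positions contribute 0: if the root weight survives, the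
       equality of potentials forces the layers to be the permuted positions. *)
    rewrite (bigID (color_perm (label col b))) /= [X in _ + X]big1 ?addr0.
      apply: eq_big => t; first by rewrite andb_idl // => ct; apply/color_permP => p;
        have [] := color_permP _ _ ct p.
      by move=> /andP[_ ct]; rewrite (rmorphM (perm_act P t)) layer_weight_act // (rmorphM (perm_act P t)) sh // perm_actC.
    move=> t /andP[ct nct]; rewrite place_subst_act layer_weightE !rmorphM.
    have pbt := placement_act pb ct.
    have [->|/eqP nzr] := eqVneq (place_subst P (b \o t) (root_weight P col lam)) 0.
      by rewrite !mul0r !mulr0.
    case/negP: nct; apply/color_permP => p; rewrite /label (color_permP _ _ ct).
    congr (_, _); have [_ /(_ potA) e] := potential_le pbt nzr.
    by rewrite [RHS]e.
  rewrite big_const iter_addr addr0 -/M layer_weightE.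
  have -> : place_subst P b (C (M%:R * N%:R * r2) * F) =
      M%:R * N%:R * pC P W r2 * (f0 * obs).
    by rewrite rmorphM place_substC ef0 !rmorphM !rmorph_nat.
  rewrite !rmorphM eh place_substC (discriminant_split P col lam) !rmorphM.
  move: lead; rewrite rmorphM -/obs -mulr_natl.
  move: (pC P W r1) (pC P W r2) (place_subst P b (root_weight P col lam)).
  move: (place_subst P b (edge_weight P col lam)) (place_subst P b (same_weight P col lam)).
  move: (place_subst P b (cross_weight P col lam)).
  move: (place_subst P b (opposite_cross_weight P col lam)) (obs).
  move=> op o cw ew sw c1 c2 rw lead.
  transitivity (M%:R * N%:R * f0 * sw * cw * (c1 * (rw * ew))); first by ring.
  by rewrite lead; ring.
exists (M%:R * N%:R * r2), G; split=> //.
- by do 2?apply: lregM => //; apply: lreg_bnat.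
- have [r lr gr] := unit_ideal P col lam; exists r => //.
  rewrite -eG -symmetrizeMl; last by move=> t _; exact: perm_actC.
  rewrite mulrA [C r * _]mulrC; exact: gr.
- exact: quotient_wheel_condition eG.
split=> [|B b' pb' nz]; first by rewrite rmorphB psiG subrr.
have [] := @place_symmetrize_neq0 B b' (C r1 * h) lam pb'.
  rewrite eG rmorphM => e; apply: nz; apply: (@place_subst_discriminant _ R P _ _ _ _ _ _ pb').
  by rewrite e mulr0.
by rewrite -potA.
Qed.

Lemma potential_bound A b : placement A b -> (potential A <= #|V| * #|V|)%N.
Proof.
move=> pb; rewrite (potentialE pb) -sum_nat_const; apply: leq_sum => p _.
apply/ltnW/(leq_trans (place_lt pb p)).
apply: leq_trans (max_card [pred q | col q == colW (b p).1]).
by rewrite (card_placement _ pb) (bigD1 (b p).1) //= leq_addr.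
Qed.

(** The outer induction lowers the potential from which F vanishes; the inner list holds the types
    of the current potential still to be cleared. If the correction G is nonzero at another type of
    this potential, that type is a rearrangement of A, and the corrected F vanishes there as
    well. *)
Lemma generated_induction :
  (forall F, (forall A b, placement A b -> place_subst P b F = 0) -> generated F) ->
  forall F, color_symmetric col F -> wheel_condition col colW F -> generated F.
Proof.
move=> base F sF wF.
have : forall A b, placement A b -> (#|V| * #|V| < potential A)%N -> place_subst P b F = 0.
  by move=> A b /potential_bound; rewrite leqNgt => /negbTE ->.
suff H n : forall F, color_symmetric col F -> wheel_condition col colW F ->
    (forall A b, placement A b -> (n <= potential A)%N -> place_subst P b F = 0) ->
    generated F by exact: H.
elim: n => [|n IH] {}F {}sF {}wF vF; first by apply: base => A b pb; exact: vF pb _.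
have level (l : seq {ffun W -> nat}) : forall F, color_symmetric col F ->
    wheel_condition col colW F ->
    (forall A b, placement A b -> (n < potential A)%N -> place_subst P b F = 0) ->
    (forall A b, placement A b -> potential A = n -> A \notin l -> place_subst P b F = 0) ->
    generated F.
  elim: l => [|A l IHl] {vF}F {}sF {}wF above at_n.
    apply: IH => // A b pb; rewrite leq_eqVlt => /predU1P[e|]; last exact: above.
    exact: (at_n _ _ pb).
  have [[b [pb potA]]|no] := pselect (exists b, placement A b /\ potential A = n); last first.
    apply: IHl => // B b pb potB Bl; apply: (at_n _ _ pb potB).
    by rewrite inE negb_or Bl andbT; apply: contra_notN no => /eqP <-; exists b.
  have [|r [G [lr gG sG wG [F'0 vG]]]] := @reduction_step A b F pb sF wF.
    by move=> B b' pb'; rewrite potA; exact: above.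
  apply: (generated_sub lr gG).
  have sF' : color_symmetric col (C r * F - G).
    by move=> t ct; rewrite rmorphB rmorphM perm_actC sF // sG.
  apply: IHl => // [B b' pb' e u v uv cu cv|B b' pb' potB|B b' pb' potB Bl].
  - rewrite rmorphB rmorphM; apply: dividesB; last exact: (wG _ _ pb').
    by apply: dividesMl; exact: (wF _ _ pb').
  - rewrite rmorphB rmorphM (above _ _ pb') // mulr0 sub0r.
    have [->|/eqP /(vG _ _ pb')[]] := eqVneq (place_subst P b' G) 0; first by rewrite oppr0.
    by rewrite potA leqNgt potB.
  - have [eBA|neBA] := eqVneq B A.
      rewrite eBA in pb'; have [t ct et] := placement_perm pb pb'.
      by rewrite (eq_place_subst _ et) -place_subst_act sF'.
    have [G0|/eqP /(vG _ _ pb')[_]] := eqVneq (place_subst P b' G) 0.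
      rewrite rmorphB rmorphM G0 (at_n _ _ pb') ?mulr0 ?subr0 //.
      by rewrite inE negb_or neBA.
    rewrite potB potA => /(_ erefl)[t ct et].
    have := vanishing_same_positions pb (placement_act pb' ct) sF' et F'0.
    by rewrite -place_subst_act sF'.
(* No string is longer than the number of variables, so the types form a finite list. *)
apply: (level [seq [ffun r => nat_of_ord (f r)] | f : {ffun W -> 'I_#|V|.+1} <- enum predT]) => //.
move=> A b pb _ /mapP[]; exists [ffun r => inord (A r)]; first by rewrite mem_enum.
apply/ffunP => r; rewrite !ffunE inordK // ltnS.
apply: leq_trans (max_card [pred q | col q == colW r]).
by rewrite (card_placement _ pb) (bigD1 r) //= leq_addr.
Qed.

End Reduction.

(** With W = V and all strings of length 1 the specialization is the identity, so vanishing at all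
    types includes F = 0. *)
Lemma symmetric_generated (Q : quiver) (R : base_ring (edge Q)) (P : poly_functor R)
    (V : finType) (col : V -> vertex Q) (F : P V) :
  color_symmetric col F -> wheel_condition col col F -> generated col F.
Proof.
apply: generated_induction => {}F vF; exists 1; first exact: lreg1.
have p1 : placement col col [ffun => 1%N] (fun p : V => (p, 0%N)).
  split=> [p q []|//|p|r [|c]]; rewrite ?ffunE //=.
  by exists r.
suff -> : F = 0 by rewrite !mulr0; exact: word_span0.
rewrite -[RHS](vF _ _ p1) -[LHS](pS_id F); apply: eq_pS => p.
by rewrite /string_val rmorph0 addr0.
Qed.

(** * The shuffle algebra *)

Section LocalizationIn.
Variables (B : comPzRingType) (S : central_mulset B).

Definition loc_in (b : B) : loc S := frac S b 1.

Fact loc_in_zmod_morphism : zmod_morphism loc_in.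
Proof.
have S1 := cms1 S; move=> a b; rewrite /loc_in fracN // fracD // !mul1r; exact: erefl.
Qed.

Fact loc_in_monoid_morphism : monoid_morphism loc_in.
Proof. by have S1 := cms1 S; split=> // a b; rewrite /loc_in fracM // mulr1. Qed.

HB.instance Definition _ :=
  GRing.isZmodMorphism.Build B (loc S) loc_in loc_in_zmod_morphism.
HB.instance Definition _ :=
  GRing.isMonoidMorphism.Build B (loc S) loc_in loc_in_monoid_morphism.

Lemma loc_inM b s : S s -> loc_in s * frac S b s = loc_in b.
Proof.
by have S1 := cms1 S; move=> Ss; rewrite fracM // mul1r; apply: fracE; rewrite // mul1r.
Qed.

Lemma loc_in_cancel s (u v : loc S) : S s -> loc_in s * u = loc_in s * v -> u = v.
Proof.
have S1 := cms1 S; move=> Ss e; have : frac S 1 s * (loc_in s * u) = frac S 1 s * (loc_in s * v).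
  by rewrite e.
by rewrite !mulrA [frac S 1 s * _]mulrC loc_inM // rmorph1 !mul1r.
Qed.

End LocalizationIn.

Lemma subring_gen0 (A : pzRingType) (X : A -> Prop) : subring_gen X 0.
Proof. by rewrite -(subrr 1); apply: subringB; exact: subring1. Qed.

Lemma subring_genD (A : pzRingType) (X : A -> Prop) x y :
  subring_gen X x -> subring_gen X y -> subring_gen X (x + y).
Proof.
move=> Xx Xy; rewrite -[y]opprK -[- y]sub0r; apply: subringB => //.
by apply: subringB => //; exact: subring_gen0.
Qed.

Section LocalizedSubring.
Variables (Q : quiver) (R : base_ring (edge Q)) (A : pzRingType) (c : R -> A).
Hypotheses (c_mul : monoid_morphism c) (c_central : forall r a, c r * a = a * c r).
Variables (B : {ffun vertex Q -> nat} -> A -> Prop) (el : vertex Q * nat -> A).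
Notation S := (base_mulset c_mul c_central).

Definition word_comb_el (T : word_comb R) : A :=
  \sum_(t <- T) c t.1 * \prod_(l <- t.2) el l.

(** If r b is the combination T, then b / q is T / (r q): the coefficients with their denominators
    lie in degree 0 and the letters in the degrees alpha_i. *)
Lemma localized_spherically_generated :
  (forall r, B 0 (c r)) ->
  (forall i d, B (@simple_root Q i) (el (i, d))) ->
  (forall n b, B n b -> exists2 r, GRing.lreg r & exists T, c r * b = word_comb_el T) ->
  spherically_generated (fun n => localized (S := S) (B n)).
Proof.
move=> Bc Bel Bw x; elim=> [{}x [n [b [s [Bb [q lq ->] ->]]]]||x1 x2 _ IH1 _ IH2].
- have [r lr [T eT]] := Bw _ _ Bb.
  have Sq : S (c q) by exists q.
  have Srq : S (c r * c q) by exists (r * q); [exact: lregM | rewrite c_mul.2].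
  have S1 := cms1 S.
  have -> : frac S b (c q) = \sum_(t <- T) frac S (c t.1) (c r * c q)
      * \prod_(l <- t.2) frac S (el l) 1.
    have -> : frac S b (c q) = frac S (word_comb_el T) (c r * c q).
      by apply: fracE => //; rewrite -eT mulrA -!c_mul.2 [q * r]mulrC.
    rewrite /word_comb_el; elim: (T) => [|t T' IH].
      by rewrite !big_nil; apply: fracE => //; rewrite !mulr0.
    rewrite !big_cons -{}IH.
    have -> (l : seq (vertex Q * nat)) : \prod_(u <- l) frac S (el u) 1 =
        frac S (\prod_(u <- l) el u) 1.
      elim: l => [|u l IHl]; first by rewrite !big_nil.
      by rewrite !big_cons IHl fracM // mulr1.
    rewrite fracM // mulr1 fracD //; apply: fracE => //; first exact: cmsM.
    by rewrite -[X in _ = _ * X]mulrDr !mulrA.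
  apply: big_ind => [||t _]; [exact: subring_gen0 | exact: subring_genD |].
  apply: subringM; first by apply: subring_in; left; exists (c t.1), (c r * c q).
  apply: big_ind => [||[i d] _]; [exact: subring1 | exact: subringM |].
  by apply: subring_in; right; exists i, (el (i, d)), 1.
- exact: subring_gen0.
- exact: subringB.
Qed.

End LocalizedSubring.

(** * Words as functions of finite sets of variables *)

Section SetWords.
Variables (Q : quiver) (R : base_ring (edge Q)).
Variables (B : comNzRingType) (c : {rmorphism R -> B}).
Variables (Z : choiceType) (col : Z -> vertex Q) (x : Z -> B).
Variables (L : comPzRingType) (iota : {rmorphism B -> L}) (z : Z -> Z -> L).
Implicit Types (p q : Z) (Y : {fset Z}) (s : word Q).

Definition letter_fun (l : vertex Q * nat) : setfun z :=
  fun Y => \sum_(p <- Y | (col p == l.1) && (Y == [fset p])%fset) iota (x p ^+ l.2).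

Definition word_fun s : setfun z := \prod_(l <- s) letter_fun l.

Definition set_discriminant Y : B :=
  \prod_(p <- Y) \prod_(q <- Y | (p != q) && (col p == col q)) (x p - x q).

(** A letter is supported on singletons, so the sum over subsets in the product becomes a sum over
    the variable that the letter takes. *)
Lemma word_fun_cons l s Y : word_fun (l :: s) Y =
  \sum_(p <- Y | col p == l.1)
    iota (x p ^+ l.2) * word_fun s (Y `\ p)%fset * \prod_(q <- (Y `\ p)%fset) z p q.
Proof.
rewrite /word_fun big_cons -/(word_fun s) setfun_mulE.
transitivity (\sum_(A <- fpowerset Y) \sum_(p <- Y | (col p == l.1) && (A == [fset p])%fset)
   iota (x p ^+ l.2) * word_fun s (Y `\` A)%fset * zprod z A (Y `\` A)%fset).
  apply: eq_big_seq => A; rewrite fpowersetE => AY.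
  rewrite /letter_fun !mulr_suml.
  rewrite -[LHS]big_filter -[RHS]big_filter; apply: perm_big.
  apply: uniq_perm; rewrite ?filter_uniq ?fset_uniq // => p.
  rewrite !mem_filter; have [eA|_] := eqVneq A [fset p]%fset; last by rewrite andbF.
  have pA : p \in A by rewrite eA inE.
  by rewrite pA (fsubsetP AY _ pA).
rewrite (exchange_big_dep (fun p => col p == l.1)) /=; last by move=> A p _ /andP[].
rewrite big_seq_cond [RHS]big_seq_cond; apply: eq_bigr => p /andP[pY cp].
rewrite cp /= -big_filter (perm_big [:: [fset p]%fset]) /=.
  by rewrite big_seq1 /zprod big_seq_fset1.
apply: uniq_perm; rewrite ?filter_uniq ?fset_uniq // => A.
rewrite mem_filter fpowersetE inE; case: eqP => // ->.
by rewrite fsub1set.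
Qed.

Lemma set_discriminantD1 p Y : p \in Y ->
  set_discriminant Y = set_discriminant (Y `\ p)%fset *
    \prod_(q <- (Y `\ p)%fset | col p == col q) ((x p - x q) * (x q - x p)).
Proof.
move=> pY; rewrite /set_discriminant (big_fsetD1 p) //= [X in X * _]big_mkcond (big_fsetD1 p) //=.
rewrite eqxx mul1r big_split /= [RHS]mulrC -mulrA; congr (_ * _).
  rewrite big_seq_cond [RHS]big_mkcond [RHS]big_seq_cond /=; apply: eq_bigr => q.
  by rewrite !inE => /andP[/andP[qp _] _]; rewrite eq_sym qp.
rewrite [X in _ = X * _]big_mkcond -big_split /=.
rewrite big_seq_cond [RHS]big_seq_cond; apply: eq_bigr => q; rewrite !inE.
move=> /andP[/andP[qp _] _]; rewrite big_mkcond (big_fsetD1 p) //= qp /= -big_mkcond /=.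
by rewrite [col q == _]eq_sym.
Qed.

Hypothesis zE : forall p q, p != q -> iota (if col p == col q then x p - x q else 1) * z p q
  = iota (root_factor c col x p q * edge_factor c col x p q).

(** The pairs containing p contribute (x_p - x_q)(x_q - x_p) to the discriminant: the first factor
    clears the pole of zeta and the second is [diff_factor]. *)
Lemma word_funE s Y :
  iota (set_discriminant Y) * word_fun s Y = iota (word_poly c col x s Y).
Proof.
elim: s Y => [|[i d] s IH] Y.
  have -> : word_fun [::] Y = if Y == fset0 then 1 else 0 by rewrite /word_fun big_nil.
  rewrite /word_poly /=.
  case: eqP => [->|_]; last by rewrite mulr0 rmorph0.
  by rewrite /set_discriminant big_seq_fset0 mulr1.
rewrite word_fun_cons mulr_sumr /word_poly /= rmorph_sum.
rewrite big_seq_cond [RHS]big_seq_cond; apply: eq_bigr => p /andP[pY _].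
rewrite (set_discriminantD1 pY) !rmorphM -[iota (word_sum _ _ _ _ _ _)]IH.
have -> : iota (\prod_(q <- (Y `\ p)%fset) word_factor c col x p q) =
   iota (\prod_(q <- (Y `\ p)%fset | col p == col q) ((x p - x q) * (x q - x p)))
   * \prod_(q <- (Y `\ p)%fset) z p q.
  rewrite !rmorph_prod [X in _ = X * _]big_mkcond -big_split /=.
  rewrite big_seq_cond [RHS]big_seq_cond; apply: eq_bigr => q /andP[]; rewrite !inE.
  move=> /andP[qp _] _; rewrite /word_factor rmorphM -zE; last by rewrite eq_sym.
  rewrite /diff_factor; case: ifP => _; rewrite ?rmorph1 ?mulr1 // rmorphM; ring.
ring.
Qed.

End SetWords.

(** * Comparison with the refined wheel conditions *)

Section WheelUpdown.
Variables (Q : quiver) (R : base_ring (edge Q)) (P : poly_functor R).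
Variables (W : finType) (A : {ffun W -> nat}).
Notation x := (pX P).
Notation C := (pC P W).
Notation hh := (bhh R).
Notation th := (bth R).
Implicit Types (e : edge Q) (r s : W).

Lemma wheel_factor_below e r s (c d : nat) : (c < d)%N ->
  wheel_factor P e r s c d =
  x s - x r + C (th e - hh) + C (bhbar R *~ (d%:Z - c%:Z)).
Proof.
move=> cd; rewrite /wheel_factor cd string_diff -addrA [C _ + C _]addrC addrA.
by congr (_ + C _ + _); rewrite mulrC mulrzA.
Qed.

Lemma wheel_factor_above e r s (c d : nat) : (d < c)%N ->
  wheel_factor P e r s c d =
  x s - x r + C (th e + hh) + C (bhbar R *~ (d%:Z - c%:Z)).
Proof.
move=> dc; rewrite /wheel_factor ltnNge ltnW //= dc string_diff -addrA [C _ + C _]addrC addrA.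
by congr (_ + C _ + _); rewrite mulrC mulrzA.
Qed.

(** For each d < A s <= A r there is a factor with c = d, equal to 1. Omitting it and renumbering c
    > d as u = c - 1 moves the argument by hbar, which turns the constant theta_e + hbar/2 into
    theta_e - hbar/2. *)
Lemma wheel_divisor_down e r s : (A s <= A r)%N -> wheel_divisor P A e r s =
  \prod_(u < (A r).-1) \prod_(v < A s)
    (x s - x r + C (th e - hh) + C (bhbar R *~ (v%:Z - u%:Z))).
Proof.
move=> le; rewrite /wheel_divisor -(pair_big predT predT
  (fun (c : 'I_(A r)) (d : 'I_(A s)) => wheel_factor P e r s c d)) /=.
rewrite exchange_big [RHS]exchange_big; apply: eq_bigr => d _ /=.
have dr : (d < A r)%N by apply: leq_trans le.
rewrite (bigD1_ord (Ordinal dr)) //= wheel_factor_eq mul1r; apply: eq_bigr => u _.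
rewrite /bump; case: leqP => du; last exact: wheel_factor_below.
rewrite add1n wheel_factor_above; last by lia.
rewrite -!addrA; congr (_ + (_ + _)); rewrite -!rmorphD; congr (C _).
have -> : d%:Z - u.+1%:Z = (d%:Z - u%:Z) - 1 by lia.
rewrite (mulrzBr _ _ 1) mulr1z; move: (_ *~ _) => y; rewrite /bhbar; ring.
Qed.

Lemma wheel_divisor_up e r s : (A r <= A s)%N -> wheel_divisor P A e r s =
  \prod_(u < A r) \prod_(v < (A s).-1)
    (x s - x r + C (th e + hh) + C (bhbar R *~ (v%:Z - u%:Z))).
Proof.
move=> le; rewrite /wheel_divisor -(pair_big predT predT
  (fun (c : 'I_(A r)) (d : 'I_(A s)) => wheel_factor P e r s c d)) /=.
apply: eq_bigr => c _ /=.
have cs : (c < A s)%N by apply: leq_trans le.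
rewrite (bigD1_ord (Ordinal cs)) //= wheel_factor_eq mul1r; apply: eq_bigr => v _.
rewrite /bump; case: leqP => cv; last exact: wheel_factor_above.
rewrite add1n wheel_factor_below; last by lia.
rewrite -!addrA; congr (_ + (_ + _)); rewrite -!rmorphD; congr (C _).
have -> : v.+1%:Z - c%:Z = (v%:Z - c%:Z) + 1 by lia.
rewrite (mulrzDr _ _ 1) mulr1z; move: (_ *~ _) => y; rewrite /bhbar; ring.
Qed.

End WheelUpdown.

Section Transfer.
Variables (Q : quiver) (R : base_ring (edge Q)) (P : poly_functor R).
Variables (V : finType) (Z : choiceType) (col : V -> vertex Q) (colZ : Z -> vertex Q).
Variables (phi : V -> Z).
Hypotheses (phiI : injective phi) (phi_col : forall p, colZ (phi p) = col p).
Notation image := [fset phi p | p in @full V]%fset.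
Notation transfer := (pS P (fun p => pX P (phi p))).

Lemma word_comb_poly_map (T : word_comb R) :
  transfer (word_comb_poly (pC P V) col (pX P) T full) =
  word_comb_poly (pC P Z) colZ (pX P) T image.
Proof.
rewrite rmorph_sum; apply: eq_bigr => t _; rewrite rmorphM pSC; congr (_ * _).
apply: word_poly_map => [r|p q _ _|p _|p _]; [exact: pSC | exact: phiI | exact: phi_col |].
exact: pSX.
Qed.

Lemma discriminant_map :
  transfer (discriminant P col) = set_discriminant colZ (pX P) image.
Proof.
rewrite /set_discriminant big_imfset /=; last by move=> p q _ _; exact: phiI.
have fullE (F : V -> P Z) : \prod_(p <- full) F p = \prod_p F p.
  by apply: perm_big; apply: uniq_perm => [||p]; rewrite ?fset_uniq ?index_enum_uniq //
    mem_index_enum !inE.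
rewrite fullE rmorph_prod; apply: eq_bigr => p _.
rewrite [RHS]big_mkcond big_imfset /=; last by move=> p' q _ _; exact: phiI.
rewrite fullE rmorph_prod -big_mkcond; apply: eq_big => q.
  by rewrite (inj_eq phiI) !phi_col.
by rewrite rmorphB !pSX.
Qed.

End Transfer.

Section SetWordCombinations.
Variables (Q : quiver) (R : base_ring (edge Q)).
Variables (B : comNzRingType) (c : {rmorphism R -> B}).
Variables (Z : choiceType) (col : Z -> vertex Q) (x : Z -> B).
Variables (L : comPzRingType) (iota : {rmorphism B -> L}) (z : Z -> Z -> L).
Hypothesis zE : forall p q, p != q -> iota (if col p == col q then x p - x q else 1) * z p q
  = iota (root_factor c col x p q * edge_factor c col x p q).

Lemma word_poly_comb0 n (T : word_comb R) (Y : {fset Z}) i : homogeneous_comb n T ->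
  count (fun p => col p == i) Y != n i -> word_comb_poly c col x T Y = 0.
Proof.
move=> /allP hT ne; rewrite /word_comb_poly big_seq big1 // => t /hT /eqP e.
by rewrite (@word_poly_content _ _ _ _ _ _ _ _ _ i) ?mulr0 // e.
Qed.

Lemma word_comb_funE (T : word_comb R) (Y : {fset Z}) :
  iota (set_discriminant col x Y) *
  (\sum_(t <- T) setfun_const z (iota (c t.1)) * word_fun col x iota z t.2) Y
  = iota (word_comb_poly c col x T Y).
Proof.
elim: T => [|t T IH]; first by rewrite /word_comb_poly !big_nil rmorph0 mulr0.
rewrite big_cons [X in _ * X]setfunD mulrDr IH /word_comb_poly big_cons rmorphD; congr (_ + _).
rewrite [X in _ * X](@setfun_constl _ _ z) mulrCA (word_funE zE).
by rewrite rmorphM.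
Qed.

End SetWordCombinations.

(** * Variables indexed by color and number *)

Section IndexedVariables.
Variables (Q : quiver) (n : {ffun vertex Q -> nat}).
Notation I := (vertex Q).
Implicit Types (i : I) (p q : widx n).

Lemma mkidxK p : mkidx (tagged p) = p.
Proof. by case: p. Qed.

Lemma mkidx_inj i : injective (@mkidx Q n i).
Proof. by move=> r s /eqP; rewrite eq_Tagged => /eqP. Qed.

Lemma big_widx (M : Type) (u : M) (op : Monoid.com_law u) i (F : widx n -> M) :
  \big[op/u]_(p | tag p == i) F p = \big[op/u]_(r < n i) F (mkidx r).
Proof.
rewrite big_mkcond /=.
rewrite (eq_bigr (fun p => if tag p == i then F (mkidx (tagged p)) else u)); last first.
  by move=> p _; rewrite mkidxK.
rewrite -(sig_big_dep predT (fun _ _ => true)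
  (fun j (r : 'I_(n j)) => if j == i then F (mkidx r) else u)) /=.
rewrite (bigD1 i) //= [X in op _ X]big1 ?Monoid.mulm1; first by rewrite eqxx.
by move=> j /negbTE ji; rewrite big1 // => r _; rewrite ji.
Qed.

Lemma card_widx i : #|[pred p : widx n | tag p == i]| = n i.
Proof. by rewrite -sum1_card big_widx sum1_card card_ord. Qed.

Lemma colors_widx : colors (fun p : widx n => tag p) = n.
Proof. by apply/ffunP => i; rewrite ffunE card_widx. Qed.

Lemma color_perm_blocks (t : {perm widx n}) : color_perm (fun p => tag p) t ->
  exists s : forall i, 'S_(n i), forall p, t p = Sv_act s p.
Proof.
move=> /color_permP ct.
have blk i : exists s : 'S_(n i), forall r, t (mkidx r) = mkidx (s r).
  have /fin_all_exists[f hf] : forall r : 'I_(n i), exists r' : 'I_(n i), t (mkidx r) = mkidx r'.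
    move=> r; have := ct (mkidx r); case: (t _) => j r' /= e; move: r'; rewrite e => r'.
    by exists r'.
  have fI : injective f.
    by move=> r r' e; have := hf r; rewrite e -hf => /perm_inj /mkidx_inj.
  by exists (perm fI) => r; rewrite permE.
have [s hs] := fin_all_exists blk.
by exists s => p; rewrite -[in LHS](mkidxK p) hs.
Qed.

Variable v : {ffun I -> nat}.
Variable A : forall i, 'I_(v i) -> nat.
Hypothesis An : forall i, (\sum_(r < v i) A r)%N = n i.

(** The cells in the order in which [strings] lists their values. *)
Definition string_positions i : seq (widx v * nat) :=
  flatten [seq [seq (mkidx r, c) | c <- iota 0 (A r)] | r <- enum 'I_(v i)].

Lemma size_string_positions i : size (string_positions i) = n i.
Proof.
rewrite size_flatten /shape -map_comp sumnE big_map big_enum -An.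
by apply: eq_bigr => r _; rewrite /= size_map size_iota.
Qed.

Lemma mem_string_positions i (rc : widx v * nat) :
  (rc \in string_positions i) = (tag rc.1 == i) && (rc.2 < A (tagged rc.1))%N.
Proof.
case: rc => [[j r] c] /=; apply/flatten_mapP/andP => /= [[r' _ /mapP[c' c'r']]|].
  move=> E; have e1 := congr1 fst E; have /= -> := congr1 snd E.
  have /= eji := congr1 tag e1; subst j; move: e1 => /eqP; rewrite /= eq_Tagged => /eqP /= ->.
  by move: c'r'; rewrite mem_iota eqxx.
case=> /eqP e; move: r; rewrite e => r cr; exists r; first by rewrite mem_enum.
by apply/mapP; exists c; rewrite ?mem_iota.
Qed.

Lemma uniq_string_positions i : uniq (string_positions i).
Proof.
rewrite /string_positions; have := enum_uniq 'I_(v i); elim: (enum _) => //= r l IH.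
move=> /andP[rl ul]; rewrite cat_uniq IH // andbT map_inj_uniq ?iota_uniq //=; last first.
  by move=> c c' [].
apply/hasPn => rc /flatten_mapP[r' r'l /mapP[c _ ->]]; apply/mapP => -[c' _ [/eqP]].
by rewrite eq_Tagged => /eqP /= e; rewrite -e r'l in rl.
Qed.

Lemma string_placement : exists2 b : widx n -> widx v * nat,
  placement (fun p : widx n => tag p) (fun r : widx v => tag r)
    [ffun r => A (tagged r)] b &
  forall p d, nth d (string_positions (tag p)) (tagged p) = b p.
Proof.
have lt p : (tagged p < size (string_positions (tag p)))%N.
  by rewrite size_string_positions ltn_ord.
have /fin_all_exists[b hb] : forall p, exists rc,
    forall d, nth d (string_positions (tag p)) (tagged p) = rc.
  move=> p; have := lt p; case: string_positions => // rc0 l l0.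
  by exists (nth rc0 (rc0 :: l) (tagged p)) => d; exact: set_nth_default.
have bmem p : b p \in string_positions (tag p).
  by rewrite -(hb p (b p)) mem_nth.
have bP p := esym (mem_string_positions (tag p) (b p)).
exists b => //; split=> [p q e|p|p|r c].
- have := bP p; have := bP q; rewrite !bmem => /andP[/eqP tq _] /andP[/eqP tp _].
  have tpq : tag p = tag q by rewrite -tp -tq e.
  move: (hb p (b p)) (hb q (b p)); rewrite -{}e => hp hq; rewrite -(mkidxK p) -(mkidxK q).
  case: p q tpq hp hq {tp tq} => [i r] [j s] /= eij; move: s; rewrite -eij => s hp hq.
  congr mkidx; apply: val_inj => /=; apply/eqP.
  rewrite -(nth_uniq (b (existT (fun i => 'I_(n i)) i r)) _ _ (uniq_string_positions i)) ?size_string_positions ?ltn_ord //.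
  by rewrite hp hq.
- by have := bP p; rewrite bmem => /andP[/eqP].
- by have := bP p; rewrite bmem ffunE => /andP[_ ].
- rewrite ffunE => cr.
  have rcm : (r, c) \in string_positions (tag r) by rewrite mem_string_positions eqxx.
  have lt' : (index (r, c) (string_positions (tag r)) < n (tag r))%N.
    by rewrite -size_string_positions index_mem.
  exists (mkidx (Ordinal lt')); rewrite -(hb _ (r, c)) /=.
  exact: nth_index.
Qed.

End IndexedVariables.

Lemma pSXn (R : comNzRingType) (P : poly_functor R) (V W : choiceType) (s : V -> P W) x d :
  pS P s (pX P x ^+ d) = s x ^+ d.
Proof. by rewrite rmorphXn pSX. Qed.

Lemma zeta_numE (Q : quiver) (R : base_ring (edge Q)) (B : comNzRingType)
    (c : {rmorphism R -> B}) (Z : choiceType) (col : Z -> vertex Q) (x : Z -> B) p q :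
  (if col p == col q then x p - x q - c (bhbar R) else 1)
  * \prod_(e | (src e == col p) && (tgt e == col q)) (- (x p - x q) + c (bth R e - bhh R))
  * \prod_(e | (src e == col q) && (tgt e == col p)) (x p - x q + c (bth R e + bhh R))
  = root_factor c col x p q * edge_factor c col x p q.
Proof.
rewrite /root_factor /edge_factor mulrA; congr (_ * _ * _).
by apply: eq_bigr => e _; rewrite opprB.
Qed.

Section ShuffleElements.
Variables (k : comNzRingType) (rat_in_k : {rmorphism rat -> k}) (Q : quiver).
Notation I := (vertex Q).
Notation R := (quiver_base rat_in_k Q).
Notation P := (mvpoly_functor R).
Notation dimvec := {ffun I -> nat}.
Implicit Types (n v : dimvec).
Notation color := (fun p : widx _ => tag p).

Lemma symmetric_poly_color n (f : @Lam k Q n) : symmetric_poly f ->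
  @color_symmetric Q R P (widx n) color f.
Proof.
move=> sf t /color_perm_blocks[s ts]; rewrite -[RHS](sf s).
by apply: (@eq_pS _ P) => p; rewrite ts.
Qed.

Lemma strings_map v (A : forall i, 'I_(v i) -> nat) i :
  strings k A i = [seq string_val (R := R) P rc.1 rc.2 | rc <- string_positions A i].
Proof.
rewrite /strings /string_positions map_flatten -map_comp; congr flatten.
by apply: eq_map => r /=; rewrite -map_comp; apply: eq_map.
Qed.

Lemma wheel_conditions_placement n (f : @Lam k Q n) : symmetric_poly f ->
  wheel_conditions f -> @wheel_condition Q R P (widx n) (widx n) color color f.
Proof.
move=> sf wf A b pb e r s rs cr cs.
pose A' i (r : 'I_(n i)) := A (mkidx r).
have An i : (\sum_(r < n i) A' i r)%N = n i.
  by rewrite -[in RHS](card_widx n i) (card_placement _ pb) big_widx.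
have [b0 pb0 hb0] := string_placement An.
have eA : [ffun r => A' (tag r) (tagged r)] = A.
  by apply/ffunP => r'; rewrite ffunE /A' mkidxK.
rewrite eA in pb0.
have [t ct et] := placement_perm pb0 pb.
have ef : place_subst P b f = evaluate (strings k A') f.
  rewrite (eq_place_subst _ et) -place_subst_act (symmetric_poly_color sf) //.
  apply: (@eq_pS _ P) => p; rewrite strings_map.
  rewrite (nth_map (b0 p)); first by rewrite hb0.
  by rewrite (size_string_positions An).
rewrite {}ef; case: r s cr cs rs => [i r] [j s] /= cr cs _; subst i j.
have [down up] := wf n A' An e r s.
have [le|le] := leqP (A (mkidx s)) (A (mkidx r)).
  by rewrite wheel_divisor_down //; exact: down.
by rewrite wheel_divisor_up; [apply: up; exact: ltnW | exact: ltnW].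
Qed.

Lemma low_degree_wheel_conditions n (f : @Lam k Q n) :
  (forall i, (n i <= 1)%N) -> wheel_conditions f.
Proof.
move=> n1 v A An e r s.
have le i (t : 'I_(v i)) : (A i t <= 1)%N.
  by apply: leq_trans (n1 i); rewrite -An (bigD1 t) //= leq_addr.
by split=> _; rewrite /updown;
  [have -> : (A (src e) r).-1 = 0%N by have := le _ r; lia
  |have -> : (A (tgt e) s).-1 = 0%N by have := le _ s; lia]; [|rewrite exchange_big];
  rewrite /= big_ord0; exists (evaluate (strings k A) f); rewrite mulr1.
Qed.

Lemma Shuffle_const (r : baseR k Q) : Shuffle 0 (Sconst r).
Proof.
exists (pconst _ r); split.
- by move=> s; exact: psubst_const.
- by apply: low_degree_wheel_conditions => i; rewrite ffunE.
apply: functional_extensionality_dep => Y.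
have eY : has_color_type 0 Y = (Y == fset0).
  apply/forallP/eqP => [H|-> i]; last by rewrite ffunE.
  apply/fsetP => p; rewrite inE; apply/negP => pY.
  have := H p.1; rewrite ffunE -leqn0 leqNgt -has_count => /hasPn /(_ p pY).
  by rewrite eqxx.
rewrite /Sembed /Sconst /setfun_const eY; case: ifP => // _.
by rewrite /evaluate psubst_const.
Qed.

Lemma simple_rootE i : @simple_root Q i i = 1%N.
Proof. by rewrite ffunE eqxx. Qed.

Definition simple_idx i : widx (@simple_root Q i) :=
  mkidx (cast_ord (esym (simple_rootE i)) ord0).

Lemma simple_idx_eq i (p : widx (@simple_root Q i)) : p = simple_idx i.
Proof.
case: p => j r; have e : (simple_root i j <= (i == j))%N by rewrite ffunE.
have := leq_trans (ltn_ord r) e; case: eqVneq => //= eij; subst j => r1.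
by congr mkidx; apply: val_inj; move: r1; rewrite ltnS leqn0 => /eqP.
Qed.

Definition letter_poly (l : I * nat) : @Lam k Q (simple_root l.1) :=
  pvar _ (simple_idx l.1) ^+ l.2.

Definition Sletter (l : I * nat) : Sambient k Q := Sembed (letter_poly l).

Lemma letter_poly_symmetric l : symmetric_poly (letter_poly l).
Proof.
move=> s; rewrite [LHS](@pSXn _ P).
rewrite (simple_idx_eq (Sv_act s (simple_idx l.1))); exact: erefl.
Qed.

Lemma Shuffle_letter l : Shuffle (simple_root l.1) (Sletter l).
Proof.
exists (letter_poly l); split=> //; first exact: letter_poly_symmetric.
by apply: low_degree_wheel_conditions => j; rewrite ffunE; case: eqP.
Qed.

Notation iota := (@loc_in _ (generated_mulset (@xset k Q))).
Notation xcol := (fun p : Xidx Q => p.1).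
Notation Sword := (word_fun xcol (@pX _ P (Xidx Q)) iota (@zeta_var k Q)).

Lemma zeta_varE (p q : Xidx Q) : p != q ->
  iota (if p.1 == q.1 then pX P p - pX P q else 1) * zeta_var k p q =
  iota (root_factor (pC P _) xcol (pX P) p q * edge_factor (pC P _) xcol (pX P) p q).
Proof.
case: p q => [i a] [j b] pq; rewrite -zeta_numE; apply: loc_inM => /=.
case: (eqVneq i j) pq => [<-|_ _]; last exact: mulset_gen1.
by move=> ab; apply: zeta_den_mulset; apply: contraNneq ab => ->.
Qed.

Section SortedVariables.
Variables (n : dimvec) (Y : {fset Xidx Q}).
Hypothesis nY : has_color_type n Y.

Definition sorted_indices (i : I) : seq nat :=
  sort leq [seq p.2 | p : Xidx Q <- Y & p.1 == i].

Lemma size_sorted_indices i : size (sorted_indices i) = n i.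
Proof. by rewrite size_sort size_map size_filter; have /forallP/(_ i)/eqP := nY. Qed.

Lemma mem_sorted_indices i a : (a \in sorted_indices i) = ((i, a) \in Y).
Proof.
rewrite mem_sort; apply/mapP/idP => [[[j b]]|ia].
  by rewrite mem_filter => /andP[/eqP /= <- jb] ->.
by exists (i, a); rewrite // mem_filter eqxx.
Qed.

Lemma uniq_sorted_indices i : uniq (sorted_indices i).
Proof.
rewrite sort_uniq map_inj_in_uniq; first by rewrite filter_uniq ?fset_uniq.
move=> [j a] [j' a']; rewrite !mem_filter => /andP[/eqP /= -> _] /andP[/eqP /= -> _].
by move=> ->.
Qed.

Definition sorted_variable (p : widx n) : Xidx Q :=
  (tag p, nth 0%N (sorted_indices (tag p)) (tagged p)).

Lemma sorted_variable_inj : injective sorted_variable.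
Proof.
move=> [i r] [j s] /= e; have /= eij := congr1 fst e; subst j.
have /= /eqP := congr1 snd e.
rewrite nth_uniq ?uniq_sorted_indices ?size_sorted_indices ?ltn_ord // => /eqP rs.
by congr mkidx; exact: val_inj.
Qed.

Lemma sorted_variable_image : [fset sorted_variable p | p in @full (widx n)]%fset = Y.
Proof.
apply/fsetP => -[i a]; apply/imfsetP/idP => /= [[[j r] _ [-> ->]]|ia].
  by rewrite -mem_sorted_indices mem_nth // size_sorted_indices ltn_ord.
have lt : (index a (sorted_indices i) < n i)%N.
  by rewrite -size_sorted_indices index_mem mem_sorted_indices.
exists (mkidx (Ordinal lt)); first by rewrite !inE.
by rewrite /sorted_variable /= nth_index // mem_sorted_indices.
Qed.

Lemma evaluate_sorted (f : @Lam k Q n) :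
  evaluate (color_vars k Y) f = pS P (fun p => pX P (sorted_variable p)) f.
Proof.
apply: (@eq_pS _ P) => p; rewrite /color_vars (nth_map 0%N) //.
by rewrite -/(sorted_indices _) size_sorted_indices.
Qed.

End SortedVariables.

Lemma has_color_type1 (p : Xidx Q) : has_color_type (simple_root p.1) [fset p]%fset.
Proof.
apply/forallP => i; have /seq.permP -> : perm_eq [fset p]%fset [:: p].
  by apply: uniq_perm; rewrite ?fset_uniq // => q; rewrite !inE.
by rewrite /= addn0 ffunE.
Qed.

Lemma has_color_type_simple (Y : {fset Xidx Q}) i (nY : has_color_type (simple_root i) Y) :
  Y = [fset sorted_variable (n := simple_root i) Y (simple_idx i)]%fset.
Proof.
rewrite -{1}(sorted_variable_image nY); apply/fsetP => q; rewrite inE.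
apply/imfsetP/eqP => [[p _ ->]|->]; first by rewrite (simple_idx_eq p).
by exists (simple_idx i); rewrite ?inE.
Qed.

Lemma Sletter_fun l : Sletter l = letter_fun xcol (@pX _ P (Xidx Q)) iota (@zeta_var k Q) l.
Proof.
apply: functional_extensionality_dep => Y; rewrite /Sletter /Sembed /letter_fun.
case: ifP => [nY|nY]; last first.
  rewrite big1_seq // => p /andP[/andP[/eqP cp /eqP eY] _]; case/negP: nY.
  by rewrite eY -cp has_color_type1.
have eY := has_color_type_simple nY; set p := sorted_variable _ _ in eY.
have -> : \sum_(q <- Y | (q.1 == l.1) && (Y == [fset q]%fset))
    iota (pX P q ^+ l.2) = iota (pX P p ^+ l.2).
  rewrite {1}eY big_mkcond big_seq_fset1 -eY eqxx.
  by rewrite [p.1]/(l.1) eqxx.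
congr (frac _ _ 1); rewrite (evaluate_sorted nY); exact: (@pSXn _ P).
Qed.

Lemma iota_discriminant (Y : {fset Xidx Q}) :
  generated_mulset (@xset k Q) (set_discriminant xcol (@pX _ P (Xidx Q)) Y).
Proof.
have gm := @cmsM _ (generated_mulset (@xset k Q)).
have g1 := cms1 (generated_mulset (@xset k Q)).
apply: (big_ind (generated_mulset (@xset k Q)) g1 gm) => -[i a] _.
apply: (big_ind (generated_mulset (@xset k Q)) g1 gm) => -[j b] /= /andP[ne /eqP eij].
subst j; apply: zeta_den_mulset; apply: contraNneq ne => ->; exact: eqxx.
Qed.

Lemma Shuffle_word_comb n x : Shuffle n x -> exists2 r : R, GRing.lreg r &
  exists T : word_comb R, Sconst r * x = word_comb_el (R := R) (@Sconst k Q) Sletter T.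
Proof.
move=> [f [sf wf ->]].
have [r lr [T hT eT]] := symmetric_generated (symmetric_poly_color sf)
  (wheel_conditions_placement sf wf).
rewrite colors_widx in hT.
exists r => //; exists T; apply: functional_extensionality_dep => Y.
apply: (loc_in_cancel (iota_discriminant Y)).
have -> : word_comb_el (R := R) (@Sconst k Q) Sletter T =
    \sum_(t <- T) setfun_const (@zeta_var k Q) (iota (pC P _ t.1)) * Sword t.2.
  apply: eq_bigr => t _; congr (_ * _); apply: eq_bigr => l _; exact: Sletter_fun.
rewrite [RHS](word_comb_funE zeta_varE) [X in _ * X = _]setfun_constl.
(* On a set of color type n the identity is transported along the sorted variables; on other sets
   both sides vanish, the words by their content. *)
rewrite /Sembed; case: ifP => [nY|/negbT].
  rewrite (evaluate_sorted nY) -/(iota _).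
  have phiI := sorted_variable_inj nY.
  have im := sorted_variable_image nY.
  have := congr1 (pS P (fun p => pX P (sorted_variable (n := n) Y p))) eT.
  have -> := @word_comb_poly_map _ R P _ _ _ xcol _ phiI (fun _ => erefl) T.
  rewrite im => <-.
  rewrite (rmorphM (pS P _)) (rmorphM (pS P _)) pSC.
  rewrite (@discriminant_map _ R P _ _ color xcol _ phiI (fun _ => erefl)) im.
  rewrite !rmorphM; exact: mulrCA.
rewrite negb_forall => /existsP[i ni].
have -> := @word_poly_comb0 _ R _ (pC P _) _ xcol (@pX _ P _) n T Y i hT ni.
by rewrite rmorph0 !mulr0.
Qed.

Lemma Shuffle_loc_spherically_generated : spherically_generated (@Shuffle_loc k Q).
Proof.
apply: (@localized_spherically_generated Q R _ _ (@Sconst_monoid_morphism k Q) (@Sconst_central k Q)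
  (@Shuffle k Q) Sletter).
- exact: Shuffle_const.
- by move=> i d; exact: (Shuffle_letter (i, d)).
- exact: Shuffle_word_comb.
Qed.

End ShuffleElements.

(** * Coefficients of words of difference operators *)

Section StringSets.
Variables (Q : quiver) (R : base_ring (edge Q)) (P : poly_functor R).
Variables (W : finType) (col : W -> vertex Q).
Notation x := (pX P).
Notation C := (pC P W).
Notation hh := (bhh R).
Notation th := (bth R).
Implicit Types (A B : {ffun W -> nat}) (p q r : W) (z : W * nat).

Definition cells A : {fset W * nat} :=
  [fset z in [seq (p, c) | p <- enum W, c <- iota 0 (A p)]]%fset.

Lemma in_cells A z : (z \in cells A) = (z.2 < A z.1)%N.
Proof.
rewrite !inE; apply/allpairsPdep/idP => [[p [c [_ + ->]]]|]; first by rewrite mem_iota.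
by case: z => p c cp; exists p, c; rewrite mem_enum mem_iota.
Qed.

Definition unit_vec p : {ffun W -> nat} := [ffun q => (q == p) : nat].

Lemma add_unitE A p q : (A + unit_vec p) q = (A q + (q == p))%N.
Proof. by rewrite ffunE [unit_vec p q]ffunE. Qed.

Definition cell_shift p z : W * nat := (z.1, z.2 + (z.1 == p))%N.

Definition cell_val z : P W := string_val P z.1 z.2.

Definition cell_col z := col z.1.

Definition var_shift p : {rmorphism P W -> P W} :=
  pS P (fun q => x q + C (bhbar R *+ unit_vec p q)).

Lemma var_shiftX p q : var_shift p (x q) = x q + C (bhbar R *+ (q == p)).
Proof. by rewrite pSX ffunE. Qed.

Lemma var_shiftC p c : var_shift p (C c) = C c.
Proof. exact: pSC. Qed.

Lemma var_shift_val p z : var_shift p (cell_val z) = cell_val (cell_shift p z).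
Proof.
rewrite rmorphD var_shiftX var_shiftC /cell_val /string_val /= addnC mulrnDr rmorphD.
by rewrite addrA.
Qed.

Lemma cell_shift_inj p : injective (cell_shift p).
Proof. by move=> [q c] [q' c'] [-> /addIn ->]. Qed.

Lemma cell_shift_neq0 p z s : (cell_shift p z == (s, 0%N)) = (s != p) && (z == (s, 0%N)).
Proof.
case: z => q c; rewrite /cell_shift !xpair_eqE addn_eq0 /=.
by case: eqVneq => [->|] /=; case: (eqVneq s p); rewrite ?andbF ?andbT.
Qed.

Lemma cells_shift A p :
  (cells (A + unit_vec p)%R `\ (p, 0%N))%fset = [fset cell_shift p z | z in cells A]%fset.
Proof.
apply/fsetP => -[q c]; rewrite in_fsetD1 in_cells add_unitE /=.
apply/andP/imfsetP => [[z0 cA]|[[q' c'] zA [-> ->]]].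
  have le : ((q == p) <= c)%N.
    by move: z0; rewrite xpair_eqE; case: (q == p); case: (c).
  exists (q, (c - (q == p))%N); first by rewrite in_cells /= ltn_subLR // addnC.
  by rewrite /cell_shift /= subnK.
rewrite /= in_cells in zA; rewrite xpair_eqE addn_eq0 ltn_add2r; split=> //.
by case: (q' == p); rewrite ?andbF.
Qed.

Lemma in_cells0 A p : ((p, 0%N) \in cells (A + unit_vec p)).
Proof. by rewrite in_cells add_unitE eqxx addn1. Qed.

Lemma big_cells (M : Type) (u : M) (op : Monoid.com_law u) A p (F : W * nat -> M) :
  \big[op/u]_(z <- cells (A + unit_vec p)) F z =
  op (F (p, 0%N)) (\big[op/u]_(z <- cells A) F (cell_shift p z)).
Proof.
rewrite (big_fsetD1 (p, 0%N)) ?in_cells0 //= cells_shift big_imfset //= => z z' _ _.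
exact: cell_shift_inj.
Qed.

Definition Nf z s : P W :=
  \prod_(e | (src e == cell_col z) && (tgt e == col s)) (x s - cell_val z + C (th e - hh)).

Definition Qf z z' : P W :=
  \prod_(e | (src e == cell_col z) && (tgt e == cell_col z'))
     (cell_val z' - cell_val z + C (th e - hh)).

Definition Pf z s : P W :=
  if (cell_col z == col s) && (z != (s, 0%N)) then cell_val z - x s else 1.

Definition Sf z z' : P W :=
  if [&& cell_col z == cell_col z', z != z' & z != (z'.1, z'.2.+1)]
  then cell_val z - cell_val z' - C (bhbar R) else 1.

(** The fraction [coef_num A / coef_den A] relates the coefficient of u^A in a word of operators to
    the word polynomial at the cells of A ([coef_word]), and depends on A alone. The exclusions z =
    (s, 0) in [Pf] and z = (z'.1, z'.2 + 1) in [Sf] remove factors that are 0. *)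
Definition coef_num A : P W := \prod_(z <- cells A) \prod_s Nf z s.

Definition coef_den A : P W :=
  (\prod_(z <- cells A) \prod_(z' <- cells A) Qf z z')
  * (\prod_(z <- cells A) \prod_s Pf z s)
  * (\prod_(z <- cells A) \prod_(z' <- cells A) Sf z z').

Lemma cell_val0 s : cell_val (s, 0%N) = x s.
Proof. by rewrite /cell_val /string_val rmorph0 addr0. Qed.

Lemma prod_cells2 A p (F : W * nat -> W * nat -> P W) :
  \prod_(z <- cells (A + unit_vec p)) \prod_(z' <- cells (A + unit_vec p)) F z z' =
  F (p, 0%N) (p, 0%N) * (\prod_(z <- cells A) F (p, 0%N) (cell_shift p z))
  * (\prod_(z <- cells A) F (cell_shift p z) (p, 0%N))
  * \prod_(z <- cells A) \prod_(z' <- cells A) F (cell_shift p z) (cell_shift p z').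
Proof.
rewrite big_cells big_cells -[RHS]mulrA; congr (_ * _); rewrite -big_split /=.
by apply: eq_bigr => z _; rewrite big_cells.
Qed.

(* One more letter: the coefficient of u_p times the coefficient at A, the latter
   shifted by u_p, is a coefficient at A + p. *)
Lemma coef_step A p :
  coef_den (A + unit_vec p) * (\prod_(s | s != p) Nf (p, 0%N) s) * var_shift p (coef_num A)
  = coef_num (A + unit_vec p)
    * (\prod_(z <- cells A) word_factor C cell_col cell_val (p, 0%N) (cell_shift p z))
    * (\prod_(s | s != p) Pf (p, 0%N) s) * var_shift p (coef_den A).
Proof.
set z0 := (p, 0%N); set t := cell_shift p; set phi := var_shift p.
have phiN z s : s != p -> phi (Nf z s) = Nf (t z) s.
  move=> /negbTE sp; rewrite rmorph_prod; apply: eq_bigr => e _.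
  by rewrite rmorphD rmorphB var_shift_val var_shiftC var_shiftX sp rmorph0 addr0.
have phiQ z z' : phi (Qf z z') = Qf (t z) (t z').
  rewrite rmorph_prod; apply: eq_bigr => e _.
  by rewrite rmorphD rmorphB !var_shift_val var_shiftC.
have phiP z s : s != p -> phi (Pf z s) = Pf (t z) s.
  move=> sp; rewrite /Pf cell_shift_neq0 sp /=; case: ifP => _; last exact: rmorph1.
  by rewrite rmorphB var_shift_val var_shiftX (negbTE sp) rmorph0 addr0.
have phiS z z' : phi (Sf z z') = Sf (t z) (t z').
  rewrite /Sf (inj_eq (@cell_shift_inj p)).
  have -> : (t z == ((t z').1, (t z').2.+1)) = (z == (z'.1, z'.2.+1)).
    by rewrite -(inj_eq (@cell_shift_inj p) z).
  by case: ifP => _; rewrite ?rmorph1 // !rmorphB !var_shift_val var_shiftC.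
pose E1 z := \prod_(e | (src e == col p) && (tgt e == cell_col z)) (cell_val (t z) - x p + C (th e - hh)).
pose E2 z := \prod_(e | (src e == cell_col z) && (tgt e == col p)) (x p - cell_val (t z) + C (th e + hh)).
have wf z : word_factor C cell_col cell_val z0 (t z) =
    Sf z0 (t z) * (E1 z * E2 z) * Pf (t z) p.
  rewrite /word_factor; congr (_ * _ * _).
  - rewrite /root_factor /Sf; case: ifP => //= _.
    have -> : z0 != t z by rewrite eq_sym cell_shift_neq0 eqxx.
    by rewrite xpair_eqE andbF.
  - rewrite /edge_factor cell_val0; congr (_ * _).
  - by rewrite /diff_factor /Pf cell_shift_neq0 eqxx /= andbT cell_val0 eq_sym.
have phiNp z : phi (Nf z p) = E2 z.
  rewrite rmorph_prod; apply: eq_bigr => e _.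
  rewrite rmorphD rmorphB var_shift_val var_shiftC var_shiftX eqxx !rmorphD rmorphN.
  by rewrite /t; ring.
have Q1 z : Qf z0 (t z) = E1 z by rewrite /Qf cell_val0.
have Q2 z : Qf (t z) z0 = Nf (t z) p by rewrite /Qf cell_val0.
have Q0 : Qf z0 z0 = Nf z0 p by rewrite /Qf /Nf cell_val0.
have S0 : Sf z0 z0 = 1 by rewrite /Sf [z0 == z0]eqxx andbF.
have P0 : Pf z0 p = 1 by rewrite /Pf [z0 == _]eqxx andbF.
have S1 z : Sf (t z) z0 = phi (Pf z p).
  rewrite /Sf /Pf cell_shift_neq0 eqxx /=.
  have -> : (t z == (p, 1%N)) = (z == z0).
    by rewrite -(inj_eq (@cell_shift_inj p) z) /cell_shift /= eqxx.
  case: ifP => _; last by rewrite rmorph1.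
  by rewrite cell_val0 rmorphB var_shift_val var_shiftX eqxx opprD addrA.
pose a0 := Nf z0 p; pose a1 := \prod_(s | s != p) Nf z0 s.
pose b1 := \prod_(z <- cells A) Nf (t z) p.
pose b2 := \prod_(z <- cells A) \prod_(s | s != p) Nf (t z) s.
pose p0 := \prod_(s | s != p) Pf z0 s; pose p1 := \prod_(z <- cells A) Pf (t z) p.
pose p2 := \prod_(z <- cells A) \prod_(s | s != p) Pf (t z) s.
pose sp := \prod_(z <- cells A) phi (Pf z p).
pose s1 := \prod_(z <- cells A) Sf z0 (t z).
pose e1 := \prod_(z <- cells A) E1 z; pose e2 := \prod_(z <- cells A) E2 z.
pose qq := \prod_(z <- cells A) \prod_(z' <- cells A) Qf (t z) (t z').
pose ss := \prod_(z <- cells A) \prod_(z' <- cells A) Sf (t z) (t z').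
have numA : coef_num (A + unit_vec p) = a0 * a1 * (b1 * b2).
  rewrite /coef_num big_cells (bigD1 p) //= -big_split; congr (_ * _).
  by apply: eq_bigr => z _; rewrite (bigD1 p).
have denA : coef_den (A + unit_vec p) = a0 * e1 * b1 * qq * (p0 * (p1 * p2)) * (s1 * sp * ss).
  rewrite /coef_den !prod_cells2 Q0 S0 mul1r; congr (_ * _ * _ * _ * _ * (_ * _ * _)).
  - by apply: eq_bigr => z _; exact: Q1.
  - by apply: eq_bigr => z _; exact: Q2.
  - rewrite big_cells (bigD1 p) //= P0 mul1r -big_split; congr (_ * _).
    by apply: eq_bigr => z _; rewrite (bigD1 p).
  - by apply: eq_bigr => z _; exact: S1.
have numB : phi (coef_num A) = e2 * b2.
  rewrite rmorph_prod -big_split; apply: eq_bigr => z _.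
  rewrite rmorph_prod (bigD1 p) //= phiNp; congr (_ * _).
  by apply: eq_bigr => s sp'; exact: phiN.
have denB : phi (coef_den A) = qq * (sp * p2) * ss.
  rewrite /coef_den !rmorphM; congr (_ * _ * _); rewrite rmorph_prod.
  - by apply: eq_bigr => z _; rewrite rmorph_prod; apply: eq_bigr => z' _; exact: phiQ.
  - rewrite -big_split; apply: eq_bigr => z _; rewrite rmorph_prod (bigD1 p) //=; congr (_ * _).
    by apply: eq_bigr => s sp'; exact: phiP.
  - by apply: eq_bigr => z _; rewrite rmorph_prod; apply: eq_bigr => z' _; exact: phiS.
have G : \prod_(z <- cells A) word_factor C cell_col cell_val z0 (t z) = s1 * (e1 * e2) * p1.
  by rewrite -!big_split; apply: eq_bigr => z _; exact: wf.
rewrite numA denA numB denB G -/a1 -/p0; ring.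
Qed.

Notation wpoly := (word_poly C cell_col cell_val).

Lemma word_poly_shift A p s : wpoly s [fset cell_shift p z | z in cells A]%fset =
  var_shift p (wpoly s (cells A)).
Proof.
apply/esym/word_poly_map => [r|z z' _ _|//|z _]; first exact: pSC.
  exact: cell_shift_inj.
exact: var_shift_val.
Qed.

Lemma word_factor_pred p c :
  word_factor C cell_col cell_val (p, c.+1) (p, c) = 0.
Proof.
rewrite /word_factor /root_factor eqxx /cell_val string_valS.
by rewrite [X in X * _ * _](_ : _ = 0) ?mul0r //; ring.
Qed.

(** By [word_factor_pred] a cell taken before the one below it gives 0, so the first letter takes
    the bottom of a string. The remaining cells are then a shift by u_p of the cells of a smaller
    type ([cells_shift]), as in a product of operators. *)
Lemma word_poly_cells i d s A : wpoly ((i, d) :: s) (cells A) =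
  \sum_(p | (col p == i) && (0 < A p)%N) x p ^+ d *
    (\prod_(z <- (cells A `\ (p, 0%N))%fset) word_factor C cell_col cell_val (p, 0%N) z)
    * wpoly s (cells A `\ (p, 0%N))%fset.
Proof.
rewrite /word_poly /= (bigID (fun z => z.2 == 0%N)) /= [X in _ + X]big1_seq ?addr0; last first.
  move=> [p [|c]] /= /andP[/andP[_ c0] pc] //.
  have c'A : (p, c) \in (cells A `\ (p, c.+1))%fset.
    rewrite in_fsetD1 xpair_eqE eqxx /= in_cells /=; move: pc; rewrite in_cells /=; lia.
  rewrite (big_fsetD1 _ c'A) /= word_factor_pred.
  by rewrite mul0r mulr0 mul0r.
rewrite -big_filter (perm_big [seq (p, 0%N) | p <- enum W & (col p == i) && (0 < A p)%N]) /=.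
  rewrite big_map big_filter big_enum_cond; apply: eq_bigr => p _.
  by rewrite cell_val0.
apply: uniq_perm; first by rewrite filter_uniq ?fset_uniq.
  by rewrite map_inj_uniq => [|p q []//]; rewrite filter_uniq ?enum_uniq.
move=> [p c]; rewrite mem_filter in_cells /=; apply/idP/mapP => [/andP[/andP[cp /eqP ->] pA]|].
  by exists p; rewrite // mem_filter mem_enum cp pA.
by move=> [q]; rewrite mem_filter => /andP[/andP[cq qA] _] [-> ->]; rewrite /cell_col cq qA.
Qed.

Lemma lreg_cell_form e z z' :
  GRing.lreg (cell_val z' - cell_val z + C (th e - hh)).
Proof.
rewrite /cell_val string_form_minus; have [->|ne] := eqVneq z'.1 z.1.
  by rewrite subrr add0r; apply/lreg_pC/lreg_bth.
by apply: lreg_form; rewrite eq_sym.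
Qed.

Lemma lreg_coef_num A : GRing.lreg (coef_num A).
Proof.
apply: lreg_prod => z _; apply: lreg_prod => s _; apply: lreg_prod => e _.
by rewrite -cell_val0; exact: lreg_cell_form.
Qed.

Lemma lreg_coef_den A : GRing.lreg (coef_den A).
Proof.
do 2?apply: lregM; apply: lreg_prod => z _; apply: lreg_prod => z' _.
- by apply: lreg_prod => e _; exact: lreg_cell_form.
- rewrite /Pf; case: ifP => [/andP[_ ne]|_]; last exact: lreg1.
  rewrite -cell_val0; apply: lreg_string_diff; rewrite -surjective_pairing eq_sym.
  exact: ne.
rewrite /Sf; case: ifP => [/and3P[_ ne ne']|_]; last exact: lreg1.
have -> : cell_val z - cell_val z' - C (bhbar R) =
   cell_val z - cell_val (z'.1, z'.2.+1).
  by rewrite /cell_val /= string_valS; ring.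
by apply: lreg_string_diff; rewrite -surjective_pairing eq_sym.
Qed.

Lemma cells0 : cells 0 = fset0.
Proof. by apply/fsetP => z; rewrite in_cells ffunE. Qed.

Lemma coef_num0 : coef_num 0 = 1.
Proof. by rewrite /coef_num cells0 big_seq_fset0. Qed.

Lemma coef_den0 : coef_den 0 = 1.
Proof. by rewrite /coef_den cells0 !big_seq_fset0 !mulr1. Qed.

End StringSets.

Section SkewCoefficients.
Variables (K : nmodType) (L : comPzRingType) (t : monoid_action K L).
Implicit Types (g : skew t) (k : K) (c : L).

Lemma mcoeff_skewE c k g A :
  ((<< c *g k >> : skew t) * g)@_A = \sum_(k2 <- msupp g) (c * t k (g@_k2)) *+ (k + k2 == A).
Proof.
rewrite [X in X@_A]skew_mulEr raddf_sum; apply: eq_bigr => k2 _.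
by rewrite skew_mulUU /= mcoeffU mulrb.
Qed.

Lemma mcoeff_skewU c k g B : injective (fun k' => k + k') ->
  ((<< c *g k >> : skew t) * g)@_(k + B) = c * t k (g@_B).
Proof.
move=> kI; rewrite mcoeff_skewE; under eq_bigr do rewrite (inj_eq kI).
case: (boolP (B \in msupp g)) => Bg.
  rewrite (bigD1_seq B Bg (fset_uniq _)) /= eqxx big1 ?addr0 // => k2.
  by move/negbTE=> ->.
rewrite mcoeff_outdom // rmorph0 mulr0 big_seq big1 // => k2 k2g; case: eqP => // e.
by rewrite -e k2g in Bg.
Qed.

Lemma mcoeff_skewU0 c k g A : (forall B, k + B != A) ->
  ((<< c *g k >> : skew t) * g)@_A = 0.
Proof. by move=> kA; rewrite mcoeff_skewE big1 // => k2 _; rewrite (negbTE (kA k2)). Qed.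

Lemma mcoeff_skewC c g A : ((<< c *g 0 >> : skew t) * g)@_A = c * g@_A.
Proof.
rewrite -[in LHS](add0r A) mcoeff_skewU ?act0 // => k k'.
by rewrite !add0r.
Qed.

End SkewCoefficients.

(** The shift is an automorphism, with inverse [psi]. *)
Lemma lreg_var_shift (Q : quiver) (R : base_ring (edge Q)) (P : poly_functor R)
    (W : finType) (p : W) (f : P W) : GRing.lreg f -> GRing.lreg (var_shift P p f).
Proof.
pose h q : R := bhbar R *+ unit_vec p q; pose psi := pS P (fun q : W => pX P q - pC P W (h q)).
have psiK g : psi (var_shift P p g) = g.
  rewrite [LHS]pS_comp -[RHS]pS_id; apply: eq_pS => q.
  by rewrite rmorphD pSX pSC subrK.
have shK g : var_shift P p (psi g) = g.
  rewrite [LHS]pS_comp -[RHS]pS_id; apply: eq_pS => q.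
  by rewrite rmorphB pSX pSC addrK.
move=> /lreg0 lf; apply/lreg0 => g e; rewrite -(shK g); apply/eqP.
rewrite (_ : psi g = 0) ?rmorph0 //; apply: lf.
by rewrite -[f]psiK -rmorphM e rmorph0.
Qed.

(** * Words of operators and word polynomials *)

Section DifferenceOperators.
Variables (Q : quiver) (R : base_ring (edge Q)) (P : poly_functor R).
Variables (W : finType) (col : W -> vertex Q).
Variables (L : comPzRingType) (iota : {rmorphism P W -> L}).
Variables (t : monoid_action {ffun W -> nat} L) (coef : W -> L).
Notation x := (pX P).
Notation C := (pC P W).
Notation cells := (@cells W).
Notation wcomb := (word_comb_poly C (cell_col col) (@cell_val Q R P W)).
Hypothesis iota_lreg : forall f, GRing.lreg f -> GRing.lreg (iota f).
Hypothesis iota_shift : forall p f, t (unit_vec p) (iota f) = iota (var_shift P p f).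
Hypothesis coefE : forall p, iota (\prod_(s | s != p) Pf P col (p, 0%N) s) * coef p =
  iota (\prod_(s | s != p) Nf P col (p, 0%N) s).
Implicit Types (A B : {ffun W -> nat}) (p q r : W).

Definition letter_op (l : vertex Q * nat) : skew t :=
  \sum_(p | col p == l.1) << iota (x p ^+ l.2) * coef p *g unit_vec p >>.

Definition const_op (r : R) : skew t := << iota (C r) *g 0 >>.

Lemma remove_unit A p : (0 < A p)%N -> exists B, A = B + unit_vec p.
Proof.
move=> Ap; exists [ffun q => (A q - (q == p))%N]; apply/ffunP => q.
by rewrite add_unitE ffunE subnK //; case: eqVneq => // ->.
Qed.

(** Induction on the word: a leading u_p contributes its own coefficient and shifts the rest, and
    [coef_step] is the resulting change of the fixed fraction. *)
Lemma coef_word s A : iota (coef_den P col A) * (\prod_(l <- s) letter_op l)@_A =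
  iota (coef_num P col A * word_poly C (cell_col col) (@cell_val Q R P W) s (cells A)).
Proof.
elim: s A => [|[i d] s IH] A.
  rewrite big_nil /word_poly /= [X in X@_A](_ : _ = << 1 *g 0 >>) // mcoeffU eq_sym.
  have -> : (cells A == fset0) = (A == 0).
    apply/eqP/eqP => [e|->]; last exact: cells0.
    apply/ffunP => p; rewrite ffunE; apply/eqP; rewrite -leqn0 leqNgt.
    by rewrite -(in_cells A (p, 0%N)) e inE.
  case: eqP => [->|_]; last by rewrite !mulr0 rmorph0.
  by rewrite coef_num0 coef_den0 rmorph1 !mulr1 rmorph1.
rewrite big_cons {1}/letter_op mulr_suml raddf_sum mulr_sumr word_poly_cells mulr_sumr rmorph_sum.
rewrite [RHS]big_mkcondr /=; apply: eq_bigr => p cp; case: ifP => Ap; last first.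
  rewrite mcoeff_skewU0 ?mulr0 // => B; apply/eqP => e; move: Ap.
  by rewrite -e addrC add_unitE eqxx addn1.
have [B eB] := remove_unit Ap; rewrite {A Ap}eB cells_shift word_poly_shift.
rewrite [X in _@_X]addrC mcoeff_skewU; last first.
  by move=> a b /ffunP e; apply/ffunP => q; have := e q; rewrite !ffunE => /addnI.
set g := \prod_(l <- s) _; pose cd := \prod_(s' | s' != p) Pf P col (p, 0%N) s'.
have lcd : GRing.lreg (iota cd).
  apply/iota_lreg/lreg_prod => q qp; rewrite /Pf; case: ifP => _; last exact: lreg1.
  rewrite cell_val0; apply: lreg_diff; by rewrite eq_sym.
have lsh : GRing.lreg (iota (var_shift P p (coef_den P col B))).
  exact/iota_lreg/lreg_var_shift/lreg_coef_den.
rewrite big_imfset /=; last by move=> z z' _ _ /cell_shift_inj.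
(* The two sides are compared after multiplication by the denominator of the letter and the shifted
   [coef_den], both regular. *)
apply: (lregM lcd lsh); move: (coef_step P col B p) (IH B); rewrite -/g -/cd.
move: (coef_den P col (B + _)) (coef_den P col B) (coef_num P col (B + _)) (coef_num P col B).
move: (\prod_(z <- _) _) (word_poly _ _ _ _ _) (g@_B) => G w gB D dB N nB eS eB {lsh IH}.
have := congr1 (t (unit_vec p)) eB; rewrite rmorphM !iota_shift => {}eB.
have := congr1 iota eS; rewrite !rmorphM -coefE -/cd.
move: eB; rewrite !rmorphM.
move: (iota D) (coef p) (iota (x p ^+ d)) (t _ _) (iota cd) (iota N) (iota G).
move: (iota (var_shift P p dB)) (iota (var_shift P p nB)) (iota (var_shift P p w)).
move=> {}dB {}nB {}w {}D c' X g' kd {}N {}G eB {}eS.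
transitivity (D * (kd * c') * X * (dB * g')); first by ring.
rewrite eB; transitivity (D * (kd * c') * nB * X * w); first by ring.
by rewrite eS; ring.
Qed.

Lemma coef_word_comb (T : word_comb R) A :
  iota (coef_den P col A) * (word_comb_el const_op letter_op T)@_A =
  iota (coef_num P col A * wcomb T (cells A)).
Proof.
elim: T => [|t' T IH].
  by rewrite /word_comb_el /word_comb_poly !big_nil mcoeff0 !mulr0 rmorph0.
rewrite /word_comb_el big_cons mcoeffD mulrDr -/(word_comb_el const_op letter_op T) IH.
rewrite /word_comb_poly big_cons mulrDr rmorphD; congr (_ + _).
rewrite mcoeff_skewC mulrCA coef_word; move: (coef_num _ _ _) (word_poly _ _ _ _ _) => a w.
rewrite !rmorphM; ring.
Qed.

(** Both parts of the fixed fraction are regular. Relations between operators thus become vanishing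
    at strings, a condition that can be compared for different v. *)
Lemma word_comb_op_eq0 (T : word_comb R) : (forall f, iota f = 0 -> f = 0) ->
  word_comb_el const_op letter_op T = 0 <-> forall A, wcomb T (cells A) = 0.
Proof.
move=> iotaI; split=> [e A|e].
  apply: (@lreg_coef_num _ R P _ col A); rewrite mulr0; apply: iotaI.
  by rewrite -coef_word_comb e mcoeff0 mulr0.
apply/malgP => A; apply: (iota_lreg (@lreg_coef_den _ R P _ col A)).
by rewrite coef_word_comb e mulr0 rmorph0 mcoeff0 mulr0.
Qed.

End DifferenceOperators.

(** * The generators M_m(f) as combinations of words *)

Section FlatWords.
Variables (Q : quiver) (R : base_ring (edge Q)) (P : poly_functor R).
Variables (V : finType) (col : V -> vertex Q).
Notation C := (pC P V).
Implicit Types (f : P V).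

Definition flat_root : P V :=
  \prod_p \prod_(q | (p != q) && (col p == col q)) (pX P p - pX P q - C (bhbar R)).

Lemma flat_root_weight : root_weight P col (fun=> 0%N) = flat_root.
Proof. by apply: eq_bigr => p _; apply: eq_bigl => q; rewrite andbT. Qed.

Lemma flat_layer_weight :
  layer_weight P col (fun=> 0%N) = flat_root * discriminant P col.
Proof.
rewrite layer_weightE flat_root_weight; congr (_ * _).
  rewrite [X in _ * X](_ : _ = 1) ?mulr1 // /edge_weight.
  by rewrite big1 // => e _; rewrite big1 // => p _; rewrite big1.
rewrite [X in _ * X](_ : _ = 1) ?mulr1.
  by apply: eq_bigr => p _; apply: eq_bigl => q; rewrite andbT.
by rewrite /cross_weight big1 // => p _; rewrite big_pred0 // => q; rewrite andbF.
Qed.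

(** For the constant layering there are no edge factors and the weight is symmetric, so
    symmetrization multiplies a symmetric multiple of it by the number N of color permutations. *)
Lemma flat_words f : color_symmetric col f -> exists2 r : R, GRing.lreg r &
  exists2 T : word_comb R, homogeneous_comb (colors col) T &
  C r * (f * (flat_root * discriminant P col)) = word_comb_poly C col (pX P) T full.
Proof.
move=> sf; have [r lr sr] := unit_ideal P col (fun=> 0%N).
have [T hT eT] := sr f; pose N := #|[pred t : {perm V} | color_perm col t]|.
have N0 : (0 < N)%N.
  by apply/card_gt0P; exists 1%g; rewrite inE; apply/color_permP => p; rewrite perm1.
exists (N%:R * r); first by apply: lregM => //; exact: lreg_bnat.
exists T => //; rewrite -eT -flat_layer_weight.
rewrite /symmetrize (eq_bigr (fun=> f * C r * layer_weight P col (fun=> 0%N))).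
  move: (layer_weight _ _ _) => lw; rewrite big_const iter_addr addr0 -/N -[RHS]mulr_natl.
  rewrite (rmorphM C) rmorph_nat; ring.
move=> t ct; rewrite (rmorphM (perm_act P t)) layer_weight_act; last first.
  by apply/color_permP => p; rewrite (color_permP _ _ ct).
by rewrite rmorphM perm_actC sf.
Qed.

End FlatWords.

Section FlatCoefficients.
Variables (Q : quiver) (R : base_ring (edge Q)) (P : poly_functor R).
Variables (V W : finType) (colV : V -> vertex Q) (col : W -> vertex Q).
Notation C := (pC P W).
Notation cells := (@cells W).
Notation placement := (placement colV col).
Implicit Types (A B : {ffun W -> nat}) (p q r s : W) (H : {set W}).

Lemma big_placement_cells (M : Type) (u : M) (op : Monoid.com_law u) A b (F : W * nat -> M) :
  placement A b -> \big[op/u]_p F (b p) = \big[op/u]_(z <- cells A) F z.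
Proof.
move=> pb; rewrite -(big_map b predT F); apply: perm_big; apply: uniq_perm.
- by rewrite map_inj_uniq ?index_enum_uniq //; exact: (place_inj pb).
- exact: fset_uniq.
move=> [r c]; rewrite in_cells; apply/mapP/idP => [[p _ ->]|/(place_surj pb)[p e]].
  exact: (place_lt pb).
by exists p; rewrite ?mem_index_enum.
Qed.

Lemma placement_image A b : placement A b -> [fset b p | p in @full V]%fset = cells A.
Proof.
move=> pb; apply/fsetP => -[r c]; rewrite in_cells; apply/imfsetP/idP => [[p _ ->]|].
  exact: (place_lt pb).
by move=> /(place_surj pb)[p e]; exists p; rewrite ?inE.
Qed.

Lemma place_subst_words (T : word_comb R) A b : placement A b ->
  place_subst P b (word_comb_poly (pC P V) colV (pX P) T full) =
  word_comb_poly C (cell_col col) (@cell_val Q R P W) T (cells A).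
Proof.
move=> pb; rewrite -(placement_image pb) rmorph_sum; apply: eq_bigr => t _.
rewrite rmorphM place_substC; congr (_ * _).
apply: word_poly_map => [r|p q _ _|p _|p _]; [exact: pSC | exact: (place_inj pb) | |].
  exact: (place_col pb).
exact: place_substX.
Qed.

Definition indicator H : {ffun W -> nat} := [ffun p => (p \in H) : nat].

Lemma big_cells_indicator (M : Type) (u : M) (op : Monoid.com_law u) H (F : W * nat -> M) :
  \big[op/u]_(z <- cells (indicator H)) F z = \big[op/u]_(p in H) F (p, 0%N).
Proof.
rewrite -big_enum -(big_map (fun p => (p, 0%N)) predT F); apply: perm_big.
apply: uniq_perm; rewrite ?fset_uniq //.
  by rewrite map_inj_uniq ?enum_uniq // => p q [].
move=> [p c]; rewrite in_cells /indicator ffunE /=; apply/idP/mapP => [|[q + [-> ->]]].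
  case: (boolP (p \in H)) => // pH; case: c => // _; exists p => //.
  by rewrite mem_enum.
by rewrite mem_enum => ->.
Qed.

Definition flat_num H : P W := \prod_(p in H) \prod_(s | s \notin H) Nf P col (p, 0%N) s.

Definition flat_den H : P W := \prod_(p in H) \prod_(s | s \notin H) Pf P col (p, 0%N) s.

(** At strings of length 1 the fixed fraction times the root factors and the discriminant is the
    rational function in the definition of M_m(f). *)
Lemma flat_coef H b : placement (indicator H) b ->
  coef_den P col (indicator H) * flat_num H = coef_num P col (indicator H) * flat_den H *
  place_subst P b (flat_root P colV * discriminant P colV).
Proof.
move=> pb.
have pairs (F : W * nat -> W * nat -> P W) :
    \prod_p \prod_q F (b p) (b q) = \prod_(p in H) \prod_(q in H) F (p, 0%N) (q, 0%N).
  rewrite (big_placement_cells _ (fun z => \prod_q F z (b q)) pb) big_cells_indicator.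
  apply: eq_bigr => p _; rewrite (big_placement_cells _ (F (p, 0%N)) pb).
  by rewrite big_cells_indicator.
have b0 (p : V) : (b p).2 = 0%N.
  by have := place_lt pb p; rewrite ffunE; case: (_ \in _); case: ((b p).2).
have bne (p q : V) : (b p == b q) = (p == q) by rewrite (inj_eq (place_inj pb)).
have rootE : place_subst P b (flat_root P colV) =
    \prod_(p in H) \prod_(q in H) Sf P col (p, 0%N) (q, 0%N).
  rewrite -pairs rmorph_prod; apply: eq_bigr => p _; rewrite rmorph_prod big_mkcond.
  apply: eq_bigr => q _; rewrite /Sf bne /cell_col !(place_col pb).
  have -> : b p != ((b q).1, (b q).2.+1).
    by apply/eqP => /(congr1 snd) /=; rewrite b0.
  rewrite andbT andbC; case: ifP => _ //.
  by rewrite !rmorphB !place_substX place_substC.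
have discE : place_subst P b (discriminant P colV) =
    \prod_(p in H) \prod_(q in H) Pf P col (p, 0%N) q.
  rewrite -(pairs (fun z z' => Pf P col z z'.1)) rmorph_prod; apply: eq_bigr => p _.
  rewrite rmorph_prod big_mkcond; apply: eq_bigr => q _; rewrite /Pf /cell_col !(place_col pb).
  have -> : ((b q).1, 0%N) = b q by rewrite [RHS]surjective_pairing b0.
  rewrite bne andbC; case: ifP => _ //.
  by rewrite rmorphB !place_substX -(cell_val0 P (b q).1) /cell_val /= (b0 q).
have numE : coef_num P col (indicator H) =
    (\prod_(p in H) \prod_(q in H) Nf P col (p, 0%N) q) * flat_num H.
  rewrite /coef_num big_cells_indicator -big_split; apply: eq_bigr => p _.
  by rewrite (bigID (mem H)).
have denE : coef_den P col (indicator H) =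
    (\prod_(p in H) \prod_(q in H) Nf P col (p, 0%N) q)
    * ((\prod_(p in H) \prod_(q in H) Pf P col (p, 0%N) q) * flat_den H)
    * \prod_(p in H) \prod_(q in H) Sf P col (p, 0%N) (q, 0%N).
  rewrite /coef_den !big_cells_indicator; congr (_ * _ * _).
  - apply: eq_bigr => p _; rewrite big_cells_indicator; apply: eq_bigr => q _.
    by rewrite /Qf cell_val0.
  - by rewrite -big_split; apply: eq_bigr => p _; rewrite (bigID (mem H)).
  - by apply: eq_bigr => p _; rewrite big_cells_indicator.
rewrite rmorphM rootE discE numE denE; ring.
Qed.

End FlatCoefficients.

Lemma lreg_loc_in (B : comPzRingType) (S : central_mulset B) (b : B) :
  GRing.lreg b -> GRing.lreg (loc_in S b).
Proof.
have S1 := cms1 S; move=> /lreg0 lb; apply/lreg0 => h.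
have [a [s [Ss ->]]] := fracP h; rewrite fracM // => e.
have [u Su] : exists2 u, S u & u * (1 * (b * a)) = u * (1 * s * 0).
  by apply/(frac_eq _ _ (cmsM S1 Ss) S1); exact: e.
rewrite mulr0 mulr0 mul1r mulrCA => /lb ua0.
by apply/(frac_eq _ _ Ss S1); exists u; rewrite // mul1r ua0 !mulr0.
Qed.

Lemma loc_in_inj0 (B : comPzRingType) (S : central_mulset B) (b : B) :
  (forall s, S s -> GRing.lreg s) -> loc_in S b = 0 -> b = 0.
Proof.
move=> lS /(frac_eq _ _ (cms1 S) (cms1 S)) [u Su]; rewrite !mul1r mulr0.
by move/lreg0: (lS u Su); apply.
Qed.

Lemma loc_cross (B : comPzRingType) (S : central_mulset B) (a b c d e : B) : S d ->
  a * (b * c) = e * d -> loc_in S a * (loc_in S b * frac S c d) = loc_in S e.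
Proof.
move=> Sd eq; apply: (loc_in_cancel Sd).
have <- : loc_in S (a * (b * c)) = loc_in S d * loc_in S e by rewrite eq mulrC rmorphM.
by rewrite mulrCA [loc_in S d * (_ * _)]mulrCA loc_inM // !rmorphM.
Qed.

Lemma skew_prod_unit (K : nmodType) (L : comPzRingType) (t : monoid_action K L)
    (T : Type) (l : seq T) (D : pred T) (a : T -> K) :
  \prod_(i <- l | D i) (<< 1 *g a i >> : skew t) = << 1 *g \sum_(i <- l | D i) a i >>.
Proof.
elim: l => [|i l IH]; first by rewrite !big_nil.
rewrite !big_cons IH; case: ifP => // _.
by rewrite [LHS]skew_mulUU rmorph1 mulr1.
Qed.

Section SumCoefficients.
Variables (K : choiceType) (L : comPzRingType) (T : finType) (D : pred T).
Variables (c : T -> L) (a : T -> K).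

Lemma mcoeff_sumU i : injective a -> D i ->
  (\sum_(j | D j) << c j *g a j >>)@_(a i) = c i.
Proof.
move=> aI Di; rewrite raddf_sum (bigD1 i) //= mcoeffUU big1 ?addr0 // => j /andP[_ ji].
by rewrite mcoeffU (inj_eq aI) (negbTE ji).
Qed.

Lemma mcoeff_sumU0 A : (forall i, D i -> a i <> A) ->
  (\sum_(j | D j) << c j *g a j >>)@_A = 0.
Proof.
by move=> aA; rewrite raddf_sum big1 //= => j /aA /eqP/negbTE jA; rewrite mcoeffU jA.
Qed.

End SumCoefficients.

Lemma count_cells (W : finType) (A : {ffun W -> nat}) (D : pred W) :
  count (fun z => D z.1) (cells A) = (\sum_(p | D p) A p)%N.
Proof.
have /seq.permP -> : perm_eq (cells A) [seq (p, c) | p <- enum W, c <- iota 0 (A p)].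
  apply: uniq_perm; [exact: fset_uniq | | by move=> z; rewrite !inE].
  apply: allpairs_uniq_dep; first exact: enum_uniq.
    by move=> p _; exact: iota_uniq.
  by move=> [p c] [p' c'] _ _ /= [-> ->].
rewrite -sum1_count big_mkcond big_allpairs_dep big_enum [RHS]big_mkcond.
apply: eq_bigr => p _ /=; case: (D p); last by rewrite big1.
by rewrite sum1_size size_iota.
Qed.

Section FlatSingleton.
Variables (Q : quiver) (R : base_ring (edge Q)) (P : poly_functor R).
Variables (W : finType) (col : W -> vertex Q) (p : W).

Lemma flat_num1 : flat_num P col [set p] = \prod_(s | s != p) Nf P col (p, 0%N) s.
Proof. by rewrite /flat_num big_set1; apply: eq_bigl => s; rewrite inE. Qed.

Lemma flat_den1 : flat_den P col [set p] = \prod_(s | s != p) Pf P col (p, 0%N) s.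
Proof. by rewrite /flat_den big_set1; apply: eq_bigl => s; rewrite inE. Qed.

End FlatSingleton.

Section BlockSets.
Variables (Q : quiver) (R : base_ring (edge Q)) (P : poly_functor R).
Variable v : {ffun vertex Q -> nat}.
Notation W := (widx v).
Notation color := (fun p : widx _ => tag p).

Definition block_set (G : subset_tuple v) : {set W} := [set p | tagged p \in G (tag p)].

Lemma in_block_set (G : subset_tuple v) i (r : 'I_(v i)) :
  (mkidx r \in block_set G) = (r \in G i).
Proof. by rewrite inE. Qed.

Lemma block_set_inj : injective block_set.
Proof.
move=> G G' e; apply/ffunP => i; apply/setP => r.
by rewrite -!in_block_set e.
Qed.

Lemma big_widx_cond (M : Type) (u : M) (op : Monoid.com_law u) i (D : pred W) (F : W -> M) :
  \big[op/u]_(p | (tag p == i) && D p) F p =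
  \big[op/u]_(r : 'I_(v i) | D (mkidx r)) F (mkidx r).
Proof. by rewrite big_mkcondr big_widx -big_mkcond. Qed.

Lemma flat_numE (G : subset_tuple v) :
  \prod_e \prod_(r in G (src e)) \prod_(s in ~: G (tgt e))
    (pX P (mkidx s) - pX P (mkidx r) + pC P W (bth R e - bhh R)) =
  flat_num P color (block_set G).
Proof.
pose F e p q := pX P q - pX P p + pC P W (bth R e - bhh R).
transitivity (\prod_e \prod_(p in block_set G) \prod_(s | s \notin block_set G)
   (if (src e == tag p) && (tgt e == tag s) then F e p s else 1)).
  apply: eq_bigr => e _.
  transitivity (\prod_(p | (tag p == src e) && (p \in block_set G))
      \prod_(s | (tag s == tgt e) && (s \notin block_set G)) F e p s).
    rewrite big_widx_cond; apply: eq_big => r; first by rewrite in_block_set.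
    by move=> _; rewrite big_widx_cond; apply: eq_bigl => s; rewrite in_block_set inE.
  rewrite big_mkcondl /=; apply: eq_bigr => p _; rewrite [src e == _]eq_sym.
  case: eqP => _ /=; last by rewrite big1.
  rewrite big_mkcondl /=; apply: eq_bigr => s _; by rewrite [tgt e == _]eq_sym.
rewrite exchange_big; apply: eq_bigr => p _; rewrite exchange_big; apply: eq_bigr => s _.
by rewrite /Nf cell_val0 [RHS]big_mkcond.
Qed.

Lemma flat_denE (G : subset_tuple v) :
  \prod_i \prod_(r in G i) \prod_(s in ~: G i) (pX P (mkidx r) - pX P (mkidx s)) =
  flat_den P color (block_set G).
Proof.
transitivity (\prod_i \prod_(p in block_set G) \prod_(s | s \notin block_set G)
   (if (tag p == i) && (tag s == i) then pX P p - pX P s else 1)).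
  apply: eq_bigr => i _.
  transitivity (\prod_(p | (tag p == i) && (p \in block_set G))
      \prod_(s | (tag s == i) && (s \notin block_set G)) (pX P p - pX P s)).
    rewrite big_widx_cond; apply: eq_big => r; first by rewrite in_block_set.
    by move=> _; rewrite big_widx_cond; apply: eq_bigl => s; rewrite in_block_set inE.
  rewrite big_mkcondl /=; apply: eq_bigr => p _.
  case: eqP => _ /=; last by rewrite big1.
  by rewrite big_mkcondl.
rewrite exchange_big; apply: eq_bigr => p pG; rewrite exchange_big; apply: eq_bigr => s sG.
rewrite /Pf cell_val0 /cell_col /= (bigD1 (tag p)) //= eqxx [X in _ * X]big1 ?mulr1.
  have -> : (p, 0%N) != (s, 0%N) by apply: contraNneq sG => -[<-].
  by rewrite andbT eq_sym.
by move=> i /negbTE ip; rewrite eq_sym ip.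
Qed.

Lemma indicator_inj : injective (@indicator W).
Proof.
by move=> H H' /ffunP e; apply/setP => p; have := e p; rewrite !ffunE; do 2?case: (_ \in _).
Qed.

Lemma card_block_set (G : subset_tuple v) i :
  (\sum_(r < v i) indicator (block_set G) (mkidx r))%N = #|G i|.
Proof.
by rewrite -sum1_card [RHS]big_mkcond; apply: eq_bigr => r _; rewrite ffunE in_block_set; case: ifP.
Qed.

Lemma block_set_sum (G : subset_tuple v) :
  \sum_i \sum_(r in G i) [ffun p => (p == mkidx r) : nat] = indicator (block_set G).
Proof.
apply/ffunP => p; rewrite sum_ffunE ffunE (bigD1 (tag p)) //= [X in _ + X]big1 ?addr0.
  rewrite sum_ffunE big_mkcond (bigD1 (tagged p)) //= mkidxK ffunE eqxx.
  rewrite [X in _ + X]big1 ?addr0; first by rewrite inE; case: ifP.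
  move=> r rp; case: ifP => // _; rewrite ffunE; case: eqP => // e.
  by case/negP: rp; apply/eqP/mkidx_inj; rewrite -e mkidxK.
move=> i ip; rewrite sum_ffunE big1 // => r _; rewrite ffunE.
by case: eqP => // e; rewrite e eqxx in ip.
Qed.

Lemma flat_string_positions (G : subset_tuple v) i :
  string_positions (fun i r => indicator (block_set G) (mkidx r)) i =
  [seq (mkidx r, 0%N) | r <- enum (G i)].
Proof.
rewrite /string_positions [in RHS]/enum_mem -enumT; elim: (enum 'I_(v i)) => //= r l ->.
by rewrite ffunE in_block_set; case: ifP.
Qed.

Section FlatValues.
Variables (m : {ffun vertex Q -> nat}) (f : P (widx m)) (rho : R) (T : word_comb R).
Notation C := (pC P W).
Notation wcomb := (word_comb_poly C (cell_col color) (@cell_val Q R P W) T).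
Hypothesis hT : homogeneous_comb m T.
Hypothesis eT : pC P (widx m) rho * (f * (flat_root P color * discriminant P color)) =
  word_comb_poly (pC P (widx m)) color (pX P) T full.

Lemma flat_value (G : subset_tuple v) : (forall i, #|G i| = m i) ->
  coef_den P color (indicator (block_set G))
  * (C rho * (pS P (fun p : widx m => nth 0 [seq pX P (mkidx r) | r <- enum (G (tag p))] (tagged p)) f
              * flat_num P color (block_set G))) =
  coef_num P color (indicator (block_set G)) * wcomb (cells (indicator (block_set G)))
    * flat_den P color (block_set G).
Proof.
move=> Gm; have An i := etrans (card_block_set G i) (Gm i).
have [b pb hb] := string_placement An.
have eA : [ffun r : W => indicator (block_set G) (mkidx (tagged r))] = indicator (block_set G).
  by apply/ffunP => p; rewrite ffunE mkidxK.
rewrite eA in pb.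
have -> : pS P (fun p : widx m => nth 0 [seq pX P (mkidx r) | r <- enum (G (tag p))] (tagged p)) f
    = place_subst P b f.
  apply: eq_pS => p; have lt : (tagged p < size (enum (G (tag p))))%N.
    by rewrite -cardE Gm.
  have r0 : 'I_(v (tag p)) by case: (enum _) lt.
  rewrite -(hb p (mkidx r0, 0%N)) flat_string_positions !(nth_map r0) //=.
  by rewrite /string_val rmorph0 addr0.
rewrite -(place_subst_words P T pb) -eT !rmorphM place_substC.
have := flat_coef P pb; rewrite rmorphM.
move: (coef_den _ _ _) (coef_num _ _ _) (flat_num _ _ _) (flat_den _ _ _) (C rho).
move: (place_subst P b f) (place_subst P b (flat_root _ _)) (place_subst P b (discriminant _ _)).
move=> fb rb db D N fn fd r e.
by transitivity (fb * r * (D * fn)); [ring | rewrite e; ring].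
Qed.

(** A string of length at least 2 would have to increase in the constant layering, so the root
    weight kills it. If all lengths are at most 1, then A is the indicator of a tuple, and wrong
    color counts give 0 by homogeneity. *)
Lemma flat_value0 (A : {ffun W -> nat}) :
  (forall G : subset_tuple v, (forall i, #|G i| = m i) -> indicator (block_set G) <> A) ->
  wcomb (cells A) = 0.
Proof.
move=> nG; have [An|] := pselect (forall i, (\sum_(r < v i) A (mkidx r))%N = m i).
  have [b pb _] := string_placement An.
  have eA : [ffun r : W => A (mkidx (tagged r))] = A.
    by apply/ffunP => p; rewrite ffunE mkidxK.
  rewrite eA in pb; rewrite -(place_subst_words P T pb) -eT !rmorphM.
  have [->|/eqP nz] := eqVneq (place_subst P b (flat_root P color)) 0.
    by rewrite !mul0r !mulr0.
  rewrite -flat_root_weight in nz; have inc := chain_increasing pb nz.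
  have A1 p : (A p <= 1)%N.
    rewrite leqNgt; apply/negP => Ap.
    have [q0 e0] := place_surj pb (ltnW Ap); have [q1 e1] := place_surj pb Ap.
    by have := inc q0 q1; rewrite e0 e1 => /(_ erefl erefl); rewrite ltnn.
  pose G : subset_tuple v := [ffun i => [set r | A (mkidx r) == 1%N]].
  have eG : indicator (block_set G) = A.
    apply/ffunP => p; rewrite -(mkidxK p) ffunE in_block_set ffunE inE mkidxK.
    by have := A1 p; case: (A p) => [|[]].
  case: (nG G) => // i; by rewrite -(card_block_set G i) eG.
move=> /existsNP[i /eqP ne]; apply: (@word_poly_comb0 _ R _ C _ _ _ m T _ i hT).
by apply: contraNneq ne => <-; rewrite (count_cells A (fun p => tag p == i)) big_widx.
Qed.

End FlatValues.

End BlockSets.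

Section GeneratorCoefficients.
Variables (k : comNzRingType) (rat_in_k : {rmorphism rat -> k}) (Q : quiver).
Notation I := (vertex Q).
Notation R := (quiver_base rat_in_k Q).
Notation P := (mvpoly_functor R).
Variable v : {ffun I -> nat}.
Notation W := (widx v).
Notation color := (fun p : widx _ => tag p).
Notation S := (generated_mulset (@wset k Q v)).
Notation iota := (loc_in S).
Notation fnum := (@flat_num Q R P W color).
Notation fden := (@flat_den Q R P W color).

Lemma wset_lreg s : S s -> GRing.lreg s.
Proof.
elim=> [|_ t [i [r [r' [n [ne ->]]]]] _ lt]; first exact: lreg1.
apply: lregM; last exact: lt.
apply: (@lreg_form _ P W (mkidx r') (mkidx r)).
by apply: contraNneq ne => /mkidx_inj ->.
Qed.

Lemma wvar_diff_mulset i (r r' : 'I_(v i)) : r != r' -> S (wvar k r - wvar k r').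
Proof.
move=> ne; rewrite -[X in S X]mulr1; apply: mulset_genM; last exact: mulset_gen1.
by exists i, r, r', 0; split; last by rewrite mulr0z rmorph0 addr0.
Qed.

Lemma flat_den_mulset (H : {set W}) : S (fden H).
Proof.
have gm := @cmsM _ S; have g1 := cms1 S.
apply: (big_ind S g1 gm) => p pH; apply: (big_ind S g1 gm) => s sH.
rewrite /Pf; case: ifP => [/andP[/eqP cps _]|_]; last exact: g1.
rewrite cell_val0; case: p s pH sH cps => [i r] [j r'] pH sH /= cps; rewrite /cell_col /= in cps.
subst j; apply: wvar_diff_mulset; apply: contraNneq sH => <-; exact: pH.
Qed.

Definition letter_coef p : Lam_loc k v := frac S (fnum [set p]) (fden [set p]).

Lemma letter_coefE p : iota (\prod_(s | s != p) Pf P color (p, 0%N) s) * letter_coef p =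
  iota (\prod_(s | s != p) Nf P color (p, 0%N) s).
Proof.
rewrite -(flat_den1 P color) -(flat_num1 P color); exact: loc_inM (flat_den_mulset _).
Qed.

Lemma iota_shift p f : wshift_action k v (unit_vec p) (iota f) = iota (var_shift P p f).
Proof. 
rewrite [LHS]loc_rmorphismE; last exact: cms1. 
by rewrite rmorph1.
Qed.

Lemma Mop_sum m (f : Lam k m) : Mop v f =
  \sum_(G : subset_tuple v | [forall i, #|G i| == m i])
    << frac S (evaluate (fun i => [seq wvar k r | r <- enum (G i)]) f * fnum (block_set G))
         (fden (block_set G)) *g indicator (block_set G) >>.
Proof.
apply: eq_bigr => G _.
have -> : \prod_i \prod_(r in G i) uvar k r = << 1 *g indicator (block_set G) >>.
  rewrite -(block_set_sum G) -(skew_prod_unit (wshift_action k v)).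
  by apply: eq_bigr => i _; rewrite -(skew_prod_unit (wshift_action k v)).
have eN : M_num k G = fnum (block_set G) := @flat_numE Q R P v G.
have eD : M_den k G = fden (block_set G) := @flat_denE Q R P v G.
rewrite -eN -eD [LHS]skew_mulUU act0 add0r mulr1; exact: erefl.
Qed.

Notation lop := (letter_op (P := P) color iota (wshift_action k v) letter_coef).
Notation cop := (const_op (P := P) (W := W) iota (wshift_action k v)).

Lemma word_op_coef (T : word_comb R) A :
  iota (coef_den P color A) * (word_comb_el cop lop T)@_A =
  iota (coef_num P color A * word_comb_poly (pC P W) (cell_col color) (@cell_val Q R P W) T (cells A)).
Proof.
have H1 := fun f => @lreg_loc_in _ S f.
have H2 := iota_shift.
have H3 := letter_coefE.
have H := @coef_word_comb Q R P W color _ _ (wshift_action k v) letter_coef H1 H2 H3 T A.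
exact: H.
Qed.

(** Comparison of coefficients: [flat_value] at the indicators of tuples of the right sizes,
    [flat_value0] elsewhere. *)
Lemma Mop_words m (f : Lam k m) (rho : R) (T : word_comb R) :
  homogeneous_comb m T ->
  pC P (widx m) rho * (f * (flat_root P color * discriminant P color)) =
    word_comb_poly (pC P (widx m)) color (pX P) T full ->
  Acoef_const v rho * Mop v f = word_comb_el cop lop T.
Proof.
move=> hT eT; apply/malgP => A.
apply: (@lreg_loc_in _ S _ (@lreg_coef_den Q R P W color A)).
rewrite word_op_coef.
have -> : (Acoef_const v rho * Mop v f)@_A = iota (pC P W rho) * (Mop v f)@_A :=
  @mcoeff_skewC _ _ (wshift_action k v) (iota (pC P W rho)) (Mop v f) A.
rewrite Mop_sum.
have [[G [Gm eA]]|noG] := pselect (exists G : subset_tuple v,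
    (forall i, #|G i| = m i) /\ indicator (block_set G) = A); last first.
  have -> := @flat_value0 Q R P v m f rho T hT eT A.
    rewrite mcoeff_sumU0 => [|G /forallP Gm eA]; first by rewrite !mulr0 rmorph0.
    by case: noG; exists G; split=> // i; exact/eqP.
  by move=> G Gm eA; case: noG; exists G.
rewrite -{}eA.
rewrite (@mcoeff_sumU _ _ _ _ _ (fun G => indicator (block_set G)) G (inj_comp (@indicator_inj Q v) (@block_set_inj Q v))); last first.
  by apply/forallP => i; rewrite Gm.
have E := @flat_value Q R P v m f rho T eT G Gm.
exact: (loc_cross (flat_den_mulset (block_set G)) E).
Qed.

End GeneratorCoefficients.

(** * The positive part of the quantized zastava *)

Section SingleLetter.
Variables (Q : quiver) (R : base_ring (edge Q)) (P : poly_functor R) (l : vertex Q * nat).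
Notation V := (widx (@simple_root Q l.1)).
Notation color := (fun p : widx _ => tag p).

Lemma single_letter_content : homogeneous_comb (simple_root l.1) [:: (1 : R, [:: l])].
Proof.
rewrite /homogeneous_comb /= andbT; apply/eqP/ffunP => i.
by rewrite !ffunE /= addn0.
Qed.

Lemma single_letter_words :
  pC P V 1 * (pX P (simple_idx l.1) ^+ l.2 * (flat_root P color * discriminant P color)) =
  word_comb_poly (pC P V) color (pX P) [:: (1, [:: l])] full.
Proof.
have all_eq (p q : V) : p = q by rewrite (simple_idx_eq p) (simple_idx_eq q).
have empty (F : V -> V -> P V) :
    \prod_p \prod_(q | (p != q) && (tag p == tag q)) F p q = 1.
  rewrite big1 // => p _; rewrite big1 // => q /andP[/eqP pq _].
  by case: pq; exact: all_eq.
rewrite /flat_root /discriminant !empty !mulr1 /word_comb_poly big_seq1; congr (_ * _).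
have fE : full = [fset simple_idx l.1]%fset.
  by apply/fsetP => p; rewrite !inE (simple_idx_eq p) eqxx.
case: (l) fE => i d /= fE; rewrite /word_poly /= fE big_mkcond big_seq_fset1 eqxx.
have -> : ([fset simple_idx i] `\ simple_idx i)%fset = fset0 by rewrite fsetDv.
by rewrite big_seq_fset0 eqxx !mulr1.
Qed.

End SingleLetter.

(** * Representation by words up to a regular scalar *)

Section WordRepresentatives.
Variables (Q : quiver) (R : base_ring (edge Q)) (A : pzRingType) (c : R -> A).
Hypotheses (c_mul : monoid_morphism c) (c_central : forall r a, c r * a = a * c r).
Hypothesis cN : c (-1) = -1.
Variable el : vertex Q * nat -> A.
Notation wel := (word_comb_el c el).
Implicit Types (T : word_comb R) (x y : A) (n : {ffun vertex Q -> nat}).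

Lemma word_comb_el_cat T1 T2 : wel (T1 ++ T2) = wel T1 + wel T2.
Proof. exact: big_cat. Qed.

Lemma word_comb_el_scale r T : wel (word_comb_scale r T) = c r * wel T.
Proof.
rewrite /word_comb_el big_map mulr_sumr; apply: eq_bigr => t _ /=.
by rewrite c_mul.2 mulrA.
Qed.

Definition word_comb_mul T1 T2 : word_comb R :=
  [seq (t1.1 * t2.1, t1.2 ++ t2.2) | t1 <- T1, t2 <- T2].

Lemma word_comb_el_mul T1 T2 : wel (word_comb_mul T1 T2) = wel T1 * wel T2.
Proof.
rewrite /word_comb_el big_allpairs_dep mulr_suml; apply: eq_bigr => t1 _.
rewrite mulr_sumr; apply: eq_bigr => t2 _ /=.
by rewrite big_cat c_mul.2 -!mulrA; congr (_ * _); rewrite !mulrA c_central.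
Qed.

Lemma homogeneous_comb_mul n1 n2 T1 T2 : homogeneous_comb n1 T1 ->
  homogeneous_comb n2 T2 -> homogeneous_comb (n1 + n2) (word_comb_mul T1 T2).
Proof.
move=> /allP h1 /allP h2; apply/allP => t /allpairsP[[t1 t2] /= [m1 m2 ->]] /=.
apply/eqP/ffunP => i; have /eqP/ffunP/(_ i) := h1 _ m1; have /eqP/ffunP/(_ i) := h2 _ m2.
by rewrite !ffunE count_cat => -> ->.
Qed.

(** The predicate D is either homogeneity or trivial, so that the same closure properties serve
    graded components and whole rings. *)
Definition represented (D : word_comb R -> Prop) x :=
  exists2 r : R, GRing.lreg r & exists2 T, D T & c r * x = wel T.

Lemma representedB (D : word_comb R -> Prop) x y :
  (forall r T, D T -> D (word_comb_scale r T)) ->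
  (forall T1 T2, D T1 -> D T2 -> D (T1 ++ T2)) ->
  represented D x -> represented D y -> represented D (x - y).
Proof.
move=> Dscale Dcat [r lr [T DT eT]] [s ls [U DU eU]].
exists (s * r); first exact: lregM.
exists (word_comb_scale s T ++ word_comb_scale (- r) U); first by apply: Dcat; apply: Dscale.
rewrite word_comb_el_cat !word_comb_el_scale -eT -eU -[- r]mulN1r.
rewrite mulrBr !c_mul.2 cN; congr (_ + _); first by rewrite mulrA.
by rewrite -mulN1r -!mulrA; congr (_ * _); rewrite !mulrA -!c_mul.2 mulrC.
Qed.

Lemma representedM (D1 D2 D : word_comb R -> Prop) x y :
  (forall T1 T2, D1 T1 -> D2 T2 -> D (word_comb_mul T1 T2)) ->
  represented D1 x -> represented D2 y -> represented D (x * y).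
Proof.
move=> Dmul [r lr [T DT eT]] [s ls [U DU eU]].
exists (r * s); first exact: lregM.
exists (word_comb_mul T U); first exact: Dmul.
by rewrite word_comb_el_mul -eT -eU c_mul.2 -!mulrA; congr (_ * _); rewrite !mulrA c_central.
Qed.

Lemma homogeneous_representedB n x y :
  represented (homogeneous_comb n) x -> represented (homogeneous_comb n) y ->
  represented (homogeneous_comb n) (x - y).
Proof.
apply: representedB => [r T|T1 T2]; first by rewrite homogeneous_comb_scale.
by rewrite homogeneous_comb_cat => -> ->.
Qed.

Lemma represented0 (D : word_comb R -> Prop) : D [::] -> represented D 0.
Proof.
by move=> D0; exists 1; [exact: lreg1 | exists [::] => //; rewrite mulr0 /word_comb_el big_nil].
Qed.

Lemma represented1 (D : word_comb R -> Prop) : D [:: (1, [::])] -> represented D 1.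
Proof.
move=> D1; exists 1; first exact: lreg1.
by exists [:: (1, [::])] => //; rewrite mulr1 /word_comb_el big_seq1 big_nil mulr1.
Qed.

Lemma subring_represented (X : A -> Prop) x :
  (forall y, X y -> represented (fun=> True) y) -> subring_gen X x ->
  represented (fun=> True) x.
Proof.
move=> HX; elim=> {x} [x /HX //||x y _ IHx _ IHy|x y _ IHx _ IHy].
- exact: represented1.
- exact: (@representedB (fun=> True)).
- exact: (@representedM (fun=> True) (fun=> True)).
Qed.

End WordRepresentatives.

Section CellComparison.
Variables (Q : quiver) (R : base_ring (edge Q)) (P : poly_functor R).
Notation wcomb W col T A :=
  (word_comb_poly (pC P W) (cell_col col) (@cell_val Q R P W) T (cells A)).

(** Types on the smaller set are extended by empty strings, and [down] undoes the renaming of the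
    variables. *)
Lemma wcomb_sub (W W' : finType) (col : W -> vertex Q) (col' : W' -> vertex Q) (j : W' -> W)
    (T : word_comb R) :
  injective j -> (forall q, col (j q) = col' q) ->
  (forall A : {ffun W -> nat}, wcomb W col T A = 0) ->
  forall A : {ffun W' -> nat}, wcomb W' col' T A = 0.
Proof.
move=> jI jc T0 A.
pose up : {rmorphism P W' -> P W} := pS P (fun q => pX P (j q)).
pose down : {rmorphism P W -> P W'} :=
  pS P (fun p => if [pick q | j q == p] is Some q then pX P q else 0).
have upK f : down (up f) = f.
  rewrite [LHS]pS_comp -[RHS]pS_id; apply: eq_pS => q; rewrite pSX.
  by case: pickP => [q' /eqP/jI -> //|/(_ q)]; rewrite eqxx.
pose J (z : W' * nat) : W * nat := (j z.1, z.2).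
have JI : injective J by move=> [q c] [q' c'] [/jI -> ->].
pose B : {ffun W -> nat} := [ffun p => if [pick q | j q == p] is Some q then A q else 0%N].
have Bj q : B (j q) = A q.
  by rewrite ffunE; case: pickP => [q' /eqP/jI -> //|/(_ q)]; rewrite eqxx.
have im : [fset J z | z in cells A]%fset = cells B.
  apply/fsetP => -[p c]; rewrite in_cells; apply/imfsetP/idP => /= [[[q c'] qA [-> ->]]|].
    by rewrite in_cells in qA; rewrite Bj.
  rewrite ffunE; case: pickP => // q /eqP <- cA.
  by exists (q, c); rewrite ?in_cells.
rewrite -[LHS]upK -[RHS](rmorph0 down); congr (down _).
rewrite -[RHS](T0 B) -im rmorph_sum; apply: eq_bigr => t _.
rewrite rmorphM pSC; congr (_ * _).
apply: word_poly_map => [r|z z' _ _|z _|z _]; [exact: pSC | exact: JI | exact: jc |].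
by rewrite rmorphD pSX pSC.
Qed.

(** On [widx n] the strings of length 1 recover the word polynomial itself. For any v, a type of
    content n gives a specialization of it, and the other types give 0 by homogeneity. *)
Lemma wcomb_homogeneous n (T : word_comb R) : homogeneous_comb n T ->
  (forall A : {ffun widx n -> nat}, wcomb (widx n) (fun p => tag p) T A = 0) ->
  forall v (A : {ffun widx v -> nat}), wcomb (widx v) (fun p => tag p) T A = 0.
Proof.
move=> hT T0 v A.
have full0 : word_comb_poly (pC P (widx n)) (fun p => tag p) (pX P) T full = 0.
  have pb : placement (fun p : widx n => tag p) (fun p => tag p) [ffun => 1%N] (fun p => (p, 0%N)).
    split=> [p q []|//|p|r [|c]]; rewrite ?ffunE //=.
    by exists r.
  rewrite -[RHS](T0 [ffun => 1%N]) -(place_subst_words P T pb) -[LHS]pS_id.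
  by apply: eq_pS => p; rewrite /string_val rmorph0 addr0.
have [An|] := pselect (forall i, (\sum_(r < v i) A (mkidx r))%N = n i).
  have [b pb _] := string_placement An.
  have eA : [ffun r : widx v => A (mkidx (tagged r))] = A.
    by apply/ffunP => p; rewrite ffunE mkidxK.
  by rewrite eA in pb; rewrite -(place_subst_words P T pb) full0 rmorph0.
move=> /existsNP[i /eqP ne]; apply: (@word_poly_comb0 _ R _ (pC P _) _ _ _ n T _ i hT).
by apply: contraNneq ne => <-; rewrite (count_cells A (fun p => tag p == i)) big_widx.
Qed.

End CellComparison.

Lemma skewN1 (K : nmodType) (L : comPzRingType) (t : monoid_action K L) :
  << -1 *g 0 >> = -1 :> Defs.skew t.
Proof. by rewrite monalgUN. Qed.

Lemma homogeneous_comb_nil (Q : quiver) (R : base_ring (edge Q)) (r : R) :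
  homogeneous_comb 0 [:: (r, [::] : word Q)].
Proof.
by rewrite /homogeneous_comb /= andbT; apply/eqP/ffunP => i; rewrite !ffunE.
Qed.

Section PairWords.
Variables (Q : quiver) (R : base_ring (edge Q)) (A A' : pzRingType).
Variables (c : R -> A) (c' : R -> A') (el : vertex Q * nat -> A) (el' : vertex Q * nat -> A').

Definition pair_const r : A * A' := (c r, c' r).

Definition pair_letter l : A * A' := (el l, el' l).

Lemma pair_const_mul : monoid_morphism c -> monoid_morphism c' -> monoid_morphism pair_const.
Proof. by move=> [c1 cM] [c1' cM']; split=> [|r s]; rewrite /pair_const ?c1 ?c1' ?cM ?cM'. Qed.

Lemma pair_const_central : (forall r a, c r * a = a * c r) ->
  (forall r a, c' r * a = a * c' r) -> forall r x, pair_const r * x = x * pair_const r.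
Proof.
move=> cC cC' r [a b]; rewrite /pair_const.
by rewrite -[LHS]/(c r * a, c' r * b) -[RHS]/(a * c r, b * c' r) cC cC'.
Qed.

Lemma pair_constN1 : c (-1) = -1 -> c' (-1) = -1 -> pair_const (-1) = -1.
Proof. by move=> cN cN'; rewrite /pair_const cN cN'. Qed.

Lemma pair_word (T : word_comb R) : word_comb_el pair_const pair_letter T =
  (word_comb_el c el T, word_comb_el c' el' T).
Proof.
have words (s : word Q) : \prod_(l <- s) pair_letter l =
    (\prod_(l <- s) el l, \prod_(l <- s) el' l).
  by elim: s => [|l s IH]; rewrite ?big_nil // !big_cons IH.
rewrite /word_comb_el; elim: T => [|t T IH]; first by rewrite !big_nil.
by rewrite !big_cons IH words.
Qed.

End PairWords.

(** * Words and the inverse limit *)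

Section AplusWords.
Variables (k : comNzRingType) (rat_in_k : {rmorphism rat -> k}) (Q : quiver).
Notation I := (vertex Q).
Notation R := (quiver_base rat_in_k Q).
Notation P := (mvpoly_functor R).
Notation dimvec := {ffun I -> nat}.
Implicit Types (n m v w : dimvec) (T : word_comb R).
Notation color := (fun p : widx _ => tag p).
Notation iota v := (loc_in (generated_mulset (@wset k Q v))).
Notation lop v := (letter_op (P := P) color (iota v) (wshift_action k v) (letter_coef rat_in_k (v := v))).
Notation cop v := (const_op (P := P) (W := widx v) (iota v) (wshift_action k v)).

Definition Mletter v (l : I * nat) : Atilde k v := Mop v (letter_poly k l).

Definition Mword v T : Atilde k v := word_comb_el (R := R) (@Acoef_const k Q v) (Mletter v) T.

Lemma Acoef_const1 v : Acoef_const v (1 : baseR k Q) = 1.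
Proof. exact: (@Acoef_const_monoid_morphism k Q v).1. Qed.

Lemma Mletter_op v l : Mletter v l = lop v l.
Proof.
have E : Acoef_const v (1 : R) * Mletter v l =
    word_comb_el (cop v) (lop v) [:: (1, [:: l])] :=
  @Mop_words k rat_in_k Q v _ _ 1 _ (single_letter_content R l) (single_letter_words P l).
have c1 : cop v 1 = 1 := Acoef_const1 v.
have -> : Mletter v l = Acoef_const v (1 : R) * Mletter v l.
  rewrite Acoef_const1; exact/esym/mul1r.
rewrite E /word_comb_el !big_seq1 c1; exact: mul1r.
Qed.

Lemma Mword_op v T : Mword v T = word_comb_el (cop v) (lop v) T.
Proof.
apply: eq_bigr => t _; congr (_ * _); apply: eq_bigr => l _; exact: Mletter_op.
Qed.

Lemma Mop_Mword v m (f : Lam k m) (rho : R) T :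
  homogeneous_comb m T ->
  pC P (widx m) rho * (f * (flat_root P color * discriminant P color)) =
    word_comb_poly (pC P (widx m)) color (pX P) T full ->
  Acoef_const v rho * Mop v f = Mword v T.
Proof. by move=> hT eT; rewrite Mword_op; exact: Mop_words. Qed.

Lemma Mword_eq0 v T : Mword v T = 0 <-> forall A : {ffun widx v -> nat},
  word_comb_poly (pC P (widx v)) (cell_col color) (@cell_val Q R P (widx v)) T (cells A) = 0.
Proof.
rewrite Mword_op.
have H1 := fun f => @lreg_loc_in _ (generated_mulset (@wset k Q v)) f.
have H4 f := @loc_in_inj0 _ (generated_mulset (@wset k Q v)) f (@wset_lreg k rat_in_k Q v).
exact: (@word_comb_op_eq0 Q R P (widx v) color _ _ (wshift_action k v) _ H1
  (@iota_shift k rat_in_k Q v) (@letter_coefE k rat_in_k Q v) T H4).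
Qed.

Lemma Mop_represented m (f : Lam k m) : symmetric_poly f ->
  exists2 r : R, GRing.lreg r & exists2 T, homogeneous_comb m T &
  forall v, Acoef_const v r * Mop v f = Mword v T.
Proof.
move=> sf; have [r lr [T hT eT]] := flat_words (@symmetric_poly_color k rat_in_k Q m f sf).
rewrite colors_widx in hT.
by exists r; [exact: lr | exists T; [exact: hT | move=> v; exact: (Mop_Mword v hT eT)]].
Qed.

Lemma Acoef_const_cancel v (r : R) x y : GRing.lreg r ->
  Acoef_const v r * x = Acoef_const v r * y -> x = y.
Proof.
move=> lr e; apply/malgP => A.
have lC : GRing.lreg (iota v (pC P (widx v) r)) :=
  @lreg_loc_in _ _ _ (@lreg_pC _ P (widx v) r lr).
have E z : (Acoef_const v r * z)@_A = iota v (pC P (widx v) r) * z@_A :=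
  @mcoeff_skewC _ _ (wshift_action k v) (iota v (pC P (widx v) r)) z A.
by apply: lC; rewrite -!E e.
Qed.

Lemma Acoef_constN1 v : Acoef_const v (-1 : baseR k Q) = -1.
Proof.
have e : iota v (pC P (widx v) (-1)) = -1 by rewrite !rmorphN1.
have -> : Acoef_const v (-1 : baseR k Q) = << iota v (pC P (widx v) (-1)) *g 0 >> by [].
by rewrite e; exact: (skewN1 (wshift_action k v)).
Qed.

Lemma Mword_cat v T1 T2 : Mword v (T1 ++ T2) = Mword v T1 + Mword v T2.
Proof. exact: word_comb_el_cat. Qed.

Lemma Mword_scale v (r : R) T : Mword v (word_comb_scale r T) = Acoef_const v r * Mword v T.
Proof. exact: (@word_comb_el_scale Q R _ _ (@Acoef_const_monoid_morphism k Q v)). Qed.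

Lemma Mword_sub v v' T : dimvec_le v' v -> Mword v T = 0 -> Mword v' T = 0.
Proof.
move=> /forallP le /Mword_eq0 T0; apply/Mword_eq0.
pose j (q : widx v') : widx v := mkidx (widen_ord (le (tag q)) (tagged q)).
apply: (@wcomb_sub Q R P (widx v) (widx v') color color j) T0 => // -[i r] [i' r'] e.
have /= eii := congr1 tag e; subst i'; move/mkidx_inj: e => /= e.
by congr mkidx; apply: val_inj; exact: (congr1 val e).
Qed.

Lemma Mword_homogeneous v n T : homogeneous_comb n T -> Mword n T = 0 -> Mword v T = 0.
Proof.
by move=> hT /Mword_eq0 T0; apply/Mword_eq0; exact: wcomb_homogeneous hT T0 v.
Qed.

Lemma Mop_eq0 v m (f : Lam k m) : ~~ dimvec_le m v -> Mop v f = 0.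
Proof.
move=> /forallPn[i lt]; rewrite /Mop big_pred0 // => G; apply/forallP => /(_ i) /eqP e.
by move: (max_card (G i)); rewrite card_ord e => le; rewrite le in lt.
Qed.

Lemma Acoef_constCA v (r s : R) (x : Atilde k v) :
  Acoef_const v r * (Acoef_const v s * x) = Acoef_const v s * (Acoef_const v r * x).
Proof.
have cM := (@Acoef_const_monoid_morphism k Q v).2.
by rewrite !mulrA -!cM [r * s]mulrC.
Qed.

Lemma Mword_diff v (r s : R) T U :
  Mword v (word_comb_scale r T ++ word_comb_scale (- s) U) =
  Acoef_const v r * Mword v T - Acoef_const v s * Mword v U.
Proof.
have cM := (@Acoef_const_monoid_morphism k Q v).2.
rewrite Mword_cat !Mword_scale; congr (_ + _).
have -> : - s = -1 * s by rewrite mulN1r.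
by rewrite cM Acoef_constN1 -mulrA mulN1r.
Qed.

Section Transitions.
Variables v v' : dimvec.
Notation cc := (pair_const (R := R) (@Acoef_const k Q v) (@Acoef_const k Q v')).
Notation ll := (pair_letter (Mletter v) (Mletter v')).

(** Both entries of a generating pair are represented by the same combination, also when the second
    entry is 0, since M_m(f) is an empty sum for m not below v'. *)
Lemma transition_represented x : dimvec_le v' v -> transition x ->
  represented (R := R) cc ll (fun=> True) x.
Proof.
move=> le.
have cM := pair_const_mul (R := R) (@Acoef_const_monoid_morphism k Q v) (@Acoef_const_monoid_morphism k Q v').
have cC := pair_const_central (R := R) (@Acoef_const_central k Q v) (@Acoef_const_central k Q v').
have cN := pair_constN1 (R := R) (Acoef_constN1 v) (Acoef_constN1 v').
apply: (subring_represented cM cC cN).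
move=> _ [m [f [mv sf ->]]]; have [r lr [T hT eT]] := Mop_represented sf.
have -> : (if dimvec_le m v' then Mop v' f else 0) = Mop v' f.
  by case: (boolP (dimvec_le m v')) => [//|/Mop_eq0 ->].
exists r; first exact: lr.
exists T; first by [].
rewrite pair_word -/(Mword v T) -/(Mword v' T) -!eT; exact: erefl.
Qed.

(** Let U represent (a, b) with the scalar s. Then r U - s T vanishes at v, hence at v', and s can
    be cancelled. *)
Lemma transition_words a b (r : R) T : dimvec_le v' v -> transition (a, b) ->
  Acoef_const v r * a = Mword v T -> Acoef_const v' r * b = Mword v' T.
Proof.
move=> le /(transition_represented le)[s ls [U _]]; rewrite pair_word => -[ea eb] er.
have {}ea : Acoef_const v s * a = Mword v U := ea.
have {}eb : Acoef_const v' s * b = Mword v' U := eb.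
have eU : Acoef_const v r * Mword v U = Acoef_const v s * Mword v T.
  by rewrite -ea -er Acoef_constCA.
have eU0 : Mword v (word_comb_scale r U ++ word_comb_scale (- s) T) = 0.
  by rewrite Mword_diff eU subrr.
have := Mword_sub le eU0; rewrite Mword_diff => /eqP; rewrite subr_eq0 => /eqP e.
apply: (Acoef_const_cancel ls); rewrite -e -eb; exact: Acoef_constCA.
Qed.

End Transitions.

Lemma Aplus_deg_represented v n d x : Aplus_deg n d x ->
  represented (R := R) (@Acoef_const k Q v) (Mletter v) (homogeneous_comb n) x.
Proof.
have cM := @Acoef_const_monoid_morphism k Q v; have cC := @Acoef_const_central k Q v.
elim=> {x} [x mx||x y _ IHx _ IHy].
- elim: mx => {n d x} [|n d x m c f _ IH _ sf _]; first by apply/represented1/homogeneous_comb_nil.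
  have [r lr [T hT eT]] := Mop_represented sf.
  have H : represented (R := R) (@Acoef_const k Q v) (Mletter v) (homogeneous_comb m) (Mop v f).
    by exists r; [exact: lr | exists T; [exact: hT | exact: eT]].
  exact: (@representedM Q R _ _ cM cC (Mletter v) (homogeneous_comb n) (homogeneous_comb m)
    (homogeneous_comb (n + m)) _ _ (@homogeneous_comb_mul Q R n m) IH H).
- exact: represented0.
- exact: (@homogeneous_representedB Q R _ _ cM (Acoef_constN1 v) (Mletter v) n _ _ IHx IHy).
Qed.

(** T is taken at v = n, where vanishing decides about combinations of content n. For an arbitrary
    v, a combination representing x at an upper bound w of n and v is proportional to T at n, hence
    at w, and the transition from w to v carries T along. *)
Lemma Aplus_bideg_words n d (x : Aprod k Q) : Aplus_bideg n d x ->
  exists2 r : R, GRing.lreg r & exists2 T, homogeneous_comb n T &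
  forall v, Acoef_const v r * x v = Mword v T.
Proof.
move=> [dx tx]; have [r lr [T hT eT]] := Aplus_deg_represented (dx n).
exists r; [exact: lr | exists T; [exact: hT | move=> v]].
pose w : dimvec := [ffun i => maxn (n i) (v i)].
have nw : dimvec_le n w by apply/forallP => i; rewrite ffunE leq_maxl.
have vw : dimvec_le v w by apply/forallP => i; rewrite ffunE leq_maxr.
apply: (transition_words vw (tx _ _ vw)).
have [s ls [U hU eU]] := Aplus_deg_represented (dx w).
have eUn := transition_words nw (tx _ _ nw) eU.
have hTU : homogeneous_comb n (word_comb_scale s T ++ word_comb_scale (- r) U).
  by rewrite homogeneous_comb_cat !homogeneous_comb_scale hT.
have eTU : Acoef_const n s * Mword n T = Acoef_const n r * Mword n U.
  by rewrite -(eT : _ = Mword n T) -eUn; exact: Acoef_constCA.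
have TU0 : Mword n (word_comb_scale s T ++ word_comb_scale (- r) U) = 0.
  by rewrite Mword_diff eTU subrr.
have := Mword_homogeneous w hTU TU0; rewrite Mword_diff => /eqP; rewrite subr_eq0 => /eqP e.
apply: (Acoef_const_cancel ls); rewrite e -(eU : _ = Mword w U); exact: Acoef_constCA.
Qed.

End AplusWords.

Lemma homogeneous_constU (k : comNzRingType) (Q : quiver) (V : choiceType) a (mu : {cmonom option (edge Q)}) :
  @homogeneous k Q V (mdeg mu) (pconst V << a *g mu >>).
Proof.
move=> m n; rewrite pconst.unlock mcoeffU; case: (mone =P m) => [<-|_]; last first.
  by rewrite mulr0n mcoeff0 eqxx.
rewrite mulr1n mcoeffU; case: (mu =P n) => [<-|_]; last by rewrite mulr0n eqxx.
by rewrite mdeg1.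
Qed.

Lemma pvar_exp (R : comNzRingType) (V : choiceType) (x : V) d :
  pvar R x ^+ d = << iter d (mmul (ucm x)) mone >>.
Proof.
elim: d => [//|d IH]; rewrite exprS IH pvar.unlock malg_mulUU mulr1; exact: erefl.
Qed.

Lemma homogeneous_pvar_exp (k : comNzRingType) (Q : quiver) (V : choiceType) (x : V) d :
  @homogeneous k Q V d (pvar (baseR k Q) x ^+ d).
Proof.
move=> m n; rewrite pvar_exp mcoeffU; case: (_ =P m) => [<-|_]; last first.
  by rewrite mulr0n mcoeff0 eqxx.
rewrite mulr1n mcoeff1; case: (n =P _) => [-> _|_]; last by rewrite mulr0n eqxx.
rewrite mdeg1 addn0; elim: d => [|d IH]; first by rewrite mdeg1.
by rewrite iterS mdegM mdegU IH.
Qed.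

Section EmptyWord.
Variables (Q : quiver) (R : base_ring (edge Q)) (P : poly_functor R) (r : R).
Notation V := (widx (0 : {ffun vertex Q -> nat})).
Notation color := (fun p : widx _ => tag p).

Lemma empty_word : pC P V 1 * (pC P V r * (flat_root P color * discriminant P color)) =
  word_comb_poly (pC P V) color (pX P) [:: (r, [::])] full.
Proof.
have V0 (p : V) : False by case: p => i [a]; rewrite ffunE.
have fE : @full V = fset0 by apply/fsetP => p; case: (V0 p).
rewrite /word_comb_poly big_seq1 /word_poly /= fE eqxx rmorph1 mul1r; congr (_ * _).
by rewrite /flat_root /discriminant !big1 ?mulr1 // => p; case: (V0 p).
Qed.

End EmptyWord.

Section ProductWords.
Variables (Q : quiver) (R : base_ring (edge Q)) (T : Type) (B : T -> pzRingType).
Variables (c : forall t, R -> B t) (el : forall t, vertex Q * nat -> B t).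

Lemma product_word (U : word_comb R) t :
  word_comb_el (A := prod_ring B) (fun r t => c t r) (fun l t => el t l) U t =
  word_comb_el (@c t) (@el t) U.
Proof.
have words (s : word Q) : (\prod_(l <- s) ((fun t => el t l) : prod_ring B)) t = \prod_(l <- s) el t l.
  by elim: s => [|l s IH]; rewrite ?big_nil // !big_cons -IH.
rewrite /word_comb_el; elim: U => [|u U IH]; first by rewrite !big_nil.
by rewrite !big_cons -IH -words.
Qed.

End ProductWords.

Lemma skewB (K : nmodType) (L : comPzRingType) (t : monoid_action K L) c d :
  << c - d *g 0 >> = << c *g 0 >> - << d *g 0 >> :> Defs.skew t.
Proof. exact: monalgUB. Qed.

Section AplusGenerators.
Variables (k : comNzRingType) (rat_in_k : {rmorphism rat -> k}) (Q : quiver).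
Notation I := (vertex Q).
Notation R := (quiver_base rat_in_k Q).
Notation P := (mvpoly_functor R).
Notation dimvec := {ffun I -> nat}.
Implicit Types (n m v w : dimvec) (T : word_comb R).
Notation color := (fun p : widx _ => tag p).

Lemma Mop_bideg m c (f : Lam k m) : symmetric_poly f -> homogeneous c f ->
  Aplus_bideg m (0 + (c%:Z + (pairing m m %/ 2)%Z)) (fun v => Mop v f : Atilde k v).
Proof.
move=> sf hf; split=> [v|v v' le].
  have [mv|/Mop_eq0 ->] := boolP (dimvec_le m v); last exact: zspan0.
  apply: zspan_in; have := Aplus_monomialM (Aplus_monomial1 k v) mv sf hf.
  by rewrite add0r mul1r.
have [mv|mv] := boolP (dimvec_le m v).
  apply: subring_in; exists m, f; split=> //.
  by case: (boolP (dimvec_le m v')) => [//|/Mop_eq0 ->].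
have mv' : ~~ dimvec_le m v'.
  apply: contraNN mv => /forallP mv'; apply/forallP => i.
  by apply: leq_trans (mv' i) _; exact: (forallP le i).
rewrite (Mop_eq0 _ mv) (Mop_eq0 _ mv'); exact: subring_gen0.
Qed.

Lemma Mop_const v (r : baseR k Q) : Mop v (pconst (widx 0) r) = Acoef_const v r.
Proof.
have E : Acoef_const v (1 : R) * Mop v (pconst (widx 0) r) = Mword v [:: (r : R, [::])] :=
  @Mop_Mword k rat_in_k Q v 0 _ 1 _ (homogeneous_comb_nil (r : R)) (empty_word P r).
have -> : Mop v (pconst (widx 0) r) = Acoef_const v (1 : R) * Mop v (pconst (widx 0) r).
  rewrite Acoef_const1; exact/esym/mul1r.
rewrite E /Mword /word_comb_el big_seq1 big_nil; exact: mulr1.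
Qed.

Lemma Aprod_const_zmod_morphism : zmod_morphism (@Aprod_const k Q).
Proof.
move=> r s; apply: functional_extensionality_dep => v.
pose io : {rmorphism Lam k v -> Lam_loc k v} := loc_in (generated_mulset (@wset k Q v)).
have E t : Aprod_const t v = << io (pC P (widx v) t) *g 0 >> by [].
rewrite [RHS]/(Aprod_const r v - Aprod_const s v) !E.
rewrite (etrans (congr1 io (rmorphB (pC P (widx v)) r s)) (rmorphB io _ _)).
exact: (skewB (wshift_action k v)).
Qed.

HB.instance Definition _ :=
  GRing.isZmodMorphism.Build (baseR k Q) (Aprod k Q) (@Aprod_const k Q)
    Aprod_const_zmod_morphism.

(** A scalar need not be homogeneous; it lies in the graded limit as the sum of its monomials, each
    of them of the form M_0(f). *)
Lemma Aplus_const (r : baseR k Q) : Aplus 0 (Aprod_const r).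
Proof.
rewrite (monalgE r) raddf_sum; apply: big_ind => [|x y Ax Ay|mu _]; first exact: zspan0.
  rewrite -[y]opprK -[- y]sub0r; apply: zspanB => //; apply: zspanB => //; exact: zspan0.
apply: zspan_in.
have eM : Aprod_const << r@_mu *g mu >> =
    (fun v => Mop v (pconst (widx 0) << r@_mu *g mu >>)) :> Aprod k Q.
  by apply: functional_extensionality_dep => v; exact/esym/Mop_const.
have sM : symmetric_poly (pconst (widx 0) << r@_mu *g mu >> : Lam k 0).
  by move=> s; exact: psubst_const.
have hM : homogeneous (mdeg mu) (pconst (widx 0) << r@_mu *g mu >> : Lam k 0).
  exact: (@homogeneous_constU k Q (widx 0) (r@_mu) mu).
exists (0 + ((mdeg mu)%:Z + (pairing (0%R : dimvec) 0%R %/ 2)%Z)).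
exact: (eq_ind_r (Aplus_bideg 0 _) (Mop_bideg sM hM) eM).
Qed.

Definition Aletter (l : I * nat) : Aprod k Q := fun v => Mletter k v l.

Lemma Aplus_letter i d : Aplus (simple_root i) (Aletter (i, d)).
Proof.
apply: zspan_in; exists (0 + (d%:Z + (pairing (simple_root i) (simple_root i) %/ 2)%Z)).
apply: (@Mop_bideg _ d (letter_poly k (i, d))); first exact: letter_poly_symmetric.
exact: homogeneous_pvar_exp.
Qed.

Lemma Aplus_words n (x : Aprod k Q) : Aplus n x -> exists2 r : R, GRing.lreg r &
  exists T, Aprod_const r * x = word_comb_el (R := R) (@Aprod_const k Q) Aletter T.
Proof.
suff H : Aplus n x -> represented (R := R) (@Aprod_const k Q) Aletter (fun=> True) x.
  by move=> /H[r lr [T _ eT]]; exists r => //; exists T.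
have cN : Aprod_const (-1 : baseR k Q) = -1.
  by apply: functional_extensionality_dep => v; exact: Acoef_constN1.
elim=> {x} [x [d /(Aplus_bideg_words rat_in_k)[r lr [T _ eT]]]||x y _ IHx _ IHy].
- exists r; first exact: lr.
  exists T => //; apply: functional_extensionality_dep => v; rewrite [LHS]eT.
  exact/esym/(product_word (R := R) (@Acoef_const k Q) (@Mletter k Q)).
- exact: represented0.
- exact: (@representedB Q R _ _ (@Aprod_const_monoid_morphism k Q) cN Aletter (fun=> True)).
Qed.

Lemma Aplus_loc_spherically_generated : spherically_generated (@Aplus_loc k Q).
Proof.
apply: (@localized_spherically_generated Q R _ _ (@Aprod_const_monoid_morphism k Q) (@Aprod_const_central k Q)
  (@Aplus k Q) Aletter).
- exact: Aplus_const.
- exact: Aplus_letter.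
- exact: Aplus_words.
Qed.

End AplusGenerators.

Theorem theorem1p18 (k : comNzRingType) (rat_in_k : {rmorphism rat -> k})
    (Q : quiver) :
  spherically_generated (@Aplus_loc k Q) /\
  spherically_generated (@Shuffle_loc k Q).
Proof.
by split; [exact: Aplus_loc_spherically_generated | exact: Shuffle_loc_spherically_generated].
Qed.
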